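(* There exist a positive universal constant $C_2$ and, for every $\delta>0$, positive constants $C_1(\delta), C_3(\delta)$ depending on $\delta$, such that the following holds. Let $\delta>0$ and $q\ge1$. Let $\boldsymbol{a}=(a_1,\dots,a_n)^\top\in\mathbb{C}^n$ be a random vector with independent mean-zero, variance-one entries satisfying $$\alpha_{4+\delta}:=\max_i\mathbb{E}\left[|a_i|^{4+\delta}\right]<\infty,\qquad \beta:=\min_i\mathbb{E}\left[|a_i|^4\right]>1,\qquad \gamma:=\max_i\left|\mathbb{E}\left[a_i^2\right]\right|<1,$$ and set $\zeta:=\min\{\beta-1,\,1-\gamma^2\}>0$. Define $$f:=\frac{\alpha_{4+\delta}^{\frac{32+12\delta}{(4+\delta)\delta}}}{\zeta^{3+\frac{8}{\delta}}},\qquad g:=\frac{\zeta^{\frac{4}{\delta}+1}}{\alpha_{4+\delta}^{4/\delta}},\qquad h:=g\cdot\zeta^{1/2}.$$ Let $\Omega=\{\boldsymbol{a}_k\}_{k=1}^m$ be independent copies of $\boldsymbol{a}$, and let $\mathcal{F}_\Omega$ be the phaseless operator $$\mathcal{F}_\Omega(\boldsymbol{x})=\left(|\langle\boldsymbol{a}_1,\boldsymbol{x}\rangle|^2,\dots,|\langle\boldsymbol{a}_m,\boldsymbol{x}\rangle|^2\right)^\top\in\mathbb{R}^m,\qquad\boldsymbol{x}\in\mathbb{C}^n.$$ Suppose that $m\ge C_1(\delta)\cdot f\cdot n$. Then, with probability at least $1-e^{-C_2mg^2}$, it holds that for all $\boldsymbol{x},\boldsymbol{y}\in\mathbb{C}^n$,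 $$\|\mathcal{F}_\Omega(\boldsymbol{x})-\mathcal{F}_\Omega(\boldsymbol{y})\|_{\ell_q}\ge C_3(\delta)\cdot h\cdot m^{1/q}\cdot\mathbf{dist}^2(\boldsymbol{x},\boldsymbol{y}).$$
   Context: The distance modulo global phase is $\mathbf{dist}(\boldsymbol{x},\boldsymbol{y}):=\min_{\theta\in[0,2\pi)}\|e^{\mathrm{i}\theta}\boldsymbol{x}-\boldsymbol{y}\|_{\ell_2}$, and $\mathbf{dist}^2(\boldsymbol{x},\boldsymbol{y})$ is its square. $\|\cdot\|_{\ell_q}$ is the usual $\ell_q$-norm. ''Mean-zero, variance-one'' means $\mathbb{E}[a_i]=0$ and $\mathbb{E}[|a_i|^2]=1$. ''Universal'' constants do not depend on any of the parameters. *)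

(* Defs.v *)
From HB Require Import structures.
From mathcomp Require Export all_boot all_order all_algebra.
From mathcomp Require Export all_classical all_reals all_analysis.
From mathcomp Require Export complex.
Export Order.TTheory GRing.Theory Num.Theory numFieldNormedType.Exports.

Set Implicit Arguments.
Unset Strict Implicit.
Unset Printing Implicit Defensive.

Local Open Scope classical_set_scope.
Local Open Scope ring_scope.

(* The Borel sigma-algebras of C and C^n. [R[i]] itself carries no topology:
   its usual topology is that of the regular module [R[i]^o], from which
   ['cV[R[i]^o]_n] gets the product topology. *)
Notation borelC R := (g_sigma_algebraType (@open (complex R)^o)).
Notation borelCn R n := (g_sigma_algebraType (@open 'cV[(complex R)^o]_n)).

(* The modulus as an element of [R]; [`| z |] is its image in [R[i]]. *)
Notation modulus := Normc.normc.

Section ComplexVectors.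
Variable R : realType.

Definition expi (t : R) : R[i] := Complex (cos t) (sin t).

Definition lnorm (k : nat) (p : R) (v : 'I_k -> R) : R :=
  (\sum_(i < k) `|v i| `^ p) `^ p^-1.

Definition l2norm (n : nat) (x : 'cV[R[i]]_n) : R :=
  lnorm 2 (fun i => modulus (x i ord0)).

(* The infimum is a minimum: the function is continuous and 2pi-periodic. *)
Definition dist (n : nat) (x y : 'cV[R[i]]_n) : R :=
  inf [set l2norm (expi t *: x - y) | t in [set t : R | 0 <= t < 2 * pi]].

Definition cdot (n : nat) (a x : 'cV[R[i]]_n) : R[i] :=
  \sum_(i < n) (a i ord0)^*%C * x i ord0.

Definition phaseless (m n : nat) (a : 'I_m -> 'cV[R[i]]_n) (x : 'cV[R[i]]_n) :
  'I_m -> R := fun k => modulus (cdot (a k) x) ^+ 2.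

End ComplexVectors.

Section Probability.
Context {d : measure_display} {T : measurableType d} {R : realType}.
Variable P : probability T R.

Definition mutually_independent {d' : measure_display} {U : measurableType d'}
    (k : nat) (X : 'I_k -> T -> U) : Prop :=
  forall (J : {set 'I_k}) (B : 'I_k -> set U),
    (forall j, j \in J -> measurable (B j)) ->
    P (\bigcap_(j in [set` J]) (X j @^-1` B j))
      = (\prod_(j in J) P (X j @^-1` B j))%E.

(* Meaningful when both parts are integrable, since [fine] sends infinities
   to 0. *)
Definition Cexpectation (Z : T -> R[i]) : R[i] :=
  Complex (fine 'E_P[fun w => complex.Re (Z w)]%E)
          (fine 'E_P[fun w => complex.Im (Z w)]%E).

Variables (n : nat) (a : T -> 'cV[R[i]]_n).

Definition entry (i : 'I_n) : T -> R[i] := fun w => a w i ord0.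

(* [-oo] and [+oo] are the units of max and min; when [0 < n] the default elements of
   the big operators do not affect their values. *)
Definition alpha (s : R) : \bar R :=
  (\big[maxe/-oo]_(i < n) 'E_P[fun w => (modulus (entry i w) `^ s)%R])%E.

Definition beta : \bar R :=
  (\big[mine/+oo]_(i < n) 'E_P[fun w => (modulus (entry i w) ^+ 4)%R])%E.

Definition gamma : R :=
  \big[Num.max/0]_(i < n) modulus (Cexpectation (fun w => entry i w ^+ 2)).

Definition zeta : R := Num.min (fine beta - 1) (1 - gamma ^+ 2).

End Probability.

Definition is_copy {R : realType} {d d0 d' : measure_display}
    {T : measurableType d} {T0 : measurableType d0} {U : measurableType d'}
    (P : probability T R) (P0 : probability T0 R)
    (X : {mfun T >-> U}) (X0 : {mfun T0 >-> U}) : Prop :=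
  forall B : set U, measurable B -> distribution P X B = distribution P0 X0 B.

Section Constants.
Variable R : realType.

Definition fconst (delta al ze : R) : R :=
  al `^ ((32 + 12 * delta) / ((4 + delta) * delta)) / ze `^ (3 + 8 / delta).

Definition gconst (delta al ze : R) : R :=
  ze `^ (4 / delta + 1) / al `^ (4 / delta).

Definition hconst (delta al ze : R) : R := gconst delta al ze * ze `^ (1 / 2).

End Constants.

(* Main.v *)
Require Import Defs.
From mathcomp Require Import measurable_realfun ring lra zify.

Set Implicit Arguments.
Unset Strict Implicit.
Unset Printing Implicit Defensive.

Local Open Scope classical_set_scope.
Local Open Scope ring_scope.

(** Why the theorem is true.

    Rotating [x] by a phase that makes its inner product with [y] a nonnegative
    real number, and passing to sum and difference, one finds vectors [s] and [t]
    with [Im <s, t> = 0], [dist x y <= |t| <= |s|] and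
<<
      |<a, x>|^2 - |<a, y>|^2 = Re (<a, s> conj <a, t>)      for every a
>>
    ([phaseless_factorization]). By homogeneity and [lnorm_ge_of_count], it
    suffices to show that, with high probability and for all unit vectors [s, t]
    with [Im <s, t> = 0], a fixed fraction of the samples satisfies
    [|Re (<a_k, s> conj <a_k, t>)| >= sqrt zeta / 32].

    For a fixed pair, [X = Re (<a, s> conj <a, t>)] is a quadratic form in
    independent centered variables, so its components indexed by pairs of entries
    are orthogonal ([Ex_chaos_sqr]). The diagonal components are nondegenerate
    because [E |a_i|^4 > 1], the others because [|E a_i^2| < 1]; whence
    [E X^2 >= zeta / 32]. A Paley-Zygmund argument would turn this into a lower
    bound on [P (|X| >= c sqrt zeta)], but [X] has only [2 + delta / 2] moments. One
    truncates the entries at a level [tau] of order [(al / zeta) ^ (1 / delta)].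
    Orthogonality shows that the truncated form [Y] is close to [X] in mean
    square, and moments of [Y] of any order are bounded, up to constants, by the
    moments of a single truncated entry: [Y] is dominated by squares of linear
    forms, and these obey the Marcinkiewicz-Zygmund bound [Ex_sum_even_moment].
    The resulting probability is [c zeta / tau^4], which is [c(delta) g]
    ([small_ball_truncated], [small_ball_moment], [small_ball_local]). The
    dependence of [c] on [delta] comes from the number of moments of [Y]; using at
    most eight moments of the entries one gets instead [c g^2] with a universal
    [c] ([small_ball_global]). Let [Q] be the larger of the two bounds. The first
    governs the constants [C1] and [C3], the second gives the probability
    [1 - exp (- C2 m g^2)] with a universal [C2].

    The passage to all pairs [s, t] uses a net ([uniform_separation]). The norm
    of the matrix of samples cannot be bounded with exponentially high
    probability from so few moments, but this is not needed: it suffices that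
    few samples notice the replacement of [s] by a grid point.
    A grid point chosen greedily for the given samples makes the total squared
    error, over samples of bounded energy, as small as if the rounding errors
    were orthogonal ([greedy_rounding]), and Markov's inequality over the samples
    bounds the number of large errors; samples of large energy are few by a
    Chernoff bound. The grid has at most [exp (C n / Q)] relevant points, with no
    logarithm of [n] ([card_net_code]), and at each of them the number of good
    samples deviates with probability at most [exp (- Q m / 8)]. So a number of
    samples of the order [n / Q^2] is enough, and [f >= g^-2] ([fconst_ge]). *)

(** * Real-valued expectations *)

Lemma eq_ler (R : numDomainType) (x y : R) : x = y -> x <= y.
Proof. by move=> ->. Qed.

Section RealExpectation.
Context {d : measure_display} {T : measurableType d} {R : realType}.
Variable P : probability T R.
Implicit Types f g : T -> R.

Lemma measurable_le_set f g : measurable_fun setT f -> measurable_fun setT g ->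
  measurable [set w | f w <= g w].
Proof.
move=> mf mg; have := measurable_fun_ler mf mg.
by move=> /(_ measurableT [set true]); rewrite setTI; apply.
Qed.

Lemma measurable_lt_set f g : measurable_fun setT f -> measurable_fun setT g ->
  measurable [set w | f w < g w].
Proof.
move=> mf mg; have := measurable_fun_ltr mf mg.
by move=> /(_ measurableT [set true]); rewrite setTI; apply.
Qed.

Definition L1 f := P.-integrable setT (EFin \o f).
Definition L2 f := measurable_fun setT f /\ L1 (fun w => f w ^+ 2).
Definition Ex f : R := \int[P]_w f w.

Lemma L1_measurable f : L1 f -> measurable_fun setT f.
Proof. by move=> /measurable_int/measurable_EFinP. Qed.

Lemma L2_measurable f : L2 f -> measurable_fun setT f.
Proof. by case. Qed.

Lemma L1_ext f g : f =1 g -> L1 f -> L1 g.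
Proof. by move=> fg; rewrite (funext fg). Qed.

Lemma L1_le f g : measurable_fun setT f -> (forall w, `|f w| <= g w) ->
  L1 g -> L1 f.
Proof.
move=> mf fg Lg; apply: (le_integrable measurableT _ _ Lg).
  exact/measurable_EFinP.
move=> w _ /=; rewrite lee_fin; exact: le_trans (ler_norm _).
Qed.

Lemma L1_cst c : L1 (fun=> c).
Proof. exact: (finite_measure_integrable_cst P c measurableT). Qed.

Lemma L1_bounded f c : measurable_fun setT f -> (forall w, `|f w| <= c) ->
  L1 f.
Proof. by move=> mf fc; apply: (L1_le mf fc (L1_cst c)). Qed.

Lemma L1D f g : L1 f -> L1 g -> L1 (fun w => f w + g w).
Proof. by move=> Lf Lg; exact: (integrableD measurableT Lf Lg). Qed.

Lemma L1B f g : L1 f -> L1 g -> L1 (fun w => f w - g w).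
Proof. by move=> Lf Lg; exact: (integrableB measurableT Lf Lg). Qed.

Lemma L1Z c f : L1 f -> L1 (fun w => c * f w).
Proof. by move=> Lf; exact: (integrableZl measurableT c Lf). Qed.

Lemma L1_sum (I : Type) (s : seq I) (p : pred I) (F : I -> T -> R) :
  (forall i, p i -> L1 (F i)) -> L1 (fun w => \sum_(i <- s | p i) F i w).
Proof.
move=> LF; elim: s => [|i s IH].
  by apply: L1_ext (L1_cst 0) => w; rewrite big_nil.
have [pi|pi] := boolP (p i); last first.
  by apply: L1_ext IH => w; rewrite big_cons (negbTE pi).
by apply: L1_ext (L1D (LF i pi) IH) => w; rewrite big_cons pi.
Qed.

Lemma Ex_ext f g : f =1 g -> Ex f = Ex g.
Proof. by move=> fg; rewrite (funext fg). Qed.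

Lemma ExD f g : L1 f -> L1 g -> Ex (fun w => f w + g w) = Ex f + Ex g.
Proof. by move=> Lf Lg; exact: RintegralD. Qed.

Lemma ExB f g : L1 f -> L1 g -> Ex (fun w => f w - g w) = Ex f - Ex g.
Proof. by move=> Lf Lg; exact: RintegralB. Qed.

Lemma ExZ c f : L1 f -> Ex (fun w => c * f w) = c * Ex f.
Proof. by move=> Lf; exact: RintegralZl. Qed.

Lemma Ex_cst c : Ex (fun=> c) = c.
Proof.
have P1 := @probability_setT _ _ _ P.
rewrite /Ex (Rintegral_cst P measurableT).
by transitivity (c * fine (P [set: T])) => //; rewrite P1 mulr1.
Qed.

Lemma Ex_sum (I : Type) (s : seq I) (p : pred I) (F : I -> T -> R) :
  (forall i, p i -> L1 (F i)) ->
  Ex (fun w => \sum_(i <- s | p i) F i w) = \sum_(i <- s | p i) Ex (F i).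
Proof.
move=> LF; elim: s => [|i s IH].
  by rewrite big_nil -[RHS](Ex_cst 0); apply: Ex_ext => w; rewrite big_nil.
rewrite big_cons -IH; have [pi|pi] := boolP (p i); last first.
  by apply: Ex_ext => w; rewrite big_cons (negbTE pi).
rewrite -ExD; [|exact: LF|exact: L1_sum].
by apply: Ex_ext => w; rewrite big_cons pi.
Qed.

Lemma Ex_le f g : L1 f -> L1 g -> (forall w, f w <= g w) -> Ex f <= Ex g.
Proof. by move=> Lf Lg fg; apply: le_Rintegral. Qed.

Lemma Ex_ge0 f : (forall w, 0 <= f w) -> 0 <= Ex f.
Proof. by move=> f0; apply: Rintegral_ge0. Qed.

Lemma Ex_EFin f : L1 f -> (\int[P]_w (f w)%:E = (Ex f)%:E)%E.
Proof. by move=> Lf; rewrite fineK//; exact: integrable_fin_num. Qed.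

Lemma L1_indic A : measurable A -> L1 \1_A.
Proof. by move=> mA; apply: integrable_indic. Qed.

Lemma Ex_indic A : measurable A -> Ex \1_A = fine (P A).
Proof. by move=> mA; rewrite /Ex /Rintegral integral_indic// setIT. Qed.

Lemma L2_mul f g : L2 f -> L2 g -> L1 (fun w => f w * g w).
Proof.
move=> [mf Lf] [mg Lg]; apply: (@L1_le _ (fun w => f w ^+ 2 + g w ^+ 2)).
- exact: measurable_funM.
- by move=> w; rewrite ler_norml; apply/andP; split; nra.
- exact: L1D.
Qed.

Lemma L2_cst c : L2 (fun=> c).
Proof. by split; [exact: measurable_cst|exact: L1_cst]. Qed.

Lemma L2_L1 f : L2 f -> L1 f.
Proof.
move=> Lf; apply: L1_ext (L2_mul Lf (L2_cst 1)) => w; exact: mulr1.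
Qed.

Lemma L2_ext f g : f =1 g -> L2 f -> L2 g.
Proof. by move=> fg; rewrite (funext fg). Qed.

Lemma L2Z c f : L2 f -> L2 (fun w => c * f w).
Proof.
move=> [mf Lf]; split; first exact: measurable_funM.
by apply: L1_ext (L1Z (c ^+ 2) Lf) => w; rewrite exprMn.
Qed.

Lemma L2D f g : L2 f -> L2 g -> L2 (fun w => f w + g w).
Proof.
move=> Lf Lg; have [[mf Lf2] [mg Lg2]] := (Lf, Lg).
split; first exact: measurable_funD.
apply: L1_ext (L1D (L1D Lf2 Lg2) (L1Z 2 (L2_mul Lf Lg))) => w /=; ring.
Qed.

Lemma L2B f g : L2 f -> L2 g -> L2 (fun w => f w - g w).
Proof.
move=> Lf Lg; apply: L2_ext (L2D Lf (L2Z (-1) Lg)) => w; ring.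
Qed.

Lemma L2_sum (I : Type) (s : seq I) (p : pred I) (F : I -> T -> R) :
  (forall i, p i -> L2 (F i)) -> L2 (fun w => \sum_(i <- s | p i) F i w).
Proof.
move=> LF; elim: s => [|i s IH].
  by apply: L2_ext (L2_cst 0) => w; rewrite big_nil.
have [pi|pi] := boolP (p i); last first.
  by apply: L2_ext IH => w; rewrite big_cons (negbTE pi).
by apply: L2_ext (L2D (LF i pi) IH) => w; rewrite big_cons pi.
Qed.

Lemma L2_le f g : measurable_fun setT f -> (forall w, `|f w| <= g w) ->
  L2 g -> L2 f.
Proof.
move=> mf fg [mg Lg]; split=> //; apply: L1_le Lg; first exact: measurable_funX.
by move=> w; rewrite ger0_norm ?sqr_ge0// -[_ ^+ 2]real_normK ?num_real// lerXn2r// nnegrE// (le_trans _ (fg w)).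
Qed.

Lemma L2_bounded f c : measurable_fun setT f -> (forall w, `|f w| <= c) ->
  L2 f.
Proof. by move=> mf fc; apply: (L2_le mf fc (L2_cst c)). Qed.

Lemma Ex_var_le f : L2 f ->
  Ex (fun w => (f w - Ex f) ^+ 2) <= Ex (fun w => f w ^+ 2).
Proof.
move=> Lf; have Lf1 := L2_L1 Lf.
rewrite (@Ex_ext _ (fun w => (f w ^+ 2 - (2 * Ex f) * f w) + (Ex f) ^+ 2)); last first.
  by move=> w; ring.
rewrite ExD; [|apply: L1B; [by case: Lf|exact: L1Z]|exact: L1_cst].
rewrite ExB; [|by case: Lf|exact: L1Z].
rewrite ExZ// Ex_cst; have := sqr_ge0 (Ex f); nra.
Qed.

Lemma Ex_norm_le f g : L1 f -> L1 g -> (forall w, `|f w| <= g w) ->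
  `|Ex f| <= Ex g.
Proof.
move=> Lf Lg fg; rewrite ler_norml; apply/andP; split; last first.
  by apply: Ex_le => // w; exact: le_trans (ler_norm _) (fg w).
rewrite lerNl -mulN1r -ExZ//; apply: Ex_le => //; first exact: L1Z.
by move=> w; rewrite mulN1r (le_trans (ler_norm _))// normrN.
Qed.

End RealExpectation.

(** * Products of independent variables *)

Section Independence.
Context {d d' : measure_display} {T : measurableType d} {U : measurableType d'}.
Context {R : realType}.
Variables (P : probability T R) (n : nat) (a : 'I_n -> T -> U).
Hypothesis ma : forall i, measurable_fun setT (a i).
Hypothesis ind : mutually_independent P a.

Definition cylinders (j : 'I_n) : set (set T) :=
  [set A | exists B : 'I_n -> set U, (forall i, measurable (B i)) /\
     A = \bigcap_(i in [set` [set~ j]%SET]) (a i @^-1` B i)].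

(** Functions of the coordinates other than [j]: measurability with respect to
    the sigma-algebra that these generate, presented by its pi-system of
    cylinders so that independence can be extended by uniqueness of measures. *)
Definition away (j : 'I_n) (W : T -> R) : Prop :=
  @measurable_fun _ _ (g_sigma_algebraType (cylinders j))
    (R) setT W.

Lemma cylinders_measurable j : cylinders j `<=` measurable.
Proof.
move=> _ [B [mB ->]]; apply: fin_bigcap_measurable => [|i _].
  exact: finite_finset.
by rewrite -[X in measurable X]setTI; exact: ma.
Qed.

Lemma cylinders_setI j : setI_closed (cylinders j).
Proof.
move=> _ _ [B [mB ->]] [C [mC ->]]; exists (fun i => B i `&` C i); split.
  by move=> i; exact: measurableI.
by rewrite -bigcapI.
Qed.

Lemma cylinders_setT j : cylinders j setT.
Proof.
exists (fun=> setT); split => //; apply/esym.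
by rewrite -subTset => w _ i _.
Qed.

(** For a fixed event [D] on coordinate [j], [A |-> P (A & D)] and
    [A |-> P A * P D] are finite measures that agree on cylinders by mutual
    independence, hence on the sigma-algebra that cylinders generate. *)
Lemma away_events_indep j A C : <<s cylinders j >> A -> measurable C ->
  P (A `&` a j @^-1` C) = (P A * P (a j @^-1` C))%E.
Proof.
move=> sA mC; set D := a j @^-1` C.
have mD : measurable D by rewrite -[D]setTI; exact: ma.
have PD : P D \is a fin_num by exact: fin_num_measure.
have PD0 : (0 <= fine (P D)) by exact: fine_ge0.
pose m1 : {measure set T -> \bar R} := mrestr P mD.
pose m2 : {measure set T -> \bar R} := mscale (NngNum PD0) P.
suff H : m1 A = m2 A.
  by move: H; rewrite /m1 /m2 /= /mrestr /mscale/= fineK// muleC.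
apply: (g_sigma_algebra_measure_unique (cylinders j)
  (@cylinders_measurable j) (fun=> setT)) sA.
- by move=> _; exact: cylinders_setT.
- by rewrite -subTset => w _; exists 0%N.
- exact: cylinders_setI.
- move=> _ [B [mB ->]]; rewrite /m1 /m2 /= /mrestr /mscale/= fineK//.
  pose B' i := if i == j then C else B i.
  have mB' i : measurable (B' i) by rewrite /B'; case: ifP.
  have := ind (J := [set: _]%SET) (B := B') (fun i _ => mB' i).
  rewrite (bigD1 j) ?inE//= {2}/B' eqxx -/D.
  rewrite (eq_bigl (fun i => i \in [set~ j]%SET)); last first.
    by move=> i; rewrite !inE.
  rewrite (eq_bigr (fun i => P (a i @^-1` B i))); last first.
    by move=> i; rewrite !inE /B' => /negbTE ->.
  rewrite -(ind (J := [set~ j]%SET) (B := B) (fun i _ => mB i)) => <-.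
  congr (P _); apply/seteqP; split=> w /=.
    move=> [Bw Dw] i _; rewrite /B' /=; case: (eqVneq i j) => [->//|ij].
    by apply: Bw; rewrite /= !inE.
  move=> Bw; split=> [i /=|].
    by rewrite !inE => ij; have := Bw i; rewrite /B' /= (negbTE ij) inE; apply.
  by have := Bw j; rewrite /B' /= eqxx inE; apply.
- by move=> _; rewrite /m1 /= /mrestr (le_lt_trans (probability_le1 _ _)) ?ltry//; exact: measurableI.
Qed.

Lemma away_measurable j W : away j W -> measurable_fun setT W.
Proof.
move=> aW _ B mB; have := aW measurableT B mB.
exact: (smallest_sub (@sigma_algebra_measurable _ T) (@cylinders_measurable j)).
Qed.

Lemma away_comp j i (f : U -> R) : i != j -> measurable_fun setT f ->
  away j (f \o a i).
Proof.
move=> ij mf _ B mB; rewrite setTI; apply: sub_sigma_algebra.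
have mfB : measurable (f @^-1` B) by rewrite -[X in measurable X]setTI; exact: mf.
exists (fun k => if k == i then f @^-1` B else setT); split.
  by move=> k; case: ifP.
apply/seteqP; split=> w /=.
  by move=> Bw k _; case: eqVneq => [->|].
by move=> /(_ i); rewrite /= !inE eqxx; apply.
Qed.

Lemma away_cst j c : away j (fun=> c).
Proof. exact: measurable_cst. Qed.

Lemma awayD j V W : away j V -> away j W -> away j (fun w => V w + W w).
Proof. by move=> aV aW; exact: (measurable_funD aV aW). Qed.

Lemma awayM j V W : away j V -> away j W -> away j (fun w => V w * W w).
Proof. by move=> aV aW; exact: (measurable_funM aV aW). Qed.

Lemma awayX j V k : away j V -> away j (fun w => V w ^+ k).
Proof. by move=> aV; exact: (measurable_funX k aV). Qed.

Lemma away_sum j (I : Type) (s : seq I) (p : pred I) (F : I -> T -> R) :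
  (forall i, p i -> away j (F i)) ->
  away j (fun w => \sum_(i <- s | p i) F i w).
Proof.
move=> aF; elim: s => [|i s IH].
  rewrite (_ : (fun w => _) = (fun=> 0)); first exact: away_cst.
  by apply/funext => w; rewrite big_nil.
have [pi|pi] := boolP (p i).
  rewrite (_ : (fun w => _) = (fun w => F i w + \sum_(i <- s | p i) F i w)).
    by apply: awayD => //; exact: aF.
  by apply/funext => w; rewrite big_cons pi.
rewrite (_ : (fun w => _) = (fun w => \sum_(i <- s | p i) F i w)) //.
by apply/funext => w; rewrite big_cons (negbTE pi).
Qed.

(** The joint law of [W] and [f (a j)] is the product of their laws, because the
    two agree on rectangles; Fubini then factors the expectation. This is the
    only form in which independence is used below for the entries. *)
Lemma away_mul j (W : T -> R) (f : U -> R) : away j W ->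
  measurable_fun setT f -> L1 P W -> L1 P (f \o a j) ->
  L1 P (fun w => W w * f (a j w)) /\
  Ex P (fun w => W w * f (a j w)) = Ex P W * Ex P (f \o a j).
Proof.
move=> aW mf LW Lf; have mW := away_measurable aW.
have mV : measurable_fun setT (f \o a j) by exact: measurableT_comp.
pose W' : {mfun T >-> R} := mfun_Sub (mem_set mW).
pose V' : {mfun T >-> R} := mfun_Sub (mem_set mV).
have mX : measurable_fun setT (fun w => (W w, f (a j w))).
  exact/measurable_fun_pair.
pose X' : {mfun T >-> (R * R)%type} := mfun_Sub (mem_set mX).
have joint : forall A, measurable A ->
    (distribution P W' \x distribution P V')%E A = distribution P X' A.
  apply: product_measure_unique => A B mA mB.
  suff : P ((W @^-1` A) `&` a j @^-1` (f @^-1` B)) =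
    (P (W @^-1` A) * P (a j @^-1` (f @^-1` B)))%E by [].
  apply: away_events_indep; first by rewrite -[X in _ X]setTI; exact: aW.
  by rewrite -[X in measurable X]setTI; exact: mf.
have mxy : measurable_fun setT (fun z : R * R => (z.1 * z.2)%:E).
  apply/measurable_EFinP; apply: measurable_funM; [exact: measurable_fst|exact: measurable_snd].
have tr (h : R * R -> \bar R) : measurable_fun setT h -> (forall z, (0 <= h z)%E) ->
    (\int[distribution P W' \x distribution P V']_z h z =
     \int[P]_w h (W w, f (a j w)))%E.
  move=> mh h0.
  rewrite (eq_measure_integral (distribution P X')); last by move=> A mA _; exact: joint.
  exact: (@ge0_integral_distribution _ _ _ _ _ P X' h).
have absL1 : L1 P (fun w => W w * f (a j w)).
  apply/integrableP; split.
    by apply/measurable_EFinP; exact: measurable_funM.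
  rewrite -(tr (fun z => `|(z.1 * z.2)%:E|)%E)//; last exact: measurableT_comp.
  rewrite (@fubini_tonelli1 _ _ _ _ _ (distribution P W') (distribution P V') (fun z => `|(z.1 * z.2)%:E|)%E)//; last exact: measurableT_comp.
  rewrite /fubini_F /=.
  set c := (\int[P]_w `|(f (a j w))%:E|)%E.
  have mabs : measurable_fun setT (fun y : R => `|y%:E|%E).
    by apply: measurableT_comp => //; exact/measurable_EFinP.
  have innerE x : (\int[distribution P V']_y `|(x * y)%:E| = `|x|%R%:E * c)%E.
    under eq_integral => y _ do rewrite EFinM abseM.
    rewrite ge0_integralZl_EFin//.
    by rewrite (@ge0_integral_distribution _ _ _ _ _ P V' (fun y => `|y%:E|%E)).
  under eq_integral => x _ do rewrite innerE.
  have c0 : (0 <= c)%E by exact: integral_ge0.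
  have coo : (c < +oo)%E by move/integrableP : Lf => [].
  have cf : c \is a fin_num by rewrite ge0_fin_numE.
  rewrite ge0_integralZr//.
  rewrite (@ge0_integral_distribution _ _ _ _ _ P W' (fun y => `|y%:E|%E))//.
  have i0 : (0 <= \int[P]_w `|(W w)%:E|)%E by exact: integral_ge0.
  apply: lte_mul_pinfty => //.
  rewrite ge0_fin_numE; first by move/integrableP : LW => [].
  exact: i0.
split=> //.
have Lprod : (distribution P W' \x distribution P V')%E.-integrable setT (fun z : R * R => (z.1 * z.2)%:E).
  apply/integrableP; split => //.
  rewrite (tr (fun z => `|(z.1 * z.2)%:E|)%E)//; last exact: measurableT_comp.
  by move/integrableP : absL1 => [].
apply: EFin_inj; rewrite EFinM -[LHS]Ex_EFin// -(Ex_EFin LW).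
transitivity (\int[distribution P W' \x distribution P V']_z (z.1 * z.2)%:E)%E.
  rewrite (eq_measure_integral (distribution P X')); last by move=> A mA _; exact: joint.
  by rewrite (@integral_distribution _ _ _ _ _ P X' (fun z => (z.1 * z.2)%:E)).
rewrite -(@integral12_prod_meas1 _ _ _ _ _ (distribution P W') (distribution P V') (fun z => (z.1 * z.2)%:E) Lprod) /fubini_F/=.
have LV' : (distribution P V').-integrable setT (fun y : R => y%:E).
  by apply: integrable_pushforward => //; exact/measurable_EFinP.
have LW' : (distribution P W').-integrable setT (fun y : R => y%:E).
  by apply: integrable_pushforward => //; exact/measurable_EFinP.
have innerE x : (\int[distribution P V']_y (x * y)%:E = x%:E * (Ex P (f \o a j))%:E)%E.
  under eq_integral => y _ do rewrite EFinM.
  rewrite integralZl// -Ex_EFin//.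
  rewrite (@integral_distribution _ _ _ _ _ P V' (fun y => y%:E))//.
  exact/measurable_EFinP.
under eq_integral => x _ do rewrite innerE.
rewrite [LHS]integralZr//.
rewrite (@integral_distribution _ _ _ _ _ P W' (fun y => y%:E))//; last exact/measurable_EFinP.
Qed.

End Independence.

(** * Chernoff bounds for the number of hits *)

Section Counting.
Context {d d' : measure_display} {T : measurableType d} {U : measurableType d'}.
Context {R : realType}.
Variables (P : probability T R) (m : nat) (b : 'I_m -> T -> U).
Hypothesis mb : forall k, measurable_fun setT (b k).
Hypothesis ind : mutually_independent P b.
Variables (B : set U) (p : R).
Hypothesis mB : measurable B.
Hypothesis PB : forall k, P (b k @^-1` B) = p%:E.

Definition hits (w : T) : nat := #|[set k | b k w \in B]%SET|.

Let mpre k : measurable (b k @^-1` B).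
Proof. by rewrite -[X in measurable X]setTI; exact: mb. Qed.

Let p01 : (0 < m)%N -> 0 <= p <= 1.
Proof.
case: m b PB mpre => [//|m'] b' PB' mpre' _.
by rewrite -!lee_fin -(PB' ord0) measure_ge0 probability_le1.
Qed.

Lemma prod_one_plus_indic (c : R) w :
  \prod_k (c * \1_B (b k w) + 1) = (c + 1) ^+ hits w.
Proof.
rewrite -prodr_const (eq_bigr (fun k => if k \in [set k | b k w \in B]%SET then c + 1 else 1)).
  by rewrite -big_mkcond.
by move=> k _; rewrite inE indicE; case: (_ \in B); rewrite ?mulr1 // mulr0 add0r.
Qed.

(** Expanding the product of the factors [c * 1_B (b k) + 1] over subsets of
    indices turns the generating function of the number of hits into the
    product rule for finite subfamilies. *)
Lemma Ex_geometric_hits (c : R) :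
  L1 P (fun w => (c + 1) ^+ hits w) /\
  Ex P (fun w => (c + 1) ^+ hits w) = (c * p + 1) ^+ m.
Proof.
pose D (J : {set 'I_m}) := \bigcap_(k in [set` J]) (b k @^-1` B) : set T.
have mD J : measurable (D J).
  by apply: fin_bigcap_measurable => //; exact: finite_finset.
have E w : (c + 1) ^+ hits w = \sum_(J in {set 'I_m}) c ^+ #|J| * \1_(D J) w.
  rewrite -prod_one_plus_indic bigA_distr; apply: eq_bigr => J _.
  rewrite -big_mkcond /= big_split /= prodr_const; congr (_ * _).
  rewrite indicE; case: (boolP (w \in D J)) => [/set_mem Dw|].
    rewrite big1// => k kJ; rewrite indicE mem_set//.
    exact: (Dw k).
  move=> /negP nD; apply/eqP; rewrite prodf_seq_eq0; apply/hasP.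
  suff [k kJ kB] : exists2 k, k \in J & b k w \notin B.
    by exists k; rewrite ?mem_index_enum// kJ indicE (negbTE kB) eqxx.
  apply: contrapT => H; apply: nD; apply/mem_set => k /= kJ.
  apply/set_mem/negPn/negP => kB; apply: H; by exists k.
have PD (J : {set 'I_m}) : Ex P (\1_(D J)) = p ^+ #|J|.
  rewrite Ex_indic// (ind (J := J) (B := fun=> B))//.
  rewrite (eq_bigr (fun=> p%:E)); last by move=> k _; exact: PB.
  by rewrite prodEFin /= prodr_const.
have LD (J : {set 'I_m}) : L1 P (fun w => c ^+ #|J| * \1_(D J) w) by apply: L1Z; exact: L1_indic.
split; first by apply: L1_ext (fun w => esym (E w)) _; exact: L1_sum.
rewrite (Ex_ext _ E) Ex_sum//.
rewrite (eq_bigr (fun J : {set 'I_m} => (c * p) ^+ #|J|)); last first.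
  by move=> J _; rewrite ExZ ?PD -?exprMn//; exact: L1_indic.
transitivity (\prod_(k < m) (c * p + 1)); last by rewrite prodr_const card_ord.
rewrite bigA_distr; apply: eq_bigr => J _.
by rewrite -big_mkcond /= prodr_const.
Qed.

Lemma measurable_hits : measurable_fun setT (fun w => (hits w)%:R : R).
Proof.
rewrite (_ : (fun w => _) = fun w => \sum_k \1_B (b k w)).
  apply: measurable_sum => k.
  have m1 : measurable_fun setT (\1_B : U -> R) by exact: measurable_indic.
  exact: (measurableT_comp m1 (mb k)).
apply/funext => w; rewrite /hits -sum1_card natr_sum big_mkcond/=.
by apply: eq_bigr => k _; rewrite inE indicE; case: ifP.
Qed.

Lemma few_hits_measurable (t : R) : measurable [set w | (hits w)%:R < t].
Proof. exact: measurable_lt_set measurable_hits (measurable_cst t). Qed.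

Lemma many_hits_measurable (t : R) : measurable [set w | t <= (hits w)%:R].
Proof. exact: measurable_le_set (measurable_cst t) measurable_hits. Qed.

Let markov_bound (A : set T) c v : -1 <= c -> 0 < v -> measurable A ->
  (forall w, A w -> v <= (c + 1) ^+ hits w) ->
  fine (P A) <= (c * p + 1) ^+ m / v.
Proof.
move=> c1 v0 mA H; have [Lc Ec] := Ex_geometric_hits c.
rewrite ler_pdivlMr// mulrC -Ec -Ex_indic// -ExZ; last exact: L1_indic.
apply: Ex_le => //; first by apply: L1Z; exact: L1_indic.
move=> w; rewrite indicE; case: (boolP (w \in A)) => [/set_mem /H|_].
  by rewrite mulr1.
by rewrite mulr0 exprn_ge0// -lerBlDr sub0r.
Qed.

(** Markov's inequality for [2^-1 ^ hits]: each factor has mean at most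
    [1 - q / 2 <= exp (- q / 2)], and the product is at least [exp (- q * m / 4)] on
    the event. *)
Lemma chernoff_few_hits (q : R) : 0 <= q <= p ->
  fine (P [set w | (hits w)%:R < q * m%:R / 4]) <= expR (- (q * m%:R / 4)).
Proof.
move=> /andP[q0 qp].
have [m0|m0] := posnP m.
  have p10 : forall x : nat, x = 0%N -> 1 <= expR (- (q * x%:R / 4)).
    by move=> x ->; rewrite mulr0 mul0r oppr0 expR0.
  apply: le_trans (p10 _ m0).
  rewrite -lee_fin fineK ?fin_num_measure ?probability_le1//; exact: few_hits_measurable.
have [p0 p1] := andP (p01 m0).
apply: le_trans (@markov_bound _ (- 2^-1) (expR (- (q * m%:R / 4))) _ _ _ _) _.
- by lra.
- exact: expR_gt0.
- exact: few_hits_measurable.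
- move=> w /= /ltW hw.
  apply: (@le_trans _ _ (expR (- 1) ^+ hits w)).
    by rewrite -expRM_natr ler_expR; lra.
  rewrite lerXn2r// ?nnegrE ?expR_ge0//; first by lra.
  have -> : - 2^-1 + 1 = 2^-1 :> R by lra.
  rewrite expRN lef_pV2 ?posrE ?expR_gt0//.
  have := expR_ge1Dx (1 : R); lra.
rewrite ler_pdivrMr ?expR_gt0// -expRD.
apply: (@le_trans _ _ (expR (- (q / 2)) ^+ m)); last first.
  by rewrite -expRM_natr ler_expR; lra.
rewrite lerXn2r// ?nnegrE ?expR_ge0//; first by lra.
apply: le_trans (expR_ge1Dx _); lra.
Qed.

(** Markov's inequality for [2 ^ hits]: its mean is at most [exp (p * m)], and on
    the event it is at least [exp (th * m / 2)], as [2 >= exp 2^-1]. *)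
Lemma chernoff_many_hits (th : R) : 4 * p <= th ->
  fine (P [set w | th * m%:R <= (hits w)%:R]) <= expR (- (th * m%:R / 4)).
Proof.
move=> pth.
have [m0|m0] := posnP m.
  have p10 : forall x : nat, x = 0%N -> 1 <= expR (- (th * x%:R / 4)).
    by move=> x ->; rewrite mulr0 mul0r oppr0 expR0.
  apply: le_trans (p10 _ m0).
  rewrite -lee_fin fineK ?fin_num_measure ?probability_le1//; exact: many_hits_measurable.
have [p0 p1] := andP (p01 m0).
apply: le_trans (@markov_bound _ 1 (expR (th * m%:R / 2)) _ _ _ _) _.
- by lra.
- exact: expR_gt0.
- exact: many_hits_measurable.
- move=> w /= hw.
  apply: (@le_trans _ _ (expR 2^-1 ^+ hits w)).
    by rewrite -expRM_natr ler_expR; lra.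
  rewrite lerXn2r// ?nnegrE ?expR_ge0//.
  have -> : 1 + 1 = 2^-1^-1 :> R by rewrite invrK; lra.
  rewrite -[2^-1 in X in X <= _]opprK expRN lef_pV2 ?posrE ?expR_gt0//.
  have := expR_ge1Dx (- 2^-1 : R); lra.
rewrite ler_pdivrMr ?expR_gt0// -expRD.
apply: (@le_trans _ _ (expR p ^+ m)); last first.
  have : p * m%:R <= th / 4 * m%:R by apply: ler_wpM2r => //; lra.
  by rewrite -expRM_natr ler_expR; lra.
rewrite lerXn2r// ?nnegrE ?expR_ge0//; first by lra.
apply: le_trans (expR_ge1Dx _); lra.
Qed.

End Counting.

(** * Measurable coordinates of complex vectors *)

Section BorelComplex.
Variable R : realType.

Lemma normc_ReB (z w : R[i]) : `|complex.Re z - complex.Re w| <= modulus (z - w).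
Proof.
case: z w => [a b] [c e] /=; rewrite -sqrtr_sqr ler_wsqrtr// lerDl; exact: sqr_ge0.
Qed.

Lemma normc_ImB (z w : R[i]) : `|complex.Im z - complex.Im w| <= modulus (z - w).
Proof.
case: z w => [a b] [c e] /=; rewrite -sqrtr_sqr ler_wsqrtr// lerDr; exact: sqr_ge0.
Qed.

(* Balls of the complex field have radii in that field, whence the complex
   radius built from a real one. *)
Let open_preimage (h : R[i] -> R) :
  (forall z w, `|h z - h w| <= modulus (z - w)) ->
  forall c : R, open ([set z | c < h z] : set (complex R)^o).
Proof.
move=> hle c; rewrite openE => z /= cz.
have e0 : (0 : R[i]) < Complex (h z - c) 0.
  by rewrite ltcE /= eqxx subr_gt0.
apply/nbhs_ballP; exists (Complex (h z - c) 0) => // w.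
rewrite -ball_normE /ball_ /= => zw.
have := hle z w.
move: zw; rewrite normc_def ltcE /= => /andP[_ zw] le1.
have nE : modulus (z - w) = Num.sqrt (complex.Re (z - w) ^+ 2 + complex.Im (z - w) ^+ 2).
  by case: (z - w).
rewrite -nE in zw.
have := le_lt_trans le1 zw; rewrite ltr_norml => /andP[H1 H2].
by move: H2; rewrite ltrBlDr -ltrBlDl opprB addrC subrK.
Qed.

Let measurable_lip (h : R[i] -> R) :
  (forall z w, `|h z - h w| <= modulus (z - w)) ->
  measurable_fun setT (h : borelC R -> R).
Proof.
move=> hle; apply: (measurability (@RGenOInfty.G R) (RGenOInfty.measurableE R)).
move=> _ [_ [c ->] <-]; rewrite setTI.
rewrite (_ : _ @^-1` _ = [set z | c < h z]).
  by apply: sub_sigma_algebra; exact: open_preimage.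
by apply/seteqP; split => z /=; rewrite in_itv /= andbT.
Qed.

Lemma measurable_Re : measurable_fun setT (@complex.Re R : borelC R -> R).
Proof. by apply: measurable_lip => z w; exact: normc_ReB. Qed.

Lemma measurable_Im : measurable_fun setT (@complex.Im R : borelC R -> R).
Proof. by apply: measurable_lip => z w; exact: normc_ImB. Qed.

Lemma measurable_entry n (i : 'I_n) :
  measurable_fun setT (fun v : borelCn R n => (v i ord0 : borelC R)).
Proof.
apply: (@measurability _ _ (borelCn R n) (borelC R) setT _ (@open (complex R)^o) erefl).
move=> _ [B oB <-]; rewrite setTI; apply: sub_sigma_algebra.
have c := @coord_continuous ((complex R)^o) n 1 i ord0.
by move/continuousP : c; apply.
Qed.

End BorelComplex.

(** * Orthogonality of a quadratic chaos *)

Section Chaos.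
Context {d d' : measure_display} {T : measurableType d} {U : measurableType d'}.
Context {R : realType}.
Variables (P : probability T R) (n : nat) (a : 'I_n -> T -> U).
Hypothesis ma : forall i, measurable_fun setT (a i).
Hypothesis ind : mutually_independent P a.
Implicit Types (i j l : 'I_n) (p q : 'I_n * 'I_n).

(** Conditional mean zero given the coordinates other than [l], stated as
    orthogonality to all square-integrable functions of those coordinates. *)
Definition centered_in (l : 'I_n) (Z : T -> R) : Prop :=
  L2 P Z /\ forall W, away a l W -> L2 P W -> Ex P (fun w => Z w * W w) = 0.

Lemma centered_inD l Z Z' : centered_in l Z -> centered_in l Z' ->
  centered_in l (fun w => Z w + Z' w).
Proof.
move=> [LZ HZ] [LZ' HZ']; split; first exact: L2D.
move=> W aW LW; rewrite (@Ex_ext _ _ _ P _ (fun w => Z w * W w + Z' w * W w)).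
  by rewrite ExD ?HZ ?HZ' ?addr0//; exact: L2_mul.
by move=> w; rewrite mulrDl.
Qed.

Lemma centered_inZ l c Z : centered_in l Z -> centered_in l (fun w => c * Z w).
Proof.
move=> [LZ HZ]; split; first exact: L2Z.
move=> W aW LW; rewrite (@Ex_ext _ _ _ P _ (fun w => c * (Z w * W w))).
  by rewrite ExZ ?HZ ?mulr0//; exact: L2_mul.
by move=> w; rewrite mulrA.
Qed.

Lemma centered_inB l Z Z' : centered_in l Z -> centered_in l Z' ->
  centered_in l (fun w => Z w - Z' w).
Proof.
move=> cZ cZ'; have := centered_inD cZ (centered_inZ (-1) cZ').
by congr (centered_in l _); apply/funext => w; rewrite mulN1r.
Qed.

Lemma centered_in_comp l (f : U -> R) : measurable_fun setT f ->
  L2 P (f \o a l) -> Ex P (f \o a l) = 0 -> centered_in l (f \o a l).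
Proof.
move=> mf Lf f0; split => // W aW LW.
rewrite (@Ex_ext _ _ _ P _ (fun w => W w * f (a l w))); last first.
  by move=> w; rewrite mulrC.
have [_ ->] := away_mul ma ind aW mf (L2_L1 LW) (L2_L1 Lf).
by rewrite f0 mulr0.
Qed.

Lemma L2_mul_indep i j (f g : U -> R) : i != j ->
  measurable_fun setT f -> measurable_fun setT g ->
  L2 P (f \o a i) -> L2 P (g \o a j) ->
  L2 P (fun w => f (a i w) * g (a j w)).
Proof.
move=> ij mf mg Lf Lg; split.
  by apply: measurable_funM; [exact: (L2_measurable Lf)|exact: (L2_measurable Lg)].
have aW : away a j (fun w => f (a i w) ^+ 2) by apply: awayX; exact: away_comp.
have mg2 : measurable_fun setT (fun u => g u ^+ 2) by exact: measurable_funX.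
have [Lfg _] := away_mul ma ind aW mg2 Lf.2 Lg.2.
by apply: L1_ext Lfg => w; rewrite exprMn.
Qed.

Lemma Ex_mul_indep i j (f g : U -> R) : i != j ->
  measurable_fun setT f -> measurable_fun setT g ->
  L1 P (f \o a i) -> L1 P (g \o a j) ->
  L1 P (fun w => f (a i w) * g (a j w)) /\
  Ex P (fun w => f (a i w) * g (a j w)) = Ex P (f \o a i) * Ex P (g \o a j).
Proof.
move=> ij mf mg Lf Lg; have aW := away_comp (a := a) ij mf.
exact: (away_mul ma ind aW mg Lf Lg).
Qed.

Lemma centered_in_mul i j (f g : U -> R) : i != j ->
  measurable_fun setT f -> measurable_fun setT g ->
  L2 P (f \o a i) -> L2 P (g \o a j) -> Ex P (g \o a j) = 0 ->
  centered_in j (fun w => f (a i w) * g (a j w)).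
Proof.
move=> ij mf mg Lf Lg g0; split; first exact: L2_mul_indep.
move=> W aW LW; rewrite (@Ex_ext _ _ _ P _ (fun w => (f (a i w) * W w) * g (a j w))).
  have aFW : away a j (fun w => f (a i w) * W w).
    by apply: awayM => //; exact: away_comp.
  have [_ ->] := away_mul ma ind aFW mg (L2_mul Lf LW) (L2_L1 Lg).
  by rewrite g0 mulr0.
by move=> w; ring.
Qed.

Definition in_pair l p := (l == p.1) || (l == p.2).

(** Ordered pairs are determined by their supports except that a diagonal pair
    is contained in others; in every case one of the two supports has an
    element outside the other, which is what orthogonality needs. *)
Lemma in_pair_inj p q : (p.1 <= p.2)%N -> (q.1 <= q.2)%N -> p != q ->
  (exists2 l, in_pair l p & ~~ in_pair l q) \/
  (exists2 l, in_pair l q & ~~ in_pair l p).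
Proof.
move: p q => [i j] [k l] /= ij kl; rewrite xpair_eqE negb_and /in_pair => /orP[] /eqP ne.
- have [->|jl] := eqVneq j l.
  + have [e|il] := eqVneq i l; last by left; exists i; rewrite /= ?eqxx// negb_or il andbT; apply/eqP.
    right; exists k; rewrite /= ?eqxx// -e; apply/negP => /orP[] /eqP e'; apply: ne; by rewrite e'.
  + have [e|jk] := eqVneq j k; last by left; exists j; rewrite /= ?eqxx ?orbT// negb_or jk jl.
    right; exists l; rewrite /= ?eqxx ?orbT//; apply/negP => /orP[] /eqP e'; last by rewrite e' eqxx in jl.
    move: ij kl; rewrite /= -e e' => ij kl; apply: ne; rewrite -e.
    by apply/val_inj/eqP; rewrite eqn_leq ij kl.
- have [->|ik] := eqVneq i k.
  + have [e|jk] := eqVneq j k; last by left; exists j; rewrite /= ?eqxx ?orbT// negb_or jk; apply/eqP.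
    right; exists l; rewrite /= ?eqxx ?orbT// -e; apply/negP => /orP[] /eqP e'; apply: ne; by rewrite e'.
  + have [e|il] := eqVneq i l; last by left; exists i; rewrite /= ?eqxx// negb_or ik il.
    right; exists k; rewrite /= ?eqxx//; apply/negP => /orP[] /eqP e'; first by rewrite e' eqxx in ik.
    move: ij kl; rewrite /= -e e' => ij kl; apply: ne; rewrite -e.
    by apply/val_inj/eqP; rewrite eqn_leq ij kl.
Qed.

(** Components indexed by unordered pairs (written in increasing order, diagonal
    included): each is centered in the indices of its pair and does not depend on
    any other coordinate. *)
Definition chaos (Z : 'I_n * 'I_n -> T -> R) : Prop :=
  forall p, (p.1 <= p.2)%N ->
    (forall l, in_pair l p -> centered_in l (Z p)) /\
    (forall l, ~~ in_pair l p -> away a l (Z p)).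

Lemma chaos_L2 Z p : chaos Z -> (p.1 <= p.2)%N -> L2 P (Z p).
Proof.
by move=> cZ pp; have [/(_ p.1)] := cZ p pp; rewrite /in_pair eqxx => /(_ isT) [].
Qed.

Lemma chaosB Z Z' : chaos Z -> chaos Z' -> chaos (fun p w => Z p w - Z' p w).
Proof.
move=> cZ cZ' p pp; have [A B] := cZ p pp; have [A' B'] := cZ' p pp; split=> l lp.
  by apply: centered_inB; [exact: A|exact: A'].
rewrite (_ : (fun w => _) = fun w => Z p w + (-1) * Z' p w); last first.
  by apply/funext => w; rewrite mulN1r.
by apply: awayD; [exact: B|apply: awayM; [exact: away_cst|exact: B']].
Qed.

(** Distinct components are orthogonal: pick an index that belongs to only one of
    the two pairs, and use that the component owning it is centered there. *)
Lemma Ex_chaos_sqr Z (c : R) : chaos Z ->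
  L2 P (fun w => c + \sum_(p : 'I_n * 'I_n | (p.1 <= p.2)%N) Z p w) /\
  Ex P (fun w => (c + \sum_(p : 'I_n * 'I_n | (p.1 <= p.2)%N) Z p w) ^+ 2) =
  c ^+ 2 + \sum_(p : 'I_n * 'I_n | (p.1 <= p.2)%N) Ex P (fun w => Z p w ^+ 2).
Proof.
move=> cZ; have LZ p : (p.1 <= p.2)%N -> L2 P (Z p) by exact: chaos_L2.
have LS : L2 P (fun w => \sum_(p : 'I_n * 'I_n | (p.1 <= p.2)%N) Z p w) by exact: L2_sum.
split; first by apply: L2D => //; exact: L2_cst.
have Z0 p : (p.1 <= p.2)%N -> Ex P (Z p) = 0.
  move=> pp; have [/(_ p.1)] := cZ p pp; rewrite /in_pair eqxx => /(_ isT) [_ HZ] _.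
  rewrite -(HZ (fun=> 1)); [|exact: away_cst|exact: L2_cst].
  by apply: Ex_ext => w; rewrite mulr1.
have ZZ p q : (p.1 <= p.2)%N -> (q.1 <= q.2)%N -> p != q ->
    Ex P (fun w => Z p w * Z q w) = 0.
  move=> pp qq pq; have [[l lp lq]|[l lq lp]] := in_pair_inj pp qq pq.
    by apply: ((cZ p pp).1 l lp).2; [exact: (cZ q qq).2|exact: LZ].
  rewrite (@Ex_ext _ _ _ P _ (fun w => Z q w * Z p w)); last by move=> w; rewrite mulrC.
  by apply: ((cZ q qq).1 l lq).2; [exact: (cZ p pp).2|exact: LZ].
rewrite (@Ex_ext _ _ _ P _ (fun w => (c ^+ 2 +
   2 * c * \sum_(p : 'I_n * 'I_n | (p.1 <= p.2)%N) Z p w) +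
   \sum_(p : 'I_n * 'I_n | (p.1 <= p.2)%N) \sum_(q : 'I_n * 'I_n | (q.1 <= q.2)%N) Z p w * Z q w)); last first.
  move=> w; rewrite sqrrD; congr (_ + _ + _).
    by rewrite -mulr_natl; ring.
  rewrite expr2 mulr_suml; apply: eq_bigr => p _; by rewrite mulr_sumr.
have Lpq p q : (p.1 <= p.2)%N -> (q.1 <= q.2)%N -> L1 P (fun w => Z p w * Z q w).
  by move=> pp qq; apply: L2_mul; exact: LZ.
have Lp p : (p.1 <= p.2)%N -> L1 P (fun w => \sum_(q : 'I_n * 'I_n | (q.1 <= q.2)%N) Z p w * Z q w).
  by move=> pp; apply: L1_sum => q qq; exact: Lpq.
rewrite ExD; last 2 first.
- by apply: L1D; [exact: L1_cst|apply: L1Z; exact: L2_L1].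
- exact: L1_sum.
rewrite ExD; [|exact: L1_cst|by apply: L1Z; exact: L2_L1].
rewrite Ex_cst ExZ; last exact: L2_L1.
rewrite Ex_sum; last by move=> p pp; exact/L2_L1/LZ.
rewrite big1 ?mulr0 ?addr0//; congr (_ + _).
rewrite Ex_sum//; apply: eq_bigr => p pp.
rewrite Ex_sum; last by move=> q qq; exact: Lpq.
rewrite (bigD1 p)//= big1 ?addr0//.
move=> q /andP[qq qp]; apply: ZZ => //; by rewrite eq_sym.
Qed.

(** The component, on the pair [p], of a Hermitian form in the variables
    [fx i + i fy i]: off the diagonal, the real part of a complex coefficient
    with parts [cr] and [ci] times a product of one variable and a conjugate;
    on the diagonal a real multiple of [D], which stands for the squared modulus
    minus its mean and may be replaced by a truncation of it. *)
Definition form_part (h : 'I_n -> R) (cr ci : 'I_n * 'I_n -> R)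
    (D fx fy : 'I_n -> U -> R) p (w : T) : R :=
  if p.1 == p.2 then h p.1 * D p.1 (a p.1 w)
  else cr p * (fx p.1 (a p.1 w) * fx p.2 (a p.2 w) + fy p.1 (a p.1 w) * fy p.2 (a p.2 w))
     + ci p * (fy p.1 (a p.1 w) * fx p.2 (a p.2 w) - fx p.1 (a p.1 w) * fy p.2 (a p.2 w)).

Definition centered_family (f : 'I_n -> U -> R) : Prop :=
  forall i, [/\ measurable_fun setT (f i), L2 P (f i \o a i) & Ex P (f i \o a i) = 0].

Lemma chaos_form_part h cr ci D fx fy :
  centered_family D -> centered_family fx -> centered_family fy ->
  chaos (form_part h cr ci D fx fy).
Proof.
move=> cD cx cy [i j] /= ij; rewrite /form_part /in_pair /=.
have [<-|ne] := eqVneq i j; split => l.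
- rewrite orbb => /eqP ->; apply: centered_inZ.
  by have [? ? ?] := cD i; exact: (centered_in_comp (f := D i)).
- rewrite orbb eq_sym => li; apply: awayM; first exact: away_cst.
  by have [? ? ?] := cD i; exact: (away_comp (f := D i)).
- have prodj f g : centered_family f -> centered_family g ->
      centered_in j (fun w => f i (a i w) * g j (a j w)).
    by move=> cf cg; have [? ? ?] := cf i; have [? ? ?] := cg j; exact: centered_in_mul.
  have prodi f g : centered_family f -> centered_family g ->
      centered_in i (fun w => f i (a i w) * g j (a j w)).
    move=> cf cg; have [? ? ?] := cf i; have [? ? ?] := cg j.
    have := @centered_in_mul j i (g j) (f i); rewrite eq_sym ne.
    rewrite (_ : (fun w => _) = fun w => f i (a i w) * g j (a j w)); first by apply.
    by apply/funext => w; rewrite mulrC.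
  move=> /orP[] /eqP ->.
    by apply: centered_inD; apply: centered_inZ; [apply: centered_inD|apply: centered_inB]; exact: prodi.
  by apply: centered_inD; apply: centered_inZ; [apply: centered_inD|apply: centered_inB]; exact: prodj.
- rewrite negb_or => /andP[li lj].
  have aw (f : 'I_n -> U -> R) k : centered_family f -> l != k -> away a l (fun w => f k (a k w)).
    by move=> cf lk; have [? ? ?] := cf k; apply: (away_comp (f := f k)) => //; rewrite eq_sym.
  apply: awayD; apply: awayM; [exact: away_cst| |exact: away_cst|].
    by apply: awayD; apply: awayM; exact: aw.
  rewrite (_ : (fun w => _) = fun w => fy i (a i w) * fx j (a j w) + (-1) * (fx i (a i w) * fy j (a j w))).
    by apply: awayD; repeat apply: awayM; (exact: away_cst || exact: aw).
  by apply/funext => w; rewrite mulN1r.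
Qed.

End Chaos.

(** * Even moments of independent sums *)

(** Binomial expansion with the first-order term kept exactly, so that it
    vanishes in expectation when [z] is centered and independent of [s]; each
    later term is dominated by its extreme powers of [z]. *)
Lemma exprD_le_taylor (R : realFieldType) (N : nat) (s z : R) : (0 < N)%N ->
  (s + z) ^+ N.*2 <= s ^+ N.*2 + N.*2%:R * (s ^+ N.*2.-1 * z)
    + 4 ^+ N * (s ^+ N.-1.*2 * z ^+ 2 + z ^+ N.*2).
Proof.
move=> N0; have [M NE] : exists M, N.*2 = M.+2 by exists N.*2.-2; rewrite -(prednK N0) doubleS.
have ME : N.-1.*2 = M by move: NE; rewrite -{1}(prednK N0) doubleS => -[].
have -> : (s + z) ^+ N.*2 = s ^+ M.+2 + M.+2%:R * (s ^+ M.+1 * z) +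
    \sum_(i < M.+1) (s ^+ (M - i) * z ^+ i.+2) *+ 'C(M.+2, i.+2).
  rewrite NE exprDn big_ord_recl big_ord_recl /= addrA; congr (_ + _ + _).
  - by rewrite subn0 expr0 mulr1 bin0.
  - by rewrite /bump /= bin1 expr1 subn1 mulr_natl.
rewrite ME NE /= lerD2l.
pose B := s ^+ M * z ^+ 2 + z ^+ M.+2.
have M2 : ~~ odd M by rewrite -ME odd_double.
have zM : 0 <= z ^+ M by rewrite exprn_even_ge0.
have sM : 0 <= s ^+ M by rewrite exprn_even_ge0.
have B0 : 0 <= B.
  apply: addr_ge0; first exact: mulr_ge0 (sqr_ge0 _).
  by apply: exprn_even_ge0; rewrite /= negbK.
apply: (@le_trans _ _ (\sum_(i < M.+1) 'C(M.+2, i.+2)%:R * B)).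
  apply: ler_sum => i _; rewrite -mulr_natl ler_wpM2l//.
  apply: (le_trans (ler_norm _)); rewrite normrM !normrX.
  have iM : (i <= M)%N by rewrite -ltnS.
  have sE : s ^+ M = `|s| ^+ M by rewrite -normrX ger0_norm.
  have zE : z ^+ M = `|z| ^+ M by rewrite -normrX ger0_norm.
  have zE2 : z ^+ 2 = `|z| ^+ 2 by rewrite -normrX ger0_norm// sqr_ge0.
  have -> : B = (`|s| ^+ M + `|z| ^+ M) * `|z| ^+ 2.
    by rewrite /B -(addn2 M) exprD sE zE zE2 mulrDl.
  rewrite -(addn2 i) exprD mulrA.
  apply: ler_wpM2r; first exact: exprn_ge0.
  have [sz|/ltW zs] := lerP `|s| `|z|.
    apply: (@le_trans _ _ (`|z| ^+ (M - i) * `|z| ^+ i)).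
      by apply: ler_wpM2r; rewrite ?exprn_ge0// lerXn2r ?nnegrE.
    by rewrite -exprD subnK// lerDr exprn_ge0.
  apply: (@le_trans _ _ (`|s| ^+ (M - i) * `|s| ^+ i)).
    by apply: ler_wpM2l; rewrite ?exprn_ge0// lerXn2r ?nnegrE.
  by rewrite -exprD subnK// lerDl exprn_ge0.
rewrite -mulr_suml ler_wpM2r// -natr_sum -[4]/(4%:R) -natrX ler_nat.
have -> : (4 ^ N = 2 ^ M.+2)%N by rewrite -NE -mul2n expnM.
rewrite -[X in (_ <= X ^ _)%N]/(1 + 1)%N expnDn.
under [X in (_ <= X)%N]eq_bigr do rewrite !exp1n !muln1.
by rewrite !big_ord_recl /= addnA; exact: leq_addl.
Qed.

Section Moments.
Context {d d' : measure_display} {T : measurableType d} {U : measurableType d'}.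
Context {R : realType}.
Variables (P : probability T R) (n : nat) (a : 'I_n -> T -> U).
Hypothesis ma : forall i, measurable_fun setT (a i).
Hypothesis ind : mutually_independent P a.
Variables (N : nat) (z : 'I_n -> U -> R) (v : 'I_n -> R) (A V c : R).
Hypothesis N0 : (0 < N)%N.
Hypothesis mz : forall i, measurable_fun setT (z i).
Hypothesis zc : forall i u, `|z i u| <= c.
Hypothesis z0 : forall i, Ex P (z i \o a i) = 0.
Hypothesis v0 : forall i, 0 <= v i.
Hypothesis A0 : 0 <= A.
Hypothesis z2 : forall i, Ex P (fun w => z i (a i w) ^+ 2) <= v i.
Hypothesis zN : forall i, Ex P (fun w => z i (a i w) ^+ N.*2) <= A * v i.
Hypothesis vV : \sum_i v i <= V.

Let S l w := \sum_(i < n | (i < l)%N) z i (a i w).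

Let mza i : measurable_fun setT (fun w => z i (a i w)).
Proof. exact: measurableT_comp. Qed.

Let mS l : measurable_fun setT (S l).
Proof.
rewrite (_ : S l = fun w => \sum_(i < n) (i < l)%N%:R * z i (a i w)).
  by apply: measurable_sum => i; exact: measurable_funM.
apply/funext => w; rewrite /S big_mkcond; apply: eq_bigr => i _.
by case: ifP; rewrite ?mul1r ?mul0r.
Qed.

Let bS l w : `|S l w| <= c *+ n.
Proof.
apply: (le_trans (ler_norm_sum _ _ _)); rewrite -[n in leRHS]card_ord -sumr_const.
by rewrite [leLHS]big_mkcond ler_sum// => i _; case: ifP => // _; rewrite (le_trans _ (zc i (a i w))).
Qed.

Let LX (f : T -> R) b k : measurable_fun setT f -> (forall w, `|f w| <= b) ->
  L1 P (fun w => f w ^+ k).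
Proof.
move=> mf fb; apply: (@L1_bounded _ _ _ P _ (b ^+ k)).
  exact: measurable_funX.
by move=> w; rewrite normrX lerXn2r ?nnegrE// (le_trans _ (fb w)).
Qed.

(* Adding one summand multiplies [1 + A + E S^(2N)] by at most
   [1 + 4^N v]: the first-order term has mean zero, and the lower moment of
   [S] is at most [1 + E S^(2N)]. *)
Let step (l : 'I_n) :
  1 + A + Ex P (fun w => S l.+1 w ^+ N.*2) <=
  (1 + 4 ^+ N * v l) * (1 + A + Ex P (fun w => S l w ^+ N.*2)).
Proof.
have SE w : S l.+1 w = S l w + z l (a l w).
  rewrite /S (bigD1 l) //= addrC; congr (_ + _); apply: eq_bigl => i.
  by rewrite ltnS [RHS]ltn_neqAle andbC.
have aS : away a l (S l).
  by apply: away_sum => i il; apply: away_comp => //; apply: contraTneq il => ->; rewrite ltnn.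
have m0 : 0 <= Ex P (fun w => S l w ^+ N.*2).
  by apply: Ex_ge0 => w; rewrite -mul2n mulnC exprM sqr_ge0.
have LS k : L1 P (fun w => S l w ^+ k) by exact: LX (mS l) (bS l).
have Lz k : L1 P (fun w => z l (a l w) ^+ k).
  by apply: LX (mza l) _ => w; exact: zc.
have [L11 E1] := away_mul ma ind (awayX N.*2.-1 aS) (mz l) (LS _) (Lz 1).
have mz2 : measurable_fun setT (fun u => z l u ^+ 2) by exact: measurable_funX.
have [L22 E2] := away_mul ma ind (awayX N.-1.*2 aS) mz2 (LS _) (Lz 2).
have H : Ex P (fun w => S l.+1 w ^+ N.*2) <= Ex P (fun w => S l w ^+ N.*2)
    + 4 ^+ N * (Ex P (fun w => S l w ^+ N.-1.*2) * v l + A * v l).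
  apply: (@le_trans _ _ (Ex P (fun w => (S l w ^+ N.*2 + N.*2%:R * (S l w ^+ N.*2.-1 * z l (a l w)))
    + 4 ^+ N * (S l w ^+ N.-1.*2 * z l (a l w) ^+ 2 + z l (a l w) ^+ N.*2)))).
    apply: Ex_le.
    - exact: LX (mS _) (bS _).
    - by apply: L1D; [apply: L1D => //; exact: L1Z|apply/L1Z/L1D].
    - by move=> w; rewrite SE; exact: exprD_le_taylor.
  rewrite ExD; [|by apply: L1D => //; exact: L1Z|by apply/L1Z/L1D].
  rewrite ExD; [|by []|exact: L1Z].
  rewrite ExZ// E1 z0 mulr0 mulr0 addr0 lerD2l ExZ; last exact: L1D.
  rewrite ExD// E2 ler_wpM2l ?exprn_ge0// lerD// ?zN//.
  rewrite ler_wpM2l//; last exact: z2.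
  by apply: Ex_ge0 => w; rewrite -mul2n mulnC exprM sqr_ge0.
have lowp : Ex P (fun w => S l w ^+ N.-1.*2) <= 1 + Ex P (fun w => S l w ^+ N.*2).
  rewrite -[1](Ex_cst P 1) -ExD//; last exact: L1_cst.
  apply: Ex_le => //; first by apply: L1D => //; exact: L1_cst.
  move=> w; rewrite -!mul2n !exprM.
  have s0 := sqr_ge0 (S l w); set s := _ ^+ 2 in s0 *.
  have [s1|/ltW s1] := lerP s 1.
    by rewrite (le_trans (exprn_ile1 _ _ _))// lerDl exprn_ge0.
  rewrite -{2}(prednK N0) exprS.
  by have := exprn_ge0 N.-1 s0; nra.
have v0l := v0 l; have c0 : 0 <= 4 ^+ N :> R by exact: exprn_ge0.
move: H lowp m0; set s1 := Ex P (fun w => S l.+1 w ^+ _).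
set s0 := Ex P (fun w => S l w ^+ N.*2).
set sl := Ex P (fun w => S l w ^+ N.-1.*2) => H lowp m0.
have : sl * v l <= (1 + s0) * v l by exact: ler_wpM2r.
move=> H3; have : 4 ^+ N * (sl * v l + A * v l) <= 4 ^+ N * ((1 + s0) * v l + A * v l).
  by rewrite ler_wpM2l// lerD2r.
nra.
Qed.

(** A Marcinkiewicz-Zygmund bound by a discrete Gronwall argument: the factors
    [1 + 4^N v i] multiply to at most [exp (4^N V)]. The constant depends on
    [N] and on the total variance, not on the number of summands. *)
Lemma Ex_sum_even_moment :
  L1 P (fun w => (\sum_i z i (a i w)) ^+ N.*2) /\
  Ex P (fun w => (\sum_i z i (a i w)) ^+ N.*2) <= (1 + A) * expR (4 ^+ N * V).
Proof.
have Sn w : \sum_i z i (a i w) = S n w.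
  by rewrite /S; apply: eq_bigl => i; rewrite ltn_ord.
have LSn := LX N.*2 (mS n) (bS n).
split; first by apply: L1_ext LSn => w; rewrite Sn.
rewrite (@Ex_ext _ _ _ P _ (fun w => S n w ^+ N.*2)); last by move=> w; rewrite Sn.
suff H l : (l <= n)%N -> 1 + A + Ex P (fun w => S l w ^+ N.*2) <=
    (1 + A) * expR (4 ^+ N * \sum_(i < n | (i < l)%N) v i).
  apply: (@le_trans _ _ (1 + A + Ex P (fun w => S n w ^+ N.*2))).
    by rewrite lerDr addr_ge0.
  apply: le_trans (H n (leqnn n)) _.
  rewrite ler_wpM2l ?addr_ge0// ler_expR ler_wpM2l ?exprn_ge0//.
  by apply: le_trans vV; apply: eq_ler; apply: eq_bigl => i; rewrite ltn_ord.
elim: l => [_|l IH ln].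
  rewrite big_pred0// mulr0 expR0 mulr1.
  rewrite (@Ex_ext _ _ _ P _ (fun=> 0)) ?Ex_cst ?addr0//.
  by move=> w; rewrite /S big_pred0// expr0n double_eq0 -leqn0 leqNgt N0.
have := step (Ordinal ln) => /= st; apply: le_trans st _.
rewrite (bigD1 (Ordinal ln))//= [in leRHS]mulrDr expRD mulrCA.
apply: ler_pM.
- by rewrite addr_ge0// mulr_ge0 ?exprn_ge0.
- rewrite !addr_ge0//; apply: Ex_ge0 => w; by rewrite -mul2n mulnC exprM sqr_ge0.
- exact: expR_ge1Dx.
- rewrite (eq_bigl (fun i : 'I_n => (i < l)%N)); first exact/IH/ltnW.
  by move=> i; rewrite ltnS [RHS]ltn_neqAle andbC.
Qed.

End Moments.

(** * Small-ball estimate at a fixed pair of directions *)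

Lemma sum_ordered_pairs (R : nmodType) n (G : 'I_n -> 'I_n -> R) :
  \sum_i \sum_j G i j = \sum_(p : 'I_n * 'I_n | (p.1 <= p.2)%N)
     (if p.1 == p.2 then G p.1 p.1 else G p.1 p.2 + G p.2 p.1).
Proof.
rewrite pair_bigA (bigID (fun p : 'I_n * 'I_n => p.1 <= p.2)%N) /=.
rewrite [X in _ + X](reindex_onto (fun p : 'I_n * 'I_n => (p.2, p.1))
  (fun p : 'I_n * 'I_n => (p.2, p.1))) /=; last by case.
rewrite [X in _ + X](eq_bigl (fun p : 'I_n * 'I_n => (p.1 <= p.2)%N && (p.1 != p.2))); last first.
  by move=> [i j] /=; rewrite eqxx andbT -ltnNge ltn_neqAle andbC.
rewrite [X in _ + X]big_mkcondr -big_split /=; apply: eq_bigr => -[i j] _ /=.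
by case: eqVneq => [->|_]; rewrite ?addr0.
Qed.

Lemma sqrD_le2 (R : realDomainType) (x y : R) : (x + y) ^+ 2 <= 2 * (x ^+ 2 + y ^+ 2).
Proof. by have := sqr_ge0 (x - y); lra. Qed.

Lemma off_diag_arith (R : realFieldType) (c e1 e2 z : R) : 0 <= c ->
  e1 <= z / 32 -> e2 <= z / 32 -> 2 * c * (e1 + e2) <= 2^-1 * (z / 4 * c).
Proof.
move=> c0 H1 H2; have : c * (e1 + e2) <= c * (z / 16) by apply: ler_wpM2l => //; lra.
by lra.
Qed.

Lemma sum_diag (R : nmodType) n (F : 'I_n -> R) :
  \sum_(p : 'I_n * 'I_n | (p.1 <= p.2)%N) (if p.1 == p.2 then F p.1 else 0) = \sum_i F i.
Proof.
rewrite -[RHS](@eq_bigr _ _ _ _ _ _ (fun i => \sum_j if i == j then F i else 0)).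
  rewrite sum_ordered_pairs; apply: eq_bigr => -[i j] _ /=.
  by rewrite eqxx eq_sym; case: eqVneq; rewrite ?addr0.
by move=> i _; rewrite -big_mkcond (big_pred1 i)// => j; rewrite eq_sym.
Qed.

Lemma event_mass_arith (R : realFieldType) (z e1 e2 e3 e4 s t : R) :
  z / 32 <= e1 -> e1 - z / 256 <= e2 -> e2 <= 3 / 2 * e3 + 3 * e4 ->
  e3 <= 2^-1 * e1 -> e4 <= s + t -> t <= z / 1536 -> z / 1536 <= s.
Proof. lra. Qed.

Lemma scale_tail (R : realFieldType) (F z t l : R) :
  1536 * F * (z * t) <= l * (z * t) -> F * (z * t) <= z / 1536 * (l * t).
Proof.
by move=> H; rewrite (_ : z / 1536 * (l * t) = 1536^-1 * (l * (z * t))); [lra|field].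
Qed.

Lemma small_ball_arith (R : realFieldType) (z p t L : R) : 0 < t ^+ 4 -> 0 < L ->
  z / 1536 <= (L * t ^+ 2) ^+ 2 * p -> (1536 * L ^+ 2)^-1 * z / t ^+ 4 <= p.
Proof.
move=> t4 L0 H; rewrite ler_pdivrMr// mulrC ler_pdivrMr; last first.
  by rewrite mulr_gt0 ?ltr0n// exprn_gt0.
rewrite (_ : p * t ^+ 4 * (1536 * L ^+ 2) = 1536 * ((L * t ^+ 2) ^+ 2 * p)); first by lra.
by ring.
Qed.

Lemma exprD_le2 (R : realFieldType) (M : nat) (x y : R) : 0 <= x -> 0 <= y ->
  (x + y) ^+ M <= 2 ^+ M * (x ^+ M + y ^+ M).
Proof.
move=> x0 y0; have [xy|/ltW yx] := lerP x y.
  apply: (@le_trans _ _ ((2 * y) ^+ M)); first by rewrite lerXn2r ?nnegrE ?addr_ge0 ?mulr_ge0//; lra.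
  by rewrite exprMn ler_wpM2l ?exprn_ge0// lerDr exprn_ge0.
apply: (@le_trans _ _ ((2 * x) ^+ M)); first by rewrite lerXn2r ?nnegrE ?addr_ge0 ?mulr_ge0//; lra.
by rewrite exprMn ler_wpM2l ?exprn_ge0// lerDl exprn_ge0.
Qed.

(* [2K + 2] moments of the quadratic form need [4K + 4] moments of the linear
   forms, hence [N = 2K + 2] in [Ex_sum_even_moment]; the variance is at most 2. *)
Definition linear_moment_const (R : realType) (K : nat) : R :=
  3 * 8 ^+ K.+1.*2 * expR (4 ^+ K.+1.*2 * 2).

Definition form_moment_const (R : realType) (K : nat) : R :=
  8 ^+ K.+1.*2 * (4 * linear_moment_const R K + 12 ^+ K.+1.*2).

Lemma form_moment_const_ge1 (R : realType) K : 1 <= form_moment_const R K.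
Proof.
have p8 : 1 <= 8 ^+ K.+1.*2 :> R by rewrite exprn_ege1//; lra.
have p12 : 1 <= 12 ^+ K.+1.*2 :> R by rewrite exprn_ege1//; lra.
rewrite /form_moment_const mulr_ege1//; apply: (le_trans p12); rewrite lerDr.
by rewrite mulr_ge0// /linear_moment_const mulr_ge0 ?expR_ge0// mulr_ge0.
Qed.

Definition small_ball_const (R : realType) (K : nat) : R :=
  (1536 * (1536 * form_moment_const R K) ^+ 2)^-1.

Lemma small_ball_const01 (R : realType) K : 0 < small_ball_const R K <= 1.
Proof.
have f1 := form_moment_const_ge1 R K; rewrite /small_ball_const.
have h : 1 <= 1536 * (1536 * form_moment_const R K) ^+ 2.
  have f2 : 1 <= 1536 * form_moment_const R K by lra.
  by apply: mulr_ege1; [rewrite ler1n|exact: exprn_ege1].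
move: h; set c := 1536 * _; move: c => c h; have c0 : 0 < c by exact: lt_le_trans h.
by rewrite invr_gt0 c0 invf_le1.
Qed.

Section SmallBall.
Context {d d' : measure_display} {T : measurableType d} {U : measurableType d'}.
Context {R : realType}.
Variables (P : probability T R) (n : nat) (a : 'I_n -> T -> U).
Hypothesis ma : forall i, measurable_fun setT (a i).
Hypothesis ind : mutually_independent P a.
Variables (xf yf : U -> R).
Hypothesis mx : measurable_fun setT xf.
Hypothesis my : measurable_fun setT yf.

Definition sqnorm u : R := xf u ^+ 2 + yf u ^+ 2.

Variables (zeta gam rho tau : R) (K : nat).
Definition small u : R := if sqnorm u <= tau ^+ 2 then 1 else 0.

Hypothesis L4 : forall i, L1 P (fun w => sqnorm (a i w) ^+ 2).
Hypothesis x0 : forall i, Ex P (xf \o a i) = 0.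
Hypothesis y0 : forall i, Ex P (yf \o a i) = 0.
Hypothesis n1 : forall i, Ex P (sqnorm \o a i) = 1.
Hypothesis n2 : forall i, 1 + zeta <= Ex P (fun w => sqnorm (a i w) ^+ 2).
Hypothesis cov : forall i,
  (Ex P (fun w => xf (a i w) ^+ 2) - Ex P (fun w => yf (a i w) ^+ 2)) ^+ 2 +
  4 * Ex P (fun w => xf (a i w) * yf (a i w)) ^+ 2 <= gam ^+ 2.
Hypothesis zeta0 : 0 < zeta.
Hypothesis gam0 : 0 <= gam.
Hypothesis zeta_gam : zeta <= 1 - gam ^+ 2.
Hypothesis big_part : forall i,
  Ex P (fun w => sqnorm (a i w) ^+ 2 * (1 - small (a i w))) <= rho.
Hypothesis small_part : forall i,
  Ex P (fun w => sqnorm (a i w) ^+ K.+1.*2 * small (a i w)) <= rho * tau ^+ (4 * K).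
Hypothesis rho_zeta : rho <= zeta / 2.
Hypothesis tau4 : 4 <= tau.
Hypothesis K0 : (0 < K)%N.
Hypothesis zeta_tau : 1 <= zeta * tau ^+ (4 * K).

(* [bx + i by_] is the truncated and recentered entry, [dd] the truncated and
   recentered squared modulus. Replacing the entries by [bx, by_] and the
   diagonal by [dd] keeps the chaos structure, so that the error is again a sum
   of orthogonal components. *)
Let mux i := Ex P (fun w => xf (a i w) * small (a i w)).
Let muy i := Ex P (fun w => yf (a i w) * small (a i w)).
Let bx i u := xf u * small u - mux i.
Let by_ i u := yf u * small u - muy i.
Let dd i u := sqnorm u * small u - Ex P (fun w => sqnorm (a i w) * small (a i w)).

Let zeta1 : zeta <= 1.
Proof. by move: zeta_gam; have := sqr_ge0 gam; lra. Qed.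

Let mN : measurable_fun setT sqnorm.
Proof. by apply: measurable_funD; exact: measurable_funX. Qed.

Let msm : measurable_fun setT small.
Proof.
apply: measurable_fun_ifT; [|exact: measurable_cst|exact: measurable_cst].
by apply: measurable_fun_ler => //; exact: measurable_cst.
Qed.

Let sm01 u : 0 <= small u <= 1.
Proof. by rewrite /small; case: ifP; rewrite !lexx ler01. Qed.

Let sm2 u : small u ^+ 2 = small u.
Proof. by rewrite /small; case: ifP; rewrite ?expr1n ?expr0n. Qed.

Let N0 u : 0 <= sqnorm u.
Proof. by rewrite addr_ge0 ?sqr_ge0. Qed.

Let mcomp (f : U -> R) i : measurable_fun setT f -> measurable_fun setT (fun w => f (a i w)).
Proof. by move=> mf; exact: measurableT_comp. Qed.

Let L2N i : L2 P (fun w => sqnorm (a i w)).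
Proof. by split; [exact: mcomp|exact: L4]. Qed.

Let L1N i : L1 P (fun w => sqnorm (a i w)).
Proof. exact/L2_L1/L2N. Qed.

Let L2x i : L2 P (fun w => xf (a i w)).
Proof.
split; first exact: mcomp.
apply: L1_le (L1N i); first by apply: measurable_funX; exact: mcomp.
by move=> w; rewrite ger0_norm ?sqr_ge0// lerDl sqr_ge0.
Qed.

Let L2y i : L2 P (fun w => yf (a i w)).
Proof.
split; first exact: mcomp.
apply: L1_le (L1N i); first by apply: measurable_funX; exact: mcomp.
by move=> w; rewrite ger0_norm ?sqr_ge0// lerDr sqr_ge0.
Qed.

Let L2sm (f : U -> R) i : measurable_fun setT f -> L2 P (fun w => f (a i w)) ->
  L2 P (fun w => f (a i w) * small (a i w)) /\
  L2 P (fun w => f (a i w) * (1 - small (a i w))).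
Proof.
move=> mf [_ Lf]; split; split.
- by apply: measurable_funM; exact: mcomp.
- apply: L1_le Lf; first by apply: measurable_funX; apply: measurable_funM; exact: mcomp.
  move=> w; rewrite ger0_norm ?sqr_ge0// exprMn ler_piMr ?sqr_ge0// sm2.
  by case/andP: (sm01 (a i w)).
- apply: measurable_funM; first exact: mcomp.
  by apply: measurable_funB => //; exact: mcomp.
- apply: L1_le Lf.
    apply: measurable_funX; apply: measurable_funM; first exact: mcomp.
    by apply: measurable_funB => //; exact: mcomp.
  move=> w; rewrite ger0_norm ?sqr_ge0// exprMn ler_piMr ?sqr_ge0//.
  by have := sm2 (a i w); have := sm01 (a i w); nra.
Qed.

(* Above the level, the squared modulus is at most [tau^-2] times its square. *)
Let eta_le i : Ex P (fun w => sqnorm (a i w) * (1 - small (a i w))) <= zeta / 32.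
Proof.
have [_ L] := L2sm mN (L2N i).
have LB : L1 P (fun w => sqnorm (a i w) ^+ 2 * (1 - small (a i w))).
  apply: L1_le (L4 i).
    by apply: measurable_funM; [apply: measurable_funX; exact: mcomp|apply: measurable_funB => //; exact: mcomp].
  move=> w; have := sm01 (a i w) => /andP[s0 s1].
  by rewrite ger0_norm ?mulr_ge0 ?sqr_ge0 ?subr_ge0// ler_piMr ?sqr_ge0// gerBl.
suff : Ex P (fun w => sqnorm (a i w) * (1 - small (a i w))) <= 16^-1 * rho.
  by move=> H; apply: (le_trans H); move: rho_zeta; lra.
apply: le_trans (_ : 16^-1 * Ex P (fun w => sqnorm (a i w) ^+ 2 * (1 - small (a i w))) <= _); last first.
  by rewrite ler_pM2l.
rewrite -ExZ//; apply: Ex_le; [exact: L2_L1|exact: L1Z|].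
move=> w; rewrite /small; case: (lerP (sqnorm _) (tau ^+ 2)) => [_|H]; first by rewrite subrr !mulr0.
rewrite subr0 !mulr1; have : 16 <= tau ^+ 2 by move: tau4; nra.
by have := N0 (a i w); nra.
Qed.

Let mu_le (f : U -> R) i : measurable_fun setT f -> L2 P (fun w => f (a i w)) ->
  Ex P (fun w => f (a i w)) = 0 -> (forall u, f u ^+ 2 <= sqnorm u) ->
  `|Ex P (fun w => f (a i w) * small (a i w))| <= tau^-1.
Proof.
move=> mf Lf f0 fN; have [Ls Lb] := L2sm mf Lf.
have [_ LN] := L2sm mN (L2N i).
have tau0 : 0 < tau by move: tau4; lra.
have -> : Ex P (fun w => f (a i w) * small (a i w)) =
    - Ex P (fun w => f (a i w) * (1 - small (a i w))).
  apply/eqP; rewrite -addr_eq0 -ExD; [|exact: L2_L1|exact: L2_L1].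
  by apply/eqP; rewrite -f0; apply: Ex_ext => w; rewrite -mulrDr addrC subrK mulr1.
rewrite normrN.
apply: (@le_trans _ _ (tau^-1 * Ex P (fun w => sqnorm (a i w) * (1 - small (a i w))))).
  rewrite -ExZ; last exact: L2_L1.
  apply: Ex_norm_le; [exact: L2_L1|by apply: L1Z; exact: L2_L1|].
  move=> w; rewrite /small; case: (lerP (sqnorm _) (tau ^+ 2)) => [_|H]; first by rewrite subrr !mulr0 normr0.
  rewrite subr0 !mulr1 mulrC ler_pdivlMr//.
  rewrite -ler_sqr ?nnegrE ?N0 ?mulr_ge0 ?(ltW tau0)//.
  rewrite exprMn real_normK ?num_real// [leRHS]expr2.
  by apply: ler_pM; rewrite ?sqr_ge0// ltW.
rewrite ler_piMr ?invr_ge0 ?ltW//.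
by apply: le_lt_trans (eta_le i) _; have := zeta1; lra.
Qed.

Let mux_le i : `|mux i| <= tau^-1.
Proof. by apply: mu_le => //; [exact: x0|move=> u; rewrite lerDl sqr_ge0]. Qed.

Let muy_le i : `|muy i| <= tau^-1.
Proof. by apply: mu_le => //; [exact: y0|move=> u; rewrite lerDr sqr_ge0]. Qed.

Let coord_small (f : U -> R) u : f u ^+ 2 <= sqnorm u -> `|f u * small u| <= tau.
Proof.
move=> fN; have tau0 : 0 <= tau by move: tau4; lra.
rewrite /small; case: ifP => [H|_]; last by rewrite mulr0 normr0.
rewrite mulr1 -ler_sqr ?nnegrE// real_normK ?num_real//.
exact: le_trans H.
Qed.

Let x_small u : `|xf u * small u| <= tau.
Proof. by apply: coord_small; rewrite lerDl sqr_ge0. Qed.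
Let y_small u : `|yf u * small u| <= tau.
Proof. by apply: coord_small; rewrite lerDr sqr_ge0. Qed.

Let tauV : tau^-1 <= 4^-1.
Proof. by rewrite lef_pV2 ?posrE//; have := tau4; lra. Qed.

Let bnd_b (f : U -> R) u (mu : R) : `|f u * small u| <= tau -> `|mu| <= tau^-1 ->
  `|f u * small u - mu| <= 2 * tau.
Proof.
move=> H1 H2; rewrite (le_trans (ler_normB _ _))//; have := tauV; have := tau4; lra.
Qed.

Let mbx i : measurable_fun setT (bx i).
Proof. by apply: measurable_funB => //; exact: measurable_funM. Qed.
Let mby i : measurable_fun setT (by_ i).
Proof. by apply: measurable_funB => //; exact: measurable_funM. Qed.

Let L2bx i : L2 P (bx i \o a i).
Proof.
apply: (@L2_bounded _ _ _ P _ (2 * tau)); first exact: measurableT_comp.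
by move=> w; exact: bnd_b.
Qed.
Let L2by i : L2 P (by_ i \o a i).
Proof.
apply: (@L2_bounded _ _ _ P _ (2 * tau)); first exact: measurableT_comp.
by move=> w; exact: bnd_b.
Qed.

Let cfx : centered_family P a (fun=> xf).
Proof. by move=> i; split=> //; exact: L2x. Qed.
Let cfy : centered_family P a (fun=> yf).
Proof. by move=> i; split=> //; exact: L2y. Qed.
Let cfD : centered_family P a (fun _ u => sqnorm u - 1).
Proof.
move=> i; split; first exact: measurable_funB.
  by apply: L2B; [exact: L2N|exact: L2_cst].
rewrite [LHS](@ExB _ _ _ P (fun w => sqnorm (a i w)) (fun=> 1)) ?Ex_cst ?n1 ?subrr//.
exact: L1_cst.
Qed.

Let centered_b (f : U -> R) i : L1 P (fun w => f (a i w)) ->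
  Ex P (fun w => f (a i w) - Ex P (fun w => f (a i w))) = 0.
Proof. by move=> Lf; rewrite ExB ?Ex_cst ?subrr//; exact: L1_cst. Qed.

Let cbx : centered_family P a bx.
Proof.
move=> i; split; [exact: mbx|exact: L2bx|].
by apply: (@centered_b (fun u => xf u * small u)); apply/L2_L1; case: (L2sm mx (L2x i)).
Qed.
Let cby : centered_family P a by_.
Proof.
move=> i; split; [exact: mby|exact: L2by|].
by apply: (@centered_b (fun u => yf u * small u)); apply/L2_L1; case: (L2sm my (L2y i)).
Qed.
Let cdd : centered_family P a dd.
Proof.
move=> i; have [Ls _] := L2sm mN (L2N i); split.
- by apply: measurable_funB => //; exact: measurable_funM.
- by apply: L2B; [by []|exact: L2_cst].
- by apply: (@centered_b (fun u => sqnorm u * small u)); exact: L2_L1.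
Qed.


Let bnorm u i := bx i u ^+ 2 + by_ i u ^+ 2.
Let M := K.+1.*2.
Let MT := zeta * tau ^+ (4 * K).

Let MT1 : 1 <= MT. Proof. exact: zeta_tau. Qed.

Let bnorm_le u i : bnorm u i <= 2 * (sqnorm u * small u + 1).
Proof.
have tau1 : tau^-1 ^+ 2 <= 16^-1.
  have h0 : 0 <= tau^-1 by rewrite invr_ge0; move: tau4; lra.
  by have := ler_pM h0 h0 tauV tauV; rewrite expr2; lra.
have sq (mu : R) : `|mu| <= tau^-1 -> mu ^+ 2 <= 16^-1.
  move=> H; apply: le_trans tau1; rewrite -[leLHS]real_normK ?num_real//.
  by rewrite lerXn2r ?nnegrE// (le_trans _ H).
have Hx := sq _ (mux_le i); have Hy := sq _ (muy_le i).
have Bx : bx i u ^+ 2 <= 2 * ((xf u * small u) ^+ 2 + mux i ^+ 2).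
  by apply: (le_trans (sqrD_le2 _ _)); rewrite sqrrN.
have By : by_ i u ^+ 2 <= 2 * ((yf u * small u) ^+ 2 + muy i ^+ 2).
  by apply: (le_trans (sqrD_le2 _ _)); rewrite sqrrN.
move: Bx By; rewrite /bnorm /sqnorm !exprMn sm2; lra.
Qed.

Let bnorm_ge0 u i : 0 <= bnorm u i.
Proof. by rewrite addr_ge0 ?sqr_ge0. Qed.

Let mbnorm i : measurable_fun setT (fun u => bnorm u i).
Proof. by apply: measurable_funD; exact: measurable_funX. Qed.

Let bnorm_bound u i : bnorm u i <= 8 * tau ^+ 2.
Proof.
have sq (f : R) : `|f| <= 2 * tau -> f ^+ 2 <= 4 * tau ^+ 2.
  move=> H; rewrite -[leLHS]real_normK ?num_real// (_ : 4 * tau ^+ 2 = (2 * tau) ^+ 2); last by ring.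
  by rewrite lerXn2r ?nnegrE// (le_trans _ H).
have := sq _ (bnd_b (x_small u) (mux_le i)); have := sq _ (bnd_b (y_small u) (muy_le i)).
by rewrite /bnorm /bx /by_; lra.
Qed.

Let Ex_bnorm i : L1 P (fun w => bnorm (a i w) i) /\ Ex P (fun w => bnorm (a i w) i) <= 1.
Proof.
split; first by apply: L1D; [exact: (L2bx i).2|exact: (L2by i).2].
rewrite ExD; [|exact: (L2bx i).2|exact: (L2by i).2].
have aux (f : U -> R) : measurable_fun setT f -> L2 P (fun w => f (a i w)) ->
   Ex P (fun w => (f (a i w) * small (a i w) - Ex P (fun w => f (a i w) * small (a i w))) ^+ 2)
   <= Ex P (fun w => f (a i w) ^+ 2).
  move=> mf Lf; have [Ls Lb] := L2sm mf Lf.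
  apply: le_trans (Ex_var_le Ls) _; apply: Ex_le; [exact: Ls.2|exact: Lf.2|] => w.
  rewrite exprMn sm2 ler_piMr ?sqr_ge0//; by case/andP: (sm01 (a i w)).
apply: le_trans (lerD (aux _ mx (L2x i)) (aux _ my (L2y i))) _.
by rewrite -ExD ?n1//; [exact: (L2x i).2|exact: (L2y i).2].
Qed.

(* The recentering constants are at most [tau^-1], so only the truncated moment
   and an additive constant remain; the constant is absorbed by [MT >= 1]. *)
Let Ex_bnorm_pow i : L1 P (fun w => bnorm (a i w) i ^+ M) /\
  Ex P (fun w => bnorm (a i w) i ^+ M) <= 2 * 4 ^+ M * MT.
Proof.
have mp : measurable_fun setT (fun w => bnorm (a i w) i ^+ M).
  by apply: measurable_funX; exact: (mcomp i (mbnorm i)).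
have Lp : L1 P (fun w => bnorm (a i w) i ^+ M).
  apply: (@L1_bounded _ _ _ P _ ((8 * tau ^+ 2) ^+ M)) => // w.
  by rewrite ger0_norm ?exprn_ge0// lerXn2r ?nnegrE// (le_trans (bnorm_ge0 (a i w) i)).
split=> //.
have Ls : L1 P (fun w => sqnorm (a i w) ^+ M * small (a i w)).
  apply: (@L1_bounded _ _ _ P _ ((tau ^+ 2) ^+ M)).
    by apply: measurable_funM; [apply: measurable_funX|]; exact: mcomp.
  move=> w; rewrite /small; case: ifP => [H|_].
    by rewrite mulr1 ger0_norm ?exprn_ge0// lerXn2r ?nnegrE// (le_trans (N0 (a i w))).
  by rewrite mulr0 normr0 exprn_ge0// sqr_ge0.
apply: (@le_trans _ _ (4 ^+ M * (Ex P (fun w => sqnorm (a i w) ^+ M * small (a i w)) + 1))).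
  rewrite -[X in _ + X](Ex_cst P 1) -ExD//; last exact: L1_cst.
  rewrite -ExZ; last by apply: L1D => //; exact: L1_cst.
  apply: Ex_le => //; first by apply: L1Z; apply: L1D => //; exact: L1_cst.
  move=> w; have /andP[s0 _] := sm01 (a i w).
  apply: (@le_trans _ _ ((2 * (sqnorm (a i w) * small (a i w) + 1)) ^+ M)).
    by rewrite lerXn2r ?nnegrE// ?mulr_ge0 ?addr_ge0 ?mulr_ge0.
  have E4 : 4 ^+ M = 2 ^+ M * 2 ^+ M :> R.
    by rewrite -exprMn; congr (_ ^+ _); lra.
  rewrite exprMn E4 -[leRHS]mulrA ler_wpM2l ?exprn_ge0//.
  have := exprD_le2 M (mulr_ge0 (N0 (a i w)) s0) ler01.
  rewrite expr1n exprMn (_ : small _ ^+ M = small (a i w))//.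
  by rewrite /small; case: ifP; rewrite ?expr1n// expr0n.
have H := small_part i; have r := rho_zeta; have z0 := zeta0.
have tK : 0 <= tau ^+ (4 * K) by rewrite exprn_ge0//; move: tau4; lra.
have rM : rho * tau ^+ (4 * K) <= MT by rewrite ler_wpM2r//; lra.
rewrite (_ : 2 * 4 ^+ M * MT = 4 ^+ M * (2 * MT)); last by ring.
rewrite ler_wpM2l ?exprn_ge0//.
by move: (le_trans H rM) MT1; rewrite -/M; lra.
Qed.

(* [Ex_sum_even_moment] with variances [v i = |c i|^2]. Each [v i] is at most 2,
   so a high power of [v i] is a constant times [v i], as required there. *)
Let lin_re_moment (cr ci : 'I_n -> R) : \sum_i (cr i ^+ 2 + ci i ^+ 2) <= 2 ->
  L1 P (fun w => (\sum_i (bx i (a i w) * cr i + by_ i (a i w) * ci i)) ^+ M.*2) /\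
  Ex P (fun w => (\sum_i (bx i (a i w) * cr i + by_ i (a i w) * ci i)) ^+ M.*2)
   <= linear_moment_const R K * MT.
Proof.
move=> c2; pose v i := cr i ^+ 2 + ci i ^+ 2.
have v0 i : 0 <= v i by rewrite addr_ge0 ?sqr_ge0.
have v2 i : v i <= 2.
  apply: le_trans c2; rewrite (bigD1 i)//= lerDl sumr_ge0// => j _; exact: v0.
pose z i u := bx i u * cr i + by_ i u * ci i.
have z2 i u : z i u ^+ 2 <= bnorm u i * v i.
  rewrite -subr_ge0 (_ : _ - _ = (bx i u * ci i - by_ i u * cr i) ^+ 2) ?sqr_ge0//.
  by rewrite /z /bnorm /v; ring.
have mz i : measurable_fun setT (z i).
  by apply: measurable_funD; apply: measurable_funM.
have t0 : 0 <= tau by move: tau4; lra.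
have zb i u : `|z i u| <= 4 * tau.
  rewrite -ler_sqr ?nnegrE ?mulr_ge0// real_normK ?num_real//.
  apply: (le_trans (z2 i u)); apply: le_trans (ler_pM _ _ (bnorm_bound u i) (v2 i)) _ => //.
  by apply: eq_ler; ring.
have zE i : Ex P (z i \o a i) = 0.
  rewrite [LHS](@ExD _ _ _ P (fun w => bx i (a i w) * cr i) (fun w => by_ i (a i w) * ci i)).
  - have [_ _ hx] := cbx i; have [_ _ hy] := cby i.
    rewrite (@Ex_ext _ _ _ P _ (fun w => cr i * bx i (a i w))); last by move=> w; rewrite mulrC.
    rewrite (@Ex_ext _ _ _ P (fun w => by_ i (a i w) * ci i) (fun w => ci i * by_ i (a i w))); last by move=> w; rewrite mulrC.
    rewrite !ExZ; [|exact: (L2_L1 (L2by i))|exact: (L2_L1 (L2bx i))].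
    by rewrite [Ex _ _]hx [Ex _ _]hy !mulr0 addr0.
  - by apply: L1_ext (L1Z (cr i) (L2_L1 (L2bx i))) => w; rewrite mulrC.
  - by apply: L1_ext (L1Z (ci i) (L2_L1 (L2by i))) => w; rewrite mulrC.
have Lzp i k : L1 P (fun w => z i (a i w) ^+ k).
  apply: (@L1_bounded _ _ _ P _ ((4 * tau) ^+ k)).
    by apply: measurable_funX; exact: (mcomp i (mz i)).
  by move=> w; rewrite normrX lerXn2r ?nnegrE ?mulr_ge0.
have zv i : Ex P (fun w => z i (a i w) ^+ 2) <= v i.
  apply: (@le_trans _ _ (Ex P (fun w => v i * bnorm (a i w) i))).
    apply: Ex_le => //; first by apply: L1Z; case: (Ex_bnorm i).
    by move=> w; rewrite mulrC.
  by have [L E] := Ex_bnorm i; rewrite ExZ// ler_piMr.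
have MTp : 0 <= MT by apply: le_trans MT1.
have zM i : Ex P (fun w => z i (a i w) ^+ M.*2) <= (2 * 8 ^+ M * MT) * v i.
  have [Lp Ep] := Ex_bnorm_pow i.
  apply: (@le_trans _ _ (Ex P (fun w => (2 ^+ M * v i) * bnorm (a i w) i ^+ M))).
    apply: Ex_le => //; first exact: L1Z.
    move=> w; rewrite -mul2n exprM.
    apply: (@le_trans _ _ ((bnorm (a i w) i * v i) ^+ M)).
      by rewrite lerXn2r ?nnegrE ?sqr_ge0 ?mulr_ge0.
    rewrite exprMn mulrC ler_wpM2r ?exprn_ge0// /M doubleS exprS mulrC ler_wpM2r//.
    apply: (@le_trans _ _ (2 ^+ K.*2.+1)); first by rewrite lerXn2r ?nnegrE.
    by rewrite [leRHS]exprS ler_peMl ?exprn_ge0//; lra.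
  rewrite ExZ//; apply: le_trans (ler_wpM2l _ Ep) _; first by rewrite mulr_ge0 ?exprn_ge0.
  apply: eq_ler.
  by rewrite (_ : 8 = 2 * 4 :> R) ?exprMn; [ring|lra].
have M0 : (0 < M)%N by [].
have [L E] := Ex_sum_even_moment ma ind M0 mz zb zE v0
   (mulr_ge0 (mulr_ge0 (ler0n R 2) (exprn_ge0 M (ler0n R 8))) MTp) zv zM c2.
split=> //; apply: (le_trans E).
rewrite /linear_moment_const -/M [leRHS]mulrAC; apply: ler_wpM2r; first exact: expR_ge0.
have : 1 <= 8 ^+ M * MT by rewrite mulr_ege1// exprn_ege1//; lra.
lra.
Qed.

Section Bilinear.
Variables sr si tr ti : 'I_n -> R.

Definition lin_re (fx fy : 'I_n -> U -> R) (cr ci : 'I_n -> R) (w : T) : R :=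
  \sum_i (fx i (a i w) * cr i + fy i (a i w) * ci i).
Definition lin_im (fx fy : 'I_n -> U -> R) (cr ci : 'I_n -> R) (w : T) : R :=
  \sum_i (fx i (a i w) * ci i - fy i (a i w) * cr i).
Definition herm (fx fy : 'I_n -> U -> R) (w : T) : R :=
  lin_re fx fy sr si w * lin_re fx fy tr ti w +
  lin_im fx fy sr si w * lin_im fx fy tr ti w.

(* Coefficients of [Re (<a,s> conj <a,t>)]: [h] is the real part of
   [s i * conj (t i)], [im] its imaginary part, and [cr + i ci] is
   [s i * conj (t j) + t i * conj (s j)], the coefficient of the pair [i < j]. *)
Let h i := sr i * tr i + si i * ti i.
Let im i := si i * tr i - sr i * ti i.
Let cr p := sr p.1 * tr p.2 + si p.1 * ti p.2 + tr p.1 * sr p.2 + ti p.1 * si p.2.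
Let ci p := si p.1 * tr p.2 - sr p.1 * ti p.2 + ti p.1 * sr p.2 - tr p.1 * si p.2.

Let herm_expand fx fy (D : 'I_n -> U -> R) w :
  herm fx fy w + \sum_i h i * (D i (a i w) - (fx i (a i w) ^+ 2 + fy i (a i w) ^+ 2))
  = \sum_(p : 'I_n * 'I_n | (p.1 <= p.2)%N) form_part a h cr ci D fx fy p w.
Proof.
rewrite -sum_diag /herm /lin_re /lin_im !big_distrlr/= -big_split /=.
rewrite (eq_bigr (fun i => \sum_j ((fx i (a i w) * sr i + fy i (a i w) * si i) *
    (fx j (a j w) * tr j + fy j (a j w) * ti j) +
    (fx i (a i w) * si i - fy i (a i w) * sr i) *
    (fx j (a j w) * ti j - fy j (a j w) * tr j)))); last first.
  by move=> i _; rewrite big_split.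
rewrite sum_ordered_pairs -big_split /=; apply: eq_bigr => -[i j] _ /=.
by rewrite /form_part /= /cr /ci /h /=; case: eqVneq => [->|_]; ring.
Qed.

Let compX := form_part a h cr ci (fun _ u => sqnorm u - 1) (fun=> xf) (fun=> yf).
Let compY := form_part a h cr ci dd bx by_.
Let X := herm (fun=> xf) (fun=> yf).
Let Y w := \sum_i h i + \sum_(p : 'I_n * 'I_n | (p.1 <= p.2)%N) compY p w.

Let XE w : X w = \sum_i h i + \sum_(p : 'I_n * 'I_n | (p.1 <= p.2)%N) compX p w.
Proof.
rewrite -herm_expand addrCA -[LHS]addr0; congr (_ + _); rewrite -big_split big1//= => i _.
rewrite /sqnorm; ring.
Qed.

Let chX : chaos P a compX. Proof. exact: chaos_form_part. Qed.
Let chY : chaos P a compY. Proof. exact: chaos_form_part. Qed.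

(* Lower bounds on the second moments of the components: the diagonal ones see
   [E |a|^4 - 1], the others the least eigenvalue of the covariance matrix of the
   real and imaginary parts. *)
Let tri : 'I_n * 'I_n -> R := fun p =>
  if p.1 == p.2 then zeta * h p.1 ^+ 2 else zeta / 4 * (cr p ^+ 2 + ci p ^+ 2).

(* The covariance matrix has trace 1 and the difference of its eigenvalues is
   [|E a^2| <= gam], so its least eigenvalue is at least [(1 - gam) / 2]. *)
Let cov_psd i (A B : R) : zeta / 4 * (A ^+ 2 + B ^+ 2) <=
   Ex P (fun w => xf (a i w) ^+ 2) * A ^+ 2 +
   2 * Ex P (fun w => xf (a i w) * yf (a i w)) * (A * B) +
   Ex P (fun w => yf (a i w) ^+ 2) * B ^+ 2.
Proof.
have sxy : Ex P (fun w => xf (a i w) ^+ 2) + Ex P (fun w => yf (a i w) ^+ 2) = 1.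
  by rewrite -ExD ?n1//; [case: (L2x i)|case: (L2y i)].
have := cov i; move: sxy.
set sx := Ex P (fun w => xf (a i w) ^+ 2); set sy := Ex P (fun w => yf (a i w) ^+ 2).
set sxy := Ex P (fun w => xf (a i w) * yf (a i w)) => sx1 c.
set g1 := sx - sy; set g2 := 2 * sxy; set p := A ^+ 2 - B ^+ 2; set q := 2 * A * B.
set r := A ^+ 2 + B ^+ 2.
have r0 : 0 <= r by rewrite addr_ge0 ?sqr_ge0.
have gr : `|g1 * p + g2 * q| <= gam * r.
  rewrite -ler_sqr ?nnegrE ?mulr_ge0// real_normK ?num_real// exprMn.
  have cs : (g1 * p + g2 * q) ^+ 2 <= (g1 ^+ 2 + g2 ^+ 2) * (p ^+ 2 + q ^+ 2).
    by have := sqr_ge0 (g1 * q - g2 * p); nra.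
  have -> : r ^+ 2 = p ^+ 2 + q ^+ 2 by rewrite /r /p /q; ring.
  apply: le_trans cs _; apply: ler_wpM2r; first by rewrite addr_ge0 ?sqr_ge0.
  by apply: le_trans c; apply: eq_ler; rewrite /g1 /g2; ring.
have gam1 : zeta / 2 <= 1 - gam by move: zeta_gam gam0 zeta0; nra.
have : zeta / 2 * r <= (1 - gam) * r by exact: ler_wpM2r.
move: gr; rewrite ler_norml => /andP[lo _].
have -> : sx * A ^+ 2 + 2 * sxy * (A * B) + sy * B ^+ 2 = (r + (g1 * p + g2 * q)) / 2.
  have -> : sx = (1 + g1) / 2 by rewrite /g1; lra.
  have -> : sy = (1 - g1) / 2 by rewrite /g1; lra.
  by rewrite /r /p /q /g2; field.
rewrite -/r; lra.
Qed.


Let Ex_sqnormB i : L2 P (fun w => sqnorm (a i w) - 1) /\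
  Ex P (fun w => (sqnorm (a i w) - 1) ^+ 2) = Ex P (fun w => sqnorm (a i w) ^+ 2) - 1.
Proof.
split; first by apply: L2B; [exact: L2N|exact: L2_cst].
rewrite (@Ex_ext _ _ _ P _ (fun w => (sqnorm (a i w) ^+ 2 - 2 * sqnorm (a i w)) + 1)); last first.
  by move=> w; ring.
have LN := L1Z 2 (L1N i).
rewrite ExD; [|exact: L1B|exact: L1_cst].
rewrite ExB// ExZ// Ex_cst [Ex P (fun w => sqnorm _)]n1; ring.
Qed.

Let diag_lb i : zeta * h i ^+ 2 <= Ex P (fun w => (h i * (sqnorm (a i w) - 1)) ^+ 2).
Proof.
have [L E] := Ex_sqnormB i.
rewrite (@Ex_ext _ _ _ P _ (fun w => h i ^+ 2 * (sqnorm (a i w) - 1) ^+ 2)); last first.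
  by move=> w; rewrite exprMn.
rewrite ExZ; last exact: L.2.
rewrite E mulrC ler_wpM2l ?sqr_ge0//; have := n2 i; lra.
Qed.

Let diag_diff i : Ex P (fun w => (h i * (sqnorm (a i w) - 1) - h i * dd i (a i w)) ^+ 2)
  <= 2^-1 * Ex P (fun w => (h i * (sqnorm (a i w) - 1)) ^+ 2).
Proof.
have [Ls Lb] := L2sm mN (L2N i).
set f := fun w => sqnorm (a i w) * (1 - small (a i w)).
have Ef : Ex P f = 1 - Ex P (fun w => sqnorm (a i w) * small (a i w)).
  rewrite -(n1 i) -ExB; [|exact: L1N|exact: L2_L1].
  by apply: Ex_ext => w; rewrite /f /=; ring.
rewrite (@Ex_ext _ _ _ P _ (fun w => h i ^+ 2 * (f w - Ex P f) ^+ 2)); last first.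
  by move=> w; rewrite Ef /f /dd; ring.
have Lf2 : L2 P (fun w => f w - Ex P f) by apply: L2B => //; exact: L2_cst.
rewrite ExZ; last exact: Lf2.2.
apply: (@le_trans _ _ (2^-1 * (zeta * h i ^+ 2))); last by rewrite ler_pM2l.
rewrite mulrA mulrC ler_wpM2r ?sqr_ge0//.
apply: le_trans (Ex_var_le Lb) _.
rewrite (@Ex_ext _ _ _ P _ (fun w => sqnorm (a i w) ^+ 2 * (1 - small (a i w)))).
  by apply: (le_trans (big_part i)); move: rho_zeta; lra.
move=> w; have := sm2 (a i w) => s2; rewrite exprMn; congr (_ * _).
by rewrite sqrrB s2; ring.
Qed.

(* Conditionally on entry [j], the component is a linear form in the real and
   imaginary parts of entry [i], with coefficients [A] and [B]. *)
Let off_lb i j (c1 c2 : R) : i != j ->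
  zeta / 4 * (c1 ^+ 2 + c2 ^+ 2) <= Ex P (fun w =>
   (c1 * (xf (a i w) * xf (a j w) + yf (a i w) * yf (a j w)) +
    c2 * (yf (a i w) * xf (a j w) - xf (a i w) * yf (a j w))) ^+ 2).
Proof.
move=> ij.
pose A u := c1 * xf u - c2 * yf u; pose B u := c1 * yf u + c2 * xf u.
have mA : measurable_fun setT A by apply: measurable_funB; exact: measurable_funM.
have mB : measurable_fun setT B by apply: measurable_funD; exact: measurable_funM.
have LA : L2 P (fun w => A (a j w)).
  by apply: L2B; apply: L2Z; [exact: L2x|exact: L2y].
have LB : L2 P (fun w => B (a j w)).
  by apply: L2D; apply: L2Z; [exact: L2y|exact: L2x].
have LAB := L2_mul LA LB; have Lxy := L2_mul (L2x i) (L2y i).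
have [L1' E1] := Ex_mul_indep ma ind ij (f := fun u => xf u ^+ 2) (g := fun u => A u ^+ 2)
  (measurable_funX 2 mx) (measurable_funX 2 mA) (L2x i).2 LA.2.
have [L2' E2] := Ex_mul_indep ma ind ij (f := fun u => xf u * yf u) (g := fun u => A u * B u)
  (measurable_funM mx my) (measurable_funM mA mB) Lxy LAB.
have [L3' E3] := Ex_mul_indep ma ind ij (f := fun u => yf u ^+ 2) (g := fun u => B u ^+ 2)
  (measurable_funX 2 my) (measurable_funX 2 mB) (L2y i).2 LB.2.
rewrite (@Ex_ext _ _ _ P _ (fun w => (xf (a i w) ^+ 2 * A (a j w) ^+ 2 +
   2 * (xf (a i w) * yf (a i w) * (A (a j w) * B (a j w)))) +
   yf (a i w) ^+ 2 * B (a j w) ^+ 2)); last by move=> w; rewrite /A /B; ring.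
have L2Z' := L1Z 2 L2'.
rewrite ExD; [|exact: L1D|by []].
rewrite ExD// ExZ// E1 E2 E3.
apply: (@le_trans _ _ (Ex P (fun w => zeta / 4 * (A (a j w) ^+ 2 + B (a j w) ^+ 2)))).
  rewrite ExZ; last by apply: L1D; [exact: LA.2|exact: LB.2].
  rewrite (@Ex_ext _ _ _ P (fun w => A (a j w) ^+ 2 + B (a j w) ^+ 2)
    (fun w => (c1 ^+ 2 + c2 ^+ 2) * sqnorm (a j w))).
    by rewrite ExZ ?[Ex P (fun w => sqnorm _)]n1 ?mulr1//; exact: L1N.
  by move=> w; rewrite /A /B /sqnorm; ring.
apply: le_trans (Ex_le _ _ (fun w => cov_psd i (A (a j w)) (B (a j w)))) _.
- by apply: L1Z; apply: L1D; [exact: LA.2|exact: LB.2].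
- by apply: L1D; [apply: L1D|]; apply: L1Z => //; [exact: LA.2|exact: LB.2].
- rewrite ExD; last 2 first.
  + by apply: L1D; apply: L1Z => //; exact: LA.2.
  + by apply: L1Z; exact: LB.2.
  rewrite ExD; [|by apply: L1Z; exact: LA.2|exact: L1Z].
  rewrite !ExZ//; [|exact: LB.2|exact: LA.2].
  by rewrite -mulrA.
Qed.

Let resid u i := (xf u - bx i u) ^+ 2 + (yf u - by_ i u) ^+ 2.
Let Ex_resid i : L1 P (fun w => resid (a i w) i) /\ Ex P (fun w => resid (a i w) i) <= zeta / 32.
Proof.
have aux (f : U -> R) : measurable_fun setT f -> L2 P (fun w => f (a i w)) ->
   Ex P (fun w => f (a i w)) = 0 ->
   let g w := f (a i w) - (f (a i w) * small (a i w) - Ex P (fun w => f (a i w) * small (a i w))) in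
   L2 P g /\ Ex P (fun w => g w ^+ 2) <= Ex P (fun w => f (a i w) ^+ 2 * (1 - small (a i w))).
  move=> mf Lf f0 g; have [Ls Lb] := L2sm mf Lf.
  pose f' w := f (a i w) * (1 - small (a i w)).
  have gE w : g w = f' w - Ex P f'.
    have -> : Ex P f' = - Ex P (fun w => f (a i w) * small (a i w)).
      rewrite -[RHS]add0r -f0 -ExB; [|exact: L2_L1|exact: L2_L1].
      by apply: Ex_ext => w'; rewrite /f'; ring.
    by rewrite /g /f'; ring.
  have Lg : L2 P g by apply: L2B => //; apply: L2B => //; exact: L2_cst.
  split=> //; rewrite (@Ex_ext _ _ _ P _ (fun w => (f' w - Ex P f') ^+ 2)); last by move=> w; rewrite gE.
  apply: le_trans (Ex_var_le Lb) _; apply: eq_ler.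
  apply: Ex_ext => w; have s2 := sm2 (a i w); rewrite /f' exprMn; congr (_ * _).
  by rewrite sqrrB s2; ring.
have [Lx Ex1] := aux xf mx (L2x i) (x0 i).
have [Ly Ey1] := aux yf my (L2y i) (y0 i).
split; first by apply: L1D; [exact: Lx.2|exact: Ly.2].
have LS (f : U -> R) : measurable_fun setT f -> L2 P (fun w => f (a i w)) ->
    L1 P (fun w => f (a i w) ^+ 2 * (1 - small (a i w))).
  move=> mf Lf; have [_ Lb] := L2sm mf Lf; apply: L1_ext Lb.2 => w.
  have s2 := sm2 (a i w); rewrite exprMn; congr (_ * _); by rewrite sqrrB s2; ring.
rewrite ExD; [|exact: Lx.2|exact: Ly.2].
apply: le_trans (lerD Ex1 Ey1) _; rewrite -ExD; [|exact: LS|exact: LS].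
rewrite (@Ex_ext _ _ _ P _ (fun w => sqnorm (a i w) * (1 - small (a i w)))) ?eta_le//.
by move=> w; rewrite /sqnorm mulrDl.
Qed.

Let off_diff i j (c1 c2 : R) : i != j -> Ex P (fun w =>
   ((c1 * (xf (a i w) * xf (a j w) + yf (a i w) * yf (a j w)) +
    c2 * (yf (a i w) * xf (a j w) - xf (a i w) * yf (a j w))) -
    (c1 * (bx i (a i w) * bx j (a j w) + by_ i (a i w) * by_ j (a j w)) +
    c2 * (by_ i (a i w) * bx j (a j w) - bx i (a i w) * by_ j (a j w)))) ^+ 2)
  <= 2^-1 * (zeta / 4 * (c1 ^+ 2 + c2 ^+ 2)).
Proof.
move=> ij.
have cauchy (u1 u2 v1 v2 : R) : (c1 * (u1 * v1 + u2 * v2) + c2 * (u2 * v1 - u1 * v2)) ^+ 2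
   <= (c1 ^+ 2 + c2 ^+ 2) * ((u1 ^+ 2 + u2 ^+ 2) * (v1 ^+ 2 + v2 ^+ 2)).
  rewrite -subr_ge0 (_ : _ - _ = (c2 * (u1 * v1 + u2 * v2) - c1 * (u2 * v1 - u1 * v2)) ^+ 2).
    exact: sqr_ge0.
  by ring.
have mres k : measurable_fun setT (fun u => resid u k).
  by apply: measurable_funD; apply: measurable_funX; apply: measurable_funB.
have mbn k : measurable_fun setT (fun u => bnorm u k).
  by apply: measurable_funD; exact: measurable_funX.
have [LR ER] := Ex_resid j; have [LR' ER'] := Ex_resid i.
have [LB EB] := Ex_bnorm j.
have [Lp Ep] := Ex_mul_indep ma ind ij (f := sqnorm) (g := fun u => resid u j) mN (mres j) (L1N i) LR.
have [Lq Eq] := Ex_mul_indep ma ind ij (f := fun u => resid u i) (g := fun u => bnorm u j) (mres i) (mbn j) LR' LB.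
apply: (@le_trans _ _ (Ex P (fun w => 2 * (c1 ^+ 2 + c2 ^+ 2) *
   (sqnorm (a i w) * resid (a j w) j + resid (a i w) i * bnorm (a j w) j)))).
  apply: Ex_le.
  - have prodL2 (f g : 'I_n -> U -> R) : centered_family P a f -> centered_family P a g ->
        L2 P (fun w => f i (a i w) * g j (a j w)).
      by move=> cf cg; have [? ? ?] := cf i; have [? ? ?] := cg j; exact: (L2_mul_indep ma ind ij).
    apply: (L2B _ _).2; apply: L2D; apply: L2Z; (apply: L2B || apply: L2D).
    + exact: (prodL2 (fun=> xf) (fun=> xf)).
    + exact: (prodL2 (fun=> yf) (fun=> yf)).
    + exact: (prodL2 (fun=> yf) (fun=> xf)).
    + exact: (prodL2 (fun=> xf) (fun=> yf)).
    + exact: (prodL2 bx bx).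
    + exact: (prodL2 by_ by_).
    + exact: (prodL2 by_ bx).
    + exact: (prodL2 bx by_).
  - by apply: L1Z; exact: L1D.
  - move=> w; rewrite /sqnorm /resid /bnorm.
    move: (xf (a i w)) (yf (a i w)) (xf (a j w)) (yf (a j w))
      (bx i (a i w)) (by_ i (a i w)) (bx j (a j w)) (by_ j (a j w)) => u1 u2 v1 v2 b1 b2 e1 e2.
    have H1 := cauchy u1 u2 (v1 - e1) (v2 - e2).
    have H2 := cauchy (u1 - b1) (u2 - b2) e1 e2.
    set M1 := c1 * _ + c2 * _ in H1; set M2 := c1 * _ + c2 * _ in H2.
    rewrite (_ : _ - _ = M1 + M2); last by rewrite /M1 /M2; ring.
    apply: le_trans (sqrD_le2 _ _) _; rewrite -mulrA ler_pM2l// mulrDr; exact: lerD.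
rewrite ExZ; last exact: L1D.
rewrite ExD// Ep Eq n1 mul1r.
have c0 : 0 <= c1 ^+ 2 + c2 ^+ 2 by rewrite addr_ge0 ?sqr_ge0.
have EB0 : 0 <= Ex P (fun w => bnorm (a j w) j) by apply: Ex_ge0 => w; rewrite addr_ge0 ?sqr_ge0.
have ER0 : 0 <= Ex P (fun w => resid (a i w) i) by apply: Ex_ge0 => w; rewrite addr_ge0 ?sqr_ge0.
exact: (off_diag_arith c0 ER (le_trans (ler_piMr ER0 EB) ER')).
Qed.

Let comp_cmp (p : 'I_n * 'I_n) : (p.1 <= p.2)%N ->
  tri p <= Ex P (fun w => compX p w ^+ 2) /\ Ex P (fun w => (compX p w - compY p w) ^+ 2) <= 2^-1 * Ex P (fun w => compX p w ^+ 2).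
Proof.
case: p => i j /= ij; rewrite /tri /compX /compY /form_part /=.
case: (eqVneq i j) => [_|ne]; first by split; [exact: diag_lb|exact: diag_diff].
have lb := off_lb (cr (i, j)) (ci (i, j)) ne.
split=> //; apply: le_trans (off_diff _ _ ne) _.
by rewrite ler_pM2l.
Qed.

Hypothesis s_norm : 2^-1 <= \sum_i (sr i ^+ 2 + si i ^+ 2) <= 2.
Hypothesis t_norm : 2^-1 <= \sum_i (tr i ^+ 2 + ti i ^+ 2) <= 2.
Hypothesis im_small : `|\sum_i im i| <= 4^-1.

(* Expanding the squares, the sum over all [i, j] of [|cr + i ci|^2] is
   [2 |s|^2 |t|^2 + 2 (Re <s,t>)^2 - 2 (Im <s,t>)^2]. This is where the imaginary part
   of the inner product has to be small: for [t = i s] the form [X] vanishes. *)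
Let tri_lb : zeta / 32 <= \sum_(p : 'I_n * 'I_n | (p.1 <= p.2)%N) tri p.
Proof.
apply: (@le_trans _ _ (\sum_i \sum_j zeta / 8 * (cr (i, j) ^+ 2 + ci (i, j) ^+ 2))).
  have -> : \sum_i \sum_j zeta / 8 * (cr (i, j) ^+ 2 + ci (i, j) ^+ 2) =
    zeta / 8 * (2 * ((\sum_i (sr i ^+ 2 + si i ^+ 2)) * (\sum_i (tr i ^+ 2 + ti i ^+ 2)))
      + 2 * ((\sum_i h i) ^+ 2 - (\sum_i im i) ^+ 2)).
    have -> : 2 * ((\sum_i (sr i ^+ 2 + si i ^+ 2)) * (\sum_i (tr i ^+ 2 + ti i ^+ 2))) =
        (\sum_i (sr i ^+ 2 + si i ^+ 2)) * (\sum_i (tr i ^+ 2 + ti i ^+ 2)) +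
        (\sum_i (tr i ^+ 2 + ti i ^+ 2)) * (\sum_i (sr i ^+ 2 + si i ^+ 2)) by ring.
    rewrite !expr2 !big_distrlr /= -sumrB -!big_split /= mulr_sumr -big_split /= mulr_sumr.
    apply: eq_bigr => i _; rewrite -!big_split -sumrB /= mulr_sumr -big_split /= mulr_sumr.
    by apply: eq_bigr => j _; rewrite /cr /ci /h /im /=; ring.
  move: s_norm t_norm im_small.
  set ns := \sum_i _; set nt := \sum_i _; set hh := \sum_i h i; set ii := \sum_i im i.
  move=> /andP[s1 s2] /andP[t1 t2] i1.
  have i2 : ii ^+ 2 <= 16^-1.
    rewrite -[_ ^+ 2]real_normK ?num_real//.
    by have := ler_pM (normr_ge0 _) (normr_ge0 _) i1 i1; rewrite expr2; lra.
  have nn : 4^-1 <= ns * nt.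
    have h0 : 0 <= 2^-1 :> R by rewrite invr_ge0.
    by have := ler_pM h0 h0 s1 t1; lra.
  have hh0 := sqr_ge0 hh; have : zeta * 4^-1 <= zeta * (2 * (ns * nt) + 2 * (hh ^+ 2 - ii ^+ 2)).
    by rewrite ler_pM2l//; lra.
  by lra.
rewrite sum_ordered_pairs; apply: ler_sum => -[i j] _ /=; rewrite /tri /=.
have z0 := zeta0; have [->|ne] := eqVneq i j.
  rewrite (_ : cr (j, j) = 2 * h j); last by rewrite /cr /h /=; ring.
  rewrite (_ : ci (j, j) = 0); last by rewrite /ci /=; ring.
  by have := sqr_ge0 (h j); nra.
rewrite (_ : cr (j, i) = cr (i, j)); last by rewrite /cr /=; ring.
rewrite (_ : ci (j, i) = - ci (i, j)); last by rewrite /ci /=; ring.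
by rewrite sqrrN; lra.
Qed.

Let X_L2 : L2 P X /\ zeta / 32 <= Ex P (fun w => X w ^+ 2).
Proof.
have [L E] := Ex_chaos_sqr (\sum_i h i) chX.
split; first by apply: L2_ext L => w; rewrite XE.
rewrite (Ex_ext _ (fun w => congr1 (fun x => x ^+ 2) (XE w))) E.
apply: (le_trans tri_lb); rewrite -[leLHS]add0r; apply: lerD; first exact: sqr_ge0.
by apply: ler_sum => p pp; case: (comp_cmp pp).
Qed.

Let Y_L2 : L2 P Y.
Proof. by have [L E] := Ex_chaos_sqr (\sum_i h i) chY. Qed.

Let XY_close : Ex P (fun w => (X w - Y w) ^+ 2) <= 2^-1 * Ex P (fun w => X w ^+ 2).
Proof.
have [_ E] := Ex_chaos_sqr (\sum_i h i) chX.
have [_ E'] := Ex_chaos_sqr 0 (chaosB chX chY).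
rewrite (Ex_ext _ (fun w => congr1 (fun x => x ^+ 2) (XE w))) E.
rewrite (@Ex_ext _ _ _ P (fun w => (X w - Y w) ^+ 2) (fun w => (0 +
   \sum_(p : 'I_n * 'I_n | (p.1 <= p.2)%N) (compX p w - compY p w)) ^+ 2)); last first.
  by move=> w; rewrite XE /Y sumrB add0r; congr (_ ^+ 2); ring.
rewrite E' expr0n add0r mulrDr mulr_sumr -[leLHS]add0r; apply: lerD.
  by rewrite mulr_ge0// sqr_ge0.
by apply: ler_sum => p pp; case: (comp_cmp pp).
Qed.

Let MTp : 0 <= MT. Proof. by apply: le_trans MT1. Qed.

(* [Y] differs by a bounded quantity from the Hermitian product of the truncated
   linear forms, which is at most the sum of their four squares. *)
Let Y_pow : L1 P (fun w => Y w ^+ M) /\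
  Ex P (fun w => Y w ^+ M) <= form_moment_const R K * MT.
Proof.
pose q1 w := lin_re bx by_ sr si w ^+ 2.
pose q2 w := lin_re bx by_ tr ti w ^+ 2.
pose q3 w := lin_im bx by_ sr si w ^+ 2.
pose q4 w := lin_im bx by_ tr ti w ^+ 2.
have q10 w : 0 <= q1 w by exact: sqr_ge0.
have q20 w : 0 <= q2 w by exact: sqr_ge0.
have q30 w : 0 <= q3 w by exact: sqr_ge0.
have q40 w : 0 <= q4 w by exact: sqr_ge0.
have imE (cr' ci' : 'I_n -> R) w : lin_im bx by_ cr' ci' w =
    \sum_i (bx i (a i w) * ci' i + by_ i (a i w) * - cr' i).
  by apply: eq_bigr => i _; rewrite mulrN.
have sw (cr' ci' : 'I_n -> R) : \sum_i (cr' i ^+ 2 + ci' i ^+ 2) <= 2 ->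
    \sum_i (ci' i ^+ 2 + (- cr' i) ^+ 2) <= 2.
  by move=> H; rewrite (eq_bigr (fun i => cr' i ^+ 2 + ci' i ^+ 2))// => i _; rewrite sqrrN addrC.
have [_ s2] := andP s_norm; have [_ t2] := andP t_norm.
have pw (x : R) : (x ^+ 2) ^+ M = x ^+ M.*2 by rewrite -exprM mul2n.
have sqr_pow (cr' ci' : 'I_n -> R) F : \sum_i (cr' i ^+ 2 + ci' i ^+ 2) <= 2 ->
    (forall w, F w = \sum_i (bx i (a i w) * cr' i + by_ i (a i w) * ci' i)) ->
    L1 P (fun w => (F w ^+ 2) ^+ M) /\
    Ex P (fun w => (F w ^+ 2) ^+ M) <= linear_moment_const R K * MT.
  move=> H FE; have [L E] := lin_re_moment H; split.
    by apply: L1_ext L => w; rewrite pw FE.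
  by apply: le_trans E; apply: eq_ler; apply: Ex_ext => w; rewrite pw FE.
have [L1' E1] := sqr_pow _ _ _ s2 (fun _ => erefl : lin_re bx by_ sr si _ = _).
have [L2' E2] := sqr_pow _ _ _ t2 (fun _ => erefl : lin_re bx by_ tr ti _ = _).
have [L3' E3] := sqr_pow _ _ _ (sw _ _ s2) (imE _ _).
have [L4' E4] := sqr_pow _ _ _ (sw _ _ t2) (imE _ _).
have h2 : \sum_i `|h i| <= 2.
  apply: (@le_trans _ _ (\sum_i ((sr i ^+ 2 + si i ^+ 2) + (tr i ^+ 2 + ti i ^+ 2)) / 2)).
    apply: ler_sum => i _; rewrite /h ler_norml.
    have := sqr_ge0 (sr i - tr i); have := sqr_ge0 (si i - ti i).
    by have := sqr_ge0 (sr i + tr i); have := sqr_ge0 (si i + ti i); lra.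
  by rewrite -mulr_suml big_split /=; lra.
have t0 : 0 < tau by move: tau4; lra.
have mN1 i : 0 <= Ex P (fun w => sqnorm (a i w) * small (a i w)) <= 1.
  have [Ls Lb] := L2sm mN (L2N i); apply/andP; split.
    by apply: Ex_ge0 => w; rewrite mulr_ge0//; case/andP: (sm01 (a i w)).
  rewrite -(n1 i); apply: Ex_le; [exact: L2_L1|exact: L1N|] => w.
  by rewrite ler_piMr//; case/andP: (sm01 (a i w)).
have diag6 i w : `|dd i (a i w) - bnorm (a i w) i + 1| <= 6.
  have cross (u mu : R) : `|u| <= tau -> `|mu| <= tau^-1 -> `|mu * u| <= 1.
    move=> H1 H2; rewrite normrM; apply: le_trans (ler_pM _ _ H2 H1) _ => //.
    by rewrite mulVf ?gt_eqF.
  have sq (mu : R) : `|mu| <= tau^-1 -> 0 <= mu ^+ 2 <= 1.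
    move=> H; rewrite sqr_ge0 /= -[leLHS]real_normK ?num_real//.
    by rewrite exprn_ile1// (le_trans H)//; move: tauV; lra.
  have := cross _ _ (x_small (a i w)) (mux_le i).
  have := cross _ _ (y_small (a i w)) (muy_le i).
  have := sq _ (mux_le i); have := sq _ (muy_le i); have := mN1 i.
  rewrite /dd /bnorm /bx /by_; set E := Ex P (fun w => sqnorm _ * _).
  have -> : sqnorm (a i w) * small (a i w) =
     (xf (a i w) * small (a i w)) ^+ 2 + (yf (a i w) * small (a i w)) ^+ 2.
    by rewrite !exprMn !sm2 /sqnorm mulrDl.
  set u1 := xf _ * _; set u2 := yf _ * _ => /andP[? ?] /andP[? ?] /andP[? ?].
  by rewrite !ler_norml => /andP[? ?] /andP[? ?]; apply/andP; split; lra.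
have YE w : Y w = herm bx by_ w + \sum_i h i * (dd i (a i w) - bnorm (a i w) i + 1).
  rewrite /Y /compY -herm_expand addrCA; congr (_ + _).
  by rewrite -big_split; apply: eq_bigr => i _; rewrite /bnorm /=; ring.
have Yle w : `|Y w| <= (q1 w + q2 w) + (q3 w + q4 w) + 12.
  rewrite YE; apply: (le_trans (ler_normD _ _)); apply: lerD.
    rewrite /herm /q1 /q2 /q3 /q4.
    move: (lin_re _ _ _ _ _) (lin_re _ _ _ _ _) (lin_im _ _ _ _ _) (lin_im _ _ _ _ _) => u1 u2 u3 u4.
    rewrite ler_norml; have := sqr_ge0 (u1 + u2); have := sqr_ge0 (u1 - u2).
    have := sqr_ge0 (u3 + u4); have := sqr_ge0 (u3 - u4).
    by have := sqr_ge0 u1; have := sqr_ge0 u2; have := sqr_ge0 u3; have := sqr_ge0 u4; lra.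
  apply: (le_trans (ler_norm_sum _ _ _)).
  apply: (@le_trans _ _ (\sum_i `|h i| * 6)).
    by apply: ler_sum => i _; rewrite normrM ler_wpM2l.
  by rewrite -mulr_suml; lra.
have mY : measurable_fun setT Y by exact: L2_measurable Y_L2.
pose G w := 8 ^+ M * ((q1 w ^+ M + q2 w ^+ M) + (q3 w ^+ M + q4 w ^+ M) + 12 ^+ M).
have LG : L1 P G by apply: L1Z; apply: L1D; [apply: L1D; exact: L1D|exact: L1_cst].
have YG w : `|Y w ^+ M| <= G w.
  rewrite normrX; apply: (@le_trans _ _ (((q1 w + q2 w) + (q3 w + q4 w) + 12) ^+ M)).
    by rewrite lerXn2r ?nnegrE ?addr_ge0.
  apply: le_trans (exprD_le2 M _ _) _; rewrite ?addr_ge0//.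
  have E8 : 8 ^+ M = 2 ^+ M * 4 ^+ M :> R by rewrite -exprMn; congr (_ ^+ _); lra.
  have E4' : 4 ^+ M = 2 ^+ M * 2 ^+ M :> R by rewrite -exprMn; congr (_ ^+ _); lra.
  rewrite /G E8 -[leRHS]mulrA ler_wpM2l ?exprn_ge0// mulrDr lerD//; last first.
    by rewrite ler_peMl ?exprn_ge0// exprn_ege1//; lra.
  apply: le_trans (exprD_le2 M _ _) _; rewrite ?addr_ge0//.
  rewrite E4' -[leRHS]mulrA ler_wpM2l ?exprn_ge0// mulrDr.
  by apply: lerD; apply: exprD_le2.
have LYM : L1 P (fun w => Y w ^+ M).
  by apply: L1_le YG LG; exact: measurable_funX.
split=> //; apply: (@le_trans _ _ (Ex P G)).
  by apply: Ex_le => // w; exact: le_trans (ler_norm _) (YG w).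
have L12 := L1D L1' L2'; have L34 := L1D L3' L4'.
rewrite ExZ; last by apply: L1D; [exact: L1D|exact: L1_cst].
rewrite ExD; [|exact: L1D|exact: L1_cst].
rewrite ExD// ExD// ExD// Ex_cst /form_moment_const -mulrA ler_wpM2l ?exprn_ge0//.
have : 12 ^+ M <= 12 ^+ M * MT by rewrite ler_peMr ?exprn_ge0.
by rewrite -/M mulrDl; lra.
Qed.

(** A Paley-Zygmund argument for [X], although [X] has too few moments for one.
    The event [B] carries at least 7/8 of the second moment of [X]. Replacing [X]
    by the truncated form [Y] costs 3/4 of that moment, as the errors are
    orthogonal and each is dominated by its own component. Finally
    [Y^2 1_B] has mean at most [lam^2 P(B)] plus the tail of [Y] beyond [lam],
    which the moment of order [2K + 2] controls. *)
Lemma small_ball_truncated :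
  small_ball_const R K * zeta / tau ^+ 4 <=
  fine (P [set w | zeta / 256 <= herm (fun=> xf) (fun=> yf) w ^+ 2]).
Proof.
rewrite -/X; set B := [set w | _]; set p := fine (P B).
have [LX EX] := X_L2; have [LY EY] := Y_pow; have LY2 := Y_L2.
have mX : measurable_fun setT X by exact: L2_measurable LX.
have mB : measurable B.
  exact: measurable_le_set (measurable_cst (zeta / 256)) (measurable_funX 2 mX).
have z0 := zeta0; have f1 := form_moment_const_ge1 R K.
have t0 : 0 < tau by move: tau4; lra.
pose F := form_moment_const R K.
pose L : R := 1536 * F; pose lam := L * tau ^+ 2.
have L1' : 1 <= L by rewrite /L /F; lra.
have lam0 : 0 < lam by rewrite mulr_gt0 ?exprn_gt0//; lra.
have LB f : L2 P f -> L1 P (fun w => f w ^+ 2 * \1_B w).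
  move=> Lf; have mf := L2_measurable Lf; apply: L1_le Lf.2.
    by apply: measurable_funM; [exact: measurable_funX|exact: measurable_indic].
  move=> w; rewrite indicE; case: (w \in B); rewrite ?mulr1 ?mulr0 ?normr0 ?sqr_ge0//.
  by rewrite ger0_norm ?sqr_ge0.
have low : Ex P (fun w => X w ^+ 2) - zeta / 256 <= Ex P (fun w => X w ^+ 2 * \1_B w).
  rewrite lerBlDr -[X in _ + X](Ex_cst P (zeta / 256)) -ExD; [|exact: LB|exact: L1_cst].
  apply: Ex_le; [exact: LX.2|by apply: L1D; [exact: LB|exact: L1_cst]|] => w.
  rewrite indicE; case: (boolP (w \in B)) => [_|/negP nB]; first by rewrite mulr1 lerDl; lra.
  rewrite mulr0 add0r leNgt; apply/negP => H; apply: nB; apply/mem_set; exact: ltW.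
have split3 : Ex P (fun w => X w ^+ 2 * \1_B w) <=
    3 / 2 * Ex P (fun w => (X w - Y w) ^+ 2) + 3 * Ex P (fun w => Y w ^+ 2 * \1_B w).
  have LD : L2 P (fun w => X w - Y w) by exact: L2B.
  rewrite -(ExZ (3 / 2) LD.2) -(ExZ 3 (LB _ LY2)) -ExD; [|exact/L1Z/LD.2|exact/L1Z/LB].
  apply: Ex_le; [exact: LB|by apply: L1D; [exact/L1Z/LD.2|exact/L1Z/LB]|] => w.
  rewrite indicE; case: (w \in B); rewrite ?mulr1 ?mulr0.
    by have := sqr_ge0 (X w - Y w - 2 * Y w); lra.
  by rewrite addr0 mulr_ge0 ?sqr_ge0//; lra.
have up : Ex P (fun w => Y w ^+ 2 * \1_B w) <=
    lam ^+ 2 * p + (lam ^+ (2 * K))^-1 * Ex P (fun w => Y w ^+ M).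
  have LI := L1_indic P mB.
  rewrite /p -Ex_indic// -(ExZ (lam ^+ 2) LI) -(ExZ _ LY) -ExD; [|exact: L1Z|exact: L1Z].
  apply: Ex_le; [exact: LB|by apply: L1D; exact: L1Z|] => w.
  have M0 : 0 <= (lam ^+ (2 * K))^-1 * Y w ^+ M.
    apply: mulr_ge0; first by rewrite invr_ge0 exprn_ge0// ltW.
    by rewrite /M -mul2n exprM exprn_ge0// sqr_ge0.
  rewrite indicE; case: (w \in B); rewrite ?mulr1 ?mulr0 ?add0r//.
  have [le|/ltW ge] := lerP (Y w ^+ 2) (lam ^+ 2); first by rewrite (le_trans le)// lerDl.
  rewrite (le_trans _ (_ : (lam ^+ (2 * K))^-1 * Y w ^+ M <= _))//; last by rewrite lerDr sqr_ge0.
  rewrite mulrC ler_pdivlMr ?exprn_gt0// /M -mul2n !exprM [leRHS]exprS ler_wpM2l ?sqr_ge0//.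
  by rewrite lerXn2r ?nnegrE ?sqr_ge0.
have tail : (lam ^+ (2 * K))^-1 * Ex P (fun w => Y w ^+ M) <= zeta / 1536.
  rewrite mulrC ler_pdivrMr ?exprn_gt0//; apply: (le_trans EY); rewrite -/F.
  have tp : 0 < tau ^+ (4 * K) by exact: exprn_gt0.
  have -> : lam ^+ (2 * K) = L ^+ (2 * K) * tau ^+ (4 * K).
    by rewrite exprMn -exprM mulnA.
  have LL : 1536 * F <= L ^+ (2 * K) by apply: ler_eXnr => //; rewrite muln_gt0.
  have := ler_wpM2r MTp LL; rewrite /MT => H.
  exact: scale_tail H.
have main : zeta / 1536 <= lam ^+ 2 * p.
  exact: (event_mass_arith EX low split3 XY_close up tail).
have t4 : 0 < tau ^+ 4 by exact: exprn_gt0.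
have Lp : 0 < L := lt_le_trans ltr01 L1'.
exact: (small_ball_arith t4 Lp main).
Qed.

End Bilinear.
End SmallBall.

(** * Greedy rounding and a net without logarithms *)

Section Rounding.
Variable R : realType.

(** Round the coordinates one after the other, each time choosing between the two
    nearest integers the one whose error has a nonpositive product with the
    accumulated error: the squares then add up, as if the errors were orthogonal. *)
Lemma greedy_rounding (I F : finType) (u : I -> R) (V : I -> F -> R) :
  exists z : I -> int, (forall j, `|u j - (z j)%:~R| <= 1) /\
    \sum_k (\sum_j (u j - (z j)%:~R) * V j k) ^+ 2 <= \sum_j \sum_k V j k ^+ 2.
Proof.
suff [z [z1 H]] : exists z : I -> int, (forall j, `|u j - (z j)%:~R| <= 1) /\
    \sum_k (\sum_(j <- index_enum I) (u j - (z j)%:~R) * V j k) ^+ 2 <=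
    \sum_(j <- index_enum I) \sum_k V j k ^+ 2 by exists z.
have := index_enum_uniq I; elim: (index_enum I) => [_|i r IH /= /andP[ir ur]].
  exists (fun j => Num.floor (u j)); split => [j|].
    have /andP[] := floor_itv (u j); rewrite intrD mulr1z => l1 l2.
    by rewrite ger0_norm ?subr_ge0//; lra.
  by rewrite big_nil big1// => k _; rewrite big_nil expr0n.
have [z [z1 Hz]] := IH ur.
pose w k := \sum_(j <- r) (u j - (z j)%:~R) * V j k.
pose c := \sum_k w k * V i k.
have [zi zi1 zic] : exists2 zi : int, `|u i - zi%:~R| <= 1 & (u i - zi%:~R) * c <= 0.
  have /andP[] := floor_itv (u i); rewrite intrD mulr1z => l1 l2.
  have [c0|/ltW c0] := lerP c 0.
    exists (Num.floor (u i)); first by rewrite ger0_norm ?subr_ge0//; lra.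
    by rewrite mulr_ge0_le0// subr_ge0.
  exists (Num.floor (u i) + 1); rewrite intrD mulr1z.
    by rewrite ler0_norm; lra.
  by rewrite mulr_le0_ge0//; lra.
exists (fun j => if j == i then zi else z j); split.
  by move=> j; case: ifP => // /eqP ->.
rewrite [leRHS]big_cons.
have wE k : \sum_(j <- i :: r) (u j - (if j == i then zi else z j)%:~R) * V j k =
   (u i - zi%:~R) * V i k + w k.
  rewrite big_cons eqxx; congr (_ + _); rewrite /w !big_seq; apply: eq_bigr => j jr.
  by rewrite ifN//; apply: contraNneq ir => <-.
rewrite (eq_bigr (fun k => (u i - zi%:~R) ^+ 2 * V i k ^+ 2 +
   2 * (u i - zi%:~R) * (w k * V i k) + w k ^+ 2)); last first.
  by move=> k _; rewrite wE; ring.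
rewrite !big_split /= -!mulr_sumr -/c.
apply: lerD; last exact: Hz.
rewrite -[leRHS]addr0; apply: lerD; last by rewrite -mulrA mulr_ge0_le0.
rewrite ler_piMl ?sumr_ge0//; first by move=> k _; exact: sqr_ge0.
by rewrite -[_ ^+ 2]real_normK ?num_real// exprn_ile1.
Qed.

(** Keep a single term of the binomial expansion of [(1 + r^-1) ^ (N + L)]. *)
Lemma binomial_le_expR (N L : nat) (r : R) : 0 < r -> 1 <= r ->
  L%:R <= r * N%:R -> 'C(N + L, N)%:R <= (expR 2 * r) ^+ N.
Proof.
move=> r0 r1 Lr; rewrite exprMn -expRM_natr -ler_pdivrMr ?exprn_gt0// -exprVn.
have x0 : 0 <= r^-1 by rewrite invr_ge0 ltW.
apply: (@le_trans _ _ ((1 + r^-1) ^+ (N + L))).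
  rewrite exprDn; have NL : (N < (N + L).+1)%N by rewrite ltnS leq_addr.
  rewrite (bigD1 (Ordinal NL))//= expr1n mul1r -[X in X + _]mulr_natl lerDl.
  by rewrite sumr_ge0// => i _; rewrite mulrn_wge0// expr1n mul1r exprn_ge0.
apply: (@le_trans _ _ (expR r^-1 ^+ (N + L))).
  by rewrite lerXn2r ?nnegrE ?expR_ge0 ?addr_ge0// expR_ge1Dx.
rewrite -expRM_natr ler_expR natrD mulrDr.
have H1 : r^-1 * N%:R <= N%:R by rewrite ler_piMl// invf_le1.
have H2 : r^-1 * L%:R <= N%:R by rewrite mulrC ler_pdivrMr// mulrC.
lra.
Qed.

(** Tuples of naturals with bounded sum; positive and negative parts of an integer
    vector of small Euclidean norm are such tuples, since [|z| <= z^2]. Counting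
    them by a binomial coefficient gives a net of cardinality [C ^ N], without a
    factor [log N] in the exponent. *)
Definition light_tuple (N L : nat) := {t : N.-tuple 'I_L.+1 | (\sum_(i <- t) i <= L)%N}.

Lemma card_light_tuple N L : #|{: light_tuple N L}| = 'C(N + L, N).
Proof. by rewrite card_sig -card_partial_ord_partitions cardsE. Qed.

Section Net.
Variables (I : finType) (L : nat).

Definition net_code := (light_tuple #|I| L * light_tuple #|I| L)%type.

Definition net_coord (c : net_code) (j : I) : int :=
  (tnth (val c.1) (enum_rank j))%:Z - (tnth (val c.2) (enum_rank j))%:Z.

Lemma net_coord_onto (z : I -> int) : \sum_j z j ^+ 2 <= L%:Z ->
  exists c : net_code, net_coord c =1 z.
Proof.
move=> zL.
have posneg (w : I -> nat) : (forall j, (w j)%:Z <= z j ^+ 2) ->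
    exists t : light_tuple #|I| L, forall j, tnth (val t) (enum_rank j) = w j :> nat.
  move=> wz.
  have wL j : (w j < L.+1)%N.
    rewrite ltnS -lez_nat; apply: le_trans zL; rewrite (bigD1 j)//=.
    by apply: (le_trans (wz j)); rewrite lerDl sumr_ge0// => i _; exact: sqr_ge0.
  pose t := [tuple Ordinal (wL (enum_val k)) | k < #|I|].
  have tL : (\sum_(i <- t) i <= L)%N.
    rewrite big_tuple -lez_nat; apply: le_trans zL.
    rewrite (eq_bigr (fun k => w (enum_val k))); last by move=> k _; rewrite tnth_mktuple.
    rewrite (reindex enum_rank) /=; last first.
      by exists enum_val => j _; [exact: enum_rankK|exact: enum_valK].
    rewrite -natz natr_sum; apply: ler_sum => j _.
    by rewrite enum_rankK natz.
  exists (exist _ t tL) => j /=; by rewrite tnth_mktuple enum_rankK.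
have [|t1 t1E] := posneg (fun j => if 0 <= z j then `|z j|%N else 0%N).
  by move=> j; case: ifP => [z0|_]; rewrite ?sqr_ge0//; nia.
have [|t2 t2E] := posneg (fun j => if 0 <= z j then 0%N else `|z j|%N).
  by move=> j; case: ifP => [_|z0]; rewrite ?sqr_ge0//; nia.
exists (t1, t2) => j; rewrite /net_coord /= t1E t2E; case: ifP; lia.
Qed.

Lemma card_net_code (r : R) : 0 < r -> 1 <= r -> L%:R <= r * #|I|%:R ->
  #|{: net_code}|%:R <= (expR 2 * r) ^+ (2 * #|I|).
Proof.
move=> r0 r1 Lr; rewrite card_prod card_light_tuple natrM mul2n -addnn exprD.
by apply: ler_pM => //; exact: binomial_le_expR.
Qed.

End Net.
End Rounding.

(** * Tails from second moments *)

Section Tails.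
Context {d d' : measure_display} {T : measurableType d} {U : measurableType d'}.
Context {R : realType}.
Variables (P : probability T R) (n : nat) (a : 'I_n -> T -> U).
Hypothesis ma : forall i, measurable_fun setT (a i).
Hypothesis ind : mutually_independent P a.
Variables (xf yf : U -> R).
Hypothesis mx : measurable_fun setT xf.
Hypothesis my : measurable_fun setT yf.
Hypothesis L1N : forall i, L1 P (fun w => sqnorm xf yf (a i w)).
Hypothesis x0 : forall i, Ex P (xf \o a i) = 0.
Hypothesis y0 : forall i, Ex P (yf \o a i) = 0.
Hypothesis n1 : forall i, Ex P (sqnorm xf yf \o a i) = 1.

Lemma markov_ineq (f : T -> R) (c : R) : L1 P f -> (forall w, 0 <= f w) -> 0 < c ->
  measurable [set w | c < f w] /\ fine (P [set w | c < f w]) <= Ex P f / c.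
Proof.
move=> Lf f0 c0; set A := [set w | _].
have mA : measurable A by exact: measurable_lt_set (measurable_cst c) (L1_measurable Lf).
split=> //; rewrite ler_pdivlMr// mulrC -Ex_indic// -ExZ; last exact: L1_indic.
apply: Ex_le => //; first by apply: L1Z; exact: L1_indic.
move=> w; rewrite indicE; case: (boolP (w \in A)) => [/set_mem /ltW|_]; rewrite ?mulr1// mulr0.
exact: f0.
Qed.

Let L2x i : L2 P (fun w => xf (a i w)).
Proof.
have m : measurable_fun setT (fun w => xf (a i w)) by exact: measurableT_comp.
split=> //; apply: L1_le (L1N i); first exact: measurable_funX.
by move=> w; rewrite ger0_norm ?sqr_ge0// lerDl sqr_ge0.
Qed.

Let L2y i : L2 P (fun w => yf (a i w)).
Proof.
have m : measurable_fun setT (fun w => yf (a i w)) by exact: measurableT_comp.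
split=> //; apply: L1_le (L1N i); first exact: measurable_funX.
by move=> w; rewrite ger0_norm ?sqr_ge0// lerDr sqr_ge0.
Qed.

(** The diagonal case of chaos orthogonality. *)
Lemma Ex_sum_sqr_indep (z : 'I_n -> U -> R) : centered_family P a z ->
  L1 P (fun w => (\sum_i z i (a i w)) ^+ 2) /\
  Ex P (fun w => (\sum_i z i (a i w)) ^+ 2) = \sum_i Ex P (fun w => z i (a i w) ^+ 2).
Proof.
move=> cz.
have ch := chaos_form_part ma ind (fun=> 1) (fun=> 0) (fun=> 0) cz cz cz.
have fpE w : \sum_(p : 'I_n * 'I_n | (p.1 <= p.2)%N)
    form_part a (fun=> 1) (fun=> 0) (fun=> 0) z z z p w = \sum_i z i (a i w).
  rewrite -sum_diag; apply: eq_bigr => p _.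
  by rewrite /form_part; case: ifP => _; rewrite ?mul1r// !mul0r addr0.
have [L E] := Ex_chaos_sqr 0 ch; split.
  by apply: L1_ext L.2 => w; rewrite fpE add0r.
transitivity (Ex P (fun w => (0 + \sum_(p : 'I_n * 'I_n | (p.1 <= p.2)%N)
    form_part a (fun=> 1) (fun=> 0) (fun=> 0) z z z p w) ^+ 2)).
  by apply: Ex_ext => w; rewrite fpE add0r.
rewrite E expr0n add0r -sum_diag; apply: eq_bigr => p _.
rewrite /form_part; case: ifP => _; first by apply: Ex_ext => w; rewrite mul1r.
by rewrite (@Ex_ext _ _ _ P _ (fun=> 0)) ?Ex_cst// => w; rewrite !mul0r addr0 expr0n.
Qed.

(** Real and imaginary parts together have second moment [|c|^2], whatever the
    pseudo-variance of the entries: the cross terms cancel between the two. *)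
Lemma linear_form_tail (cr ci : 'I_n -> R) (c : R) : 0 < c ->
  fine (P [set w | c < lin_re a (fun=> xf) (fun=> yf) cr ci w ^+ 2 +
     lin_im a (fun=> xf) (fun=> yf) cr ci w ^+ 2]) <= (\sum_i (cr i ^+ 2 + ci i ^+ 2)) / c.
Proof.
move=> c0.
have cf (k1 k2 : 'I_n -> R) : centered_family P a (fun i u => k1 i * xf u + k2 i * yf u).
  move=> i; split.
  - by apply: measurable_funD; exact: measurable_funM.
  - by apply: L2D; exact: L2Z.
  - rewrite [LHS](@ExD _ _ _ P (fun w => k1 i * xf (a i w)) (fun w => k2 i * yf (a i w))).
    + rewrite !ExZ ?[Ex P (fun w => xf _)]x0 ?[Ex P (fun w => yf _)]y0 ?mulr0 ?addr0//; exact: L2_L1.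
    + by apply: L1Z; exact: L2_L1.
    + by apply: L1Z; exact: L2_L1.
have [L E] := Ex_sum_sqr_indep (cf cr ci).
have [L' E'] := Ex_sum_sqr_indep (cf ci (fun i => - cr i)).
have reE w : lin_re a (fun=> xf) (fun=> yf) cr ci w = \sum_i (cr i * xf (a i w) + ci i * yf (a i w)).
  by apply: eq_bigr => i _; rewrite mulrC (mulrC (yf _)).
have imE w : lin_im a (fun=> xf) (fun=> yf) cr ci w = \sum_i (ci i * xf (a i w) + - cr i * yf (a i w)).
  by apply: eq_bigr => i _; rewrite mulrC (mulrC (yf _)) mulNr.
have LS : L1 P (fun w => lin_re a (fun=> xf) (fun=> yf) cr ci w ^+ 2 +
     lin_im a (fun=> xf) (fun=> yf) cr ci w ^+ 2).
  by apply: L1D; [apply: L1_ext L => w; rewrite reE|apply: L1_ext L' => w; rewrite imE].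
have [_ H] := markov_ineq LS (fun w => addr_ge0 (sqr_ge0 _) (sqr_ge0 _)) c0.
apply: (le_trans H); rewrite ler_pM2r ?invr_gt0//.
rewrite ExD; [|by apply: L1_ext L => w; rewrite reE|by apply: L1_ext L' => w; rewrite imE].
rewrite (@Ex_ext _ _ _ P _ (fun w => (\sum_i (cr i * xf (a i w) + ci i * yf (a i w))) ^+ 2)); last first.
  by move=> w; rewrite reE.
rewrite (@Ex_ext _ _ _ P (fun w => lin_im _ _ _ _ _ w ^+ 2)
   (fun w => (\sum_i (ci i * xf (a i w) + - cr i * yf (a i w))) ^+ 2)); last first.
  by move=> w; rewrite imE.
rewrite E E' -big_split /=; apply: ler_sum => i _.
have Lxy (k1 k2 : R) : L1 P (fun w => (k1 * xf (a i w) + k2 * yf (a i w)) ^+ 2).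
  by apply: (L2D (L2Z k1 (L2x i)) (L2Z k2 (L2y i))).2.
rewrite -ExD; [|exact: Lxy|exact: Lxy].
rewrite (@Ex_ext _ _ _ P _ (fun w => (cr i ^+ 2 + ci i ^+ 2) * sqnorm xf yf (a i w))).
  by rewrite ExZ// [Ex P (fun w => sqnorm _ _ _)]n1 mulr1.
by move=> w; rewrite /sqnorm; ring.
Qed.

Lemma norm_tail (c : R) : 0 < c -> (0 < n)%N ->
  fine (P [set w | c * n%:R < \sum_i sqnorm xf yf (a i w)]) <= c^-1.
Proof.
move=> c0 n0; have nR : 0 < n%:R :> R by rewrite ltr0n.
have LS : L1 P (fun w => \sum_i sqnorm xf yf (a i w)) by apply: L1_sum => i _; exact: L1N.
have S0 w : 0 <= \sum_i sqnorm xf yf (a i w).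
  by apply: sumr_ge0 => i _; rewrite addr_ge0 ?sqr_ge0.
have [_ H] := markov_ineq LS S0 (mulr_gt0 c0 nR); apply: (le_trans H).
rewrite Ex_sum; last by move=> i _; exact: L1N.
rewrite (eq_bigr (fun=> 1)); last by move=> i _; exact: n1.
rewrite sumr_const card_ord invfM mulrCA mulfV ?mulr1//; exact: lt0r_neq0.
Qed.

End Tails.

(** * Uniformity over all pairs of directions *)

Lemma sum_pair_bool (R : nmodType) n (F : 'I_n * bool -> R) :
  \sum_j F j = \sum_i (F (i, true) + F (i, false)).
Proof.
rewrite (eq_bigr (fun j => F (j.1, j.2))); last by case.
rewrite -(pair_bigA _ (fun i b => F (i, b))) /=.
by apply: eq_bigr => i _; rewrite big_bool.
Qed.

(** By Cauchy-Schwarz each of the three error terms is at most [sqrt z / 128], and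
    the main term is at least [sqrt z / 16]. *)
Lemma perturbed_product (R : realFieldType) (z k p1 p2 q1 q2 e1 e2 f1 f2 : R) :
  0 < z -> z <= 1 -> 1 <= k ->
  p1 ^+ 2 + p2 ^+ 2 <= k -> q1 ^+ 2 + q2 ^+ 2 <= k ->
  e1 ^+ 2 + e2 ^+ 2 <= z / (2 ^+ 14 * k) -> f1 ^+ 2 + f2 ^+ 2 <= z / (2 ^+ 14 * k) ->
  z / 256 <= (p1 * q1 + p2 * q2) ^+ 2 ->
  z / 1024 <= ((p1 + e1) * (q1 + f1) + (p2 + e2) * (q2 + f2)) ^+ 2.
Proof.
move=> z0 z1 k1 pk qk ek fk H.
have k0 : 0 < k by lra.
have zk : 0 <= z / (2 ^+ 14 * k) by rewrite divr_ge0 ?mulr_ge0 ?exprn_ge0// ltW.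
have dot (u1 u2 v1 v2 : R) : (u1 * v1 + u2 * v2) ^+ 2 <= (u1 ^+ 2 + u2 ^+ 2) * (v1 ^+ 2 + v2 ^+ 2).
  rewrite -subr_ge0 (_ : _ - _ = (u1 * v2 - u2 * v1) ^+ 2) ?sqr_ge0//; ring.
have dk : z / (2 ^+ 14 * k) * k = z / 2 ^+ 14 by field; rewrite lt0r_neq0.
have s0 (x y : R) : 0 <= x ^+ 2 + y ^+ 2 by rewrite addr_ge0 ?sqr_ge0.
have D1 : (e1 * q1 + e2 * q2) ^+ 2 <= z / 2 ^+ 14.
  by apply: le_trans (dot _ _ _ _) _; rewrite -dk; apply: ler_pM.
have D2 : (p1 * f1 + p2 * f2) ^+ 2 <= z / 2 ^+ 14.
  by apply: le_trans (dot _ _ _ _) _; rewrite -dk mulrC; apply: ler_pM.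
have D3 : (e1 * f1 + e2 * f2) ^+ 2 <= z / 2 ^+ 14.
  apply: le_trans (dot _ _ _ _) _; rewrite -dk; apply: ler_pM => //.
  apply: (le_trans fk); rewrite ler_pdivrMr; last by rewrite mulr_gt0 ?exprn_gt0.
  have : 1 <= k * (2 ^+ 14 * k).
    by rewrite mulr_ege1// mulr_ege1// exprn_ege1//; lra.
  lra.
set A := p1 * q1 + p2 * q2 in H.
set B1 := e1 * q1 + e2 * q2 in D1; set B2 := p1 * f1 + p2 * f2 in D2.
set B3 := e1 * f1 + e2 * f2 in D3.
rewrite (_ : (p1 + e1) * (q1 + f1) + (p2 + e2) * (q2 + f2) = A + (B1 + B2 + B3)); last first.
  by rewrite /A /B1 /B2 /B3; ring.
have B : (B1 + B2 + B3) ^+ 2 <= 9 * z / 2 ^+ 14.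
  have := sqr_ge0 (B1 - B2); have := sqr_ge0 (B1 - B3); have := sqr_ge0 (B2 - B3); lra.
set E := B1 + B2 + B3 in B *.
have := sqr_ge0 (A + 2 * E) => sq.
by rewrite (_ : 2 ^+ 14 = 16384 :> R) in B; [nra|ring].
Qed.

Section Uniform.
Context {d d' dv d0 : measure_display} {T : measurableType d} {U : measurableType d'}.
Context {V : measurableType dv} {T0 : measurableType d0} {R : realType}.
Variables (n m : nat) (co : 'I_n -> V -> U) (xf yf : U -> R).
Hypothesis mco : forall i, measurable_fun setT (co i).
Hypothesis mx : measurable_fun setT xf.
Hypothesis my : measurable_fun setT yf.
Hypothesis n0 : (0 < n)%N.
Local Notation I := ('I_n * bool)%type.
Implicit Types (s t e : I -> R) (v : V).

(** Complex directions are families indexed by ['I_n * bool], real parts at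
    [true] and imaginary parts at [false], so that rounding and the net see a
    real vector of dimension [2n]. [re_form s v] and [im_form s v] are the parts of
    the linear form of [v] in direction [s], up to conjugation. *)
Definition re_coef v (j : I) : R := if j.2 then xf (co j.1 v) else yf (co j.1 v).
Definition im_coef v (j : I) : R := if j.2 then - yf (co j.1 v) else xf (co j.1 v).
Definition re_form s v := \sum_j s j * re_coef v j.
Definition im_form s v := \sum_j s j * im_coef v j.
Definition prod_form s t v := re_form s v * re_form t v + im_form s v * im_form t v.
Definition sq_form s v := re_form s v ^+ 2 + im_form s v ^+ 2.
Definition sq_norm s := \sum_j s j ^+ 2.
Definition im_inner s t := \sum_(i < n) (s (i, false) * t (i, true) - s (i, true) * t (i, false)).
Definition energy v := \sum_(i < n) sqnorm xf yf (co i v).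
Definition balanced s t :=
  [/\ 2^-1 <= sq_norm s <= 2, 2^-1 <= sq_norm t <= 2 & `|im_inner s t| <= 4^-1].

Lemma re_formB s t v : re_form s v - re_form t v = re_form (fun j => s j - t j) v.
Proof. by rewrite /re_form -sumrB; apply: eq_bigr => j _; rewrite mulrBl. Qed.

Lemma im_formB s t v : im_form s v - im_form t v = im_form (fun j => s j - t j) v.
Proof. by rewrite /im_form -sumrB; apply: eq_bigr => j _; rewrite mulrBl. Qed.

Lemma im_inner_bound (c : R) s t : 0 < c ->
  `|im_inner s t| <= (c * sq_norm s + c^-1 * sq_norm t) / 2.
Proof.
move=> c0; apply: (le_trans (ler_norm_sum _ _ _)).
rewrite /sq_norm !sum_pair_bool !mulr_sumr -big_split mulr_suml; apply: ler_sum => i _ /=.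
have ab (x y : R) : `|x * y| <= (c * x ^+ 2 + c^-1 * y ^+ 2) / 2.
  have H (u : R) : 0 <= c * x ^+ 2 + c^-1 * y ^+ 2 + 2 * (u * (x * y)) :> R -> - (u * (x * y)) <= (c * x ^+ 2 + c^-1 * y ^+ 2) / 2.
    by lra.
  have cc : c * c^-1 = 1 by rewrite mulfV// gt_eqF.
  have E (u : R) : u ^+ 2 = 1 -> c * x ^+ 2 + c^-1 * y ^+ 2 + 2 * (u * (x * y)) = c^-1 * (c * x + u * y) ^+ 2.
    move=> u2; rewrite (_ : c^-1 * (c * x + u * y) ^+ 2 =
      (c * c^-1) * (c * x ^+ 2) + c^-1 * u ^+ 2 * y ^+ 2 + 2 * (c * c^-1) * (u * (x * y))); last by ring.
    by rewrite cc u2; ring.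
  rewrite ler_norml lerNl; apply/andP; split.
    have := H 1; rewrite mul1r; apply; rewrite -[X in _ + _ + 2 * X]mul1r E ?expr1n//.
    by rewrite mulr_ge0 ?invr_ge0 ?sqr_ge0// ltW.
  have := H (-1); rewrite mulN1r opprK; apply; rewrite -[X in 2 * X]mulN1r E ?sqrrN ?expr1n//.
  by rewrite mulr_ge0 ?invr_ge0 ?sqr_ge0// ltW.
apply: (le_trans (ler_normB _ _)).
have := ab (s (i, false)) (t (i, true)); have := ab (s (i, true)) (t (i, false)); lra.
Qed.

Lemma coef_energy v : \sum_j (re_coef v j ^+ 2 + im_coef v j ^+ 2) = 2 * energy v.
Proof.
rewrite sum_pair_bool /energy mulr_sumr; apply: eq_bigr => i _.
rewrite /re_coef /im_coef /sqnorm /=; ring.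
Qed.

(** Rounding is done for the given samples, not for all directions at once: the
    sum of the squared errors over samples of bounded energy is controlled by
    [greedy_rounding] through their total energy. A bound on the norm of the sample
    matrix is avoided: so few moments cannot make its failure exponentially
    improbable. *)
Lemma round_to_grid s (step M : R) (v : 'I_m -> V) : 0 < step -> 0 <= M ->
  exists z : I -> int, (forall j, (s j - step * (z j)%:~R) ^+ 2 <= step ^+ 2) /\
   \sum_(k | energy (v k) <= M * n%:R)
      sq_form (fun j => s j - step * (z j)%:~R) (v k) <= step ^+ 2 * (2 * (M * n%:R) * m%:R).
Proof.
move=> step0 M0.
pose W (j : I) (f : 'I_m * bool) : R :=
  if energy (v f.1) <= M * n%:R then
    (if f.2 then re_coef (v f.1) j else im_coef (v f.1) j) else 0.
have [z [z1 Hz]] := greedy_rounding (fun j => s j / step) W.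
have sE j : s j - step * (z j)%:~R = step * (s j / step - (z j)%:~R).
  by rewrite mulrBr mulrCA mulfV ?mulr1// gt_eqF.
exists z; split=> [j|].
  rewrite sE exprMn ler_piMr ?sqr_ge0//.
  by rewrite -[_ ^+ 2]real_normK ?num_real// exprn_ile1.
have -> : \sum_(k | energy (v k) <= M * n%:R)
      sq_form (fun j => s j - step * (z j)%:~R) (v k) =
    step ^+ 2 * \sum_k (\sum_j (s j / step - (z j)%:~R) * W j k) ^+ 2.
  rewrite sum_pair_bool mulr_sumr big_mkcond /=; apply: eq_bigr => k _.
  rewrite /W /=; case: ifP => _; last first.
    by rewrite !big1 ?expr0n ?addr0 ?mulr0// => j _; rewrite mulr0.
  rewrite mulrDr -!exprMn !mulr_sumr /sq_form /re_form /im_form.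
  by congr (_ ^+ 2 + _ ^+ 2); apply: eq_bigr => j _; rewrite sE mulrA.
rewrite ler_pM2l ?exprn_gt0//; apply: (le_trans Hz).
rewrite exchange_big /= sum_pair_bool /=.
apply: (@le_trans _ _ (\sum_(k < m) (2 * (M * n%:R)))); last first.
  by rewrite sumr_const card_ord -[leLHS]mulr_natr.
apply: ler_sum => k _; rewrite -big_split /= /W /=.
case: (boolP (energy (v k) <= _)) => H.
  by rewrite coef_energy ler_pM2l.
by rewrite big1 ?mulr_ge0// => j _; rewrite expr0n addr0.
Qed.

Lemma sq_norm_near s s' (D : R) : sq_norm (fun j => s j - s' j) <= D -> D <= 2 ^- 20 ->
  sq_norm s = 1 -> 2^-1 <= sq_norm s' <= 2.
Proof.
move=> HD D20 s1.
have D20' : D <= 64^-1.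
  by apply: (le_trans D20); rewrite lef_pV2 ?posrE ?exprn_gt0//; rewrite -[64]/(64%:R) -natrX ler_nat.
have up j : s' j ^+ 2 <= 5 / 4 * s j ^+ 2 + 5 * (s j - s' j) ^+ 2.
  by have := sqr_ge0 (5 * s j - 4 * s' j); have := sqr_ge0 (s j); nra.
have lo j : 3 / 4 * s j ^+ 2 - 3 * (s j - s' j) ^+ 2 <= s' j ^+ 2.
  by have := sqr_ge0 (4 * s' j - 3 * s j); nra.
have H1 : sq_norm s' <= 5 / 4 * sq_norm s + 5 * sq_norm (fun j => s j - s' j).
  by rewrite /sq_norm !mulr_sumr -big_split ler_sum.
have H2 : 3 / 4 * sq_norm s - 3 * sq_norm (fun j => s j - s' j) <= sq_norm s'.
  by rewrite /sq_norm !mulr_sumr -sumrB ler_sum.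
move: H1 H2; rewrite s1 => H1 H2; apply/andP; split; lra.
Qed.

Lemma im_inner_near s t s' t' (D : R) :
  sq_norm (fun j => s j - s' j) <= D -> sq_norm (fun j => t j - t' j) <= D -> D <= 2 ^- 20 ->
  sq_norm s = 1 -> sq_norm t = 1 -> im_inner s t = 0 -> `|im_inner s' t'| <= 4^-1.
Proof.
move=> Ds Dt D20 s1 t1 st.
have /andP[_ t2] := sq_norm_near Dt D20 t1.
pose e j := s j - s' j; pose f j := t j - t' j.
have E : im_inner s' t' = im_inner s t + (- im_inner e t' - im_inner s f).
  rewrite /im_inner -!sumrN -!big_split /=.
  apply: eq_bigr => i _; rewrite /e /f; ring.
have c0 : 0 < 2 ^+ 8 :> R by rewrite exprn_gt0.
have c0' : 0 < 2 ^- 8 :> R by rewrite invr_gt0.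
have B1 := im_inner_bound e t' c0; have B2 := im_inner_bound s f c0'.
rewrite E st add0r; apply: (le_trans (ler_normB _ _)); rewrite normrN; move: B1 B2 Ds Dt t2.
rewrite s1 -/e -/f invrK.
set A1 := `|_|; set A2 := `|_| => B1 B2 Ds Dt t2.
have D20' : 2 ^+ 8 * D <= 2 ^- 12.
  apply: (le_trans (ler_wpM2l (ltW c0) D20)); rewrite -[2 ^- 12]mul1r ler_pdivlMr ?exprn_gt0//.
  by rewrite mulrAC -exprD mulfV// expf_neq0// pnatr_eq0.
have h12 : 2 ^- 12 <= 64^-1 :> R.
  by rewrite lef_pV2 ?posrE ?exprn_gt0//; rewrite -[64]/(64%:R) -natrX ler_nat.
have h8 : 2 ^- 8 <= 64^-1 :> R.
  by rewrite lef_pV2 ?posrE ?exprn_gt0//; rewrite -[64]/(64%:R) -natrX ler_nat.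
have E1 : 2 ^+ 8 * sq_norm e <= 2 ^+ 8 * D by rewrite ler_pM2l.
have E2 : 2 ^+ 8 * sq_norm f <= 2 ^+ 8 * D by rewrite ler_pM2l.
have E3 : 2 ^- 8 * sq_norm t' <= 64^-1 * 2.
  apply: ler_pM => //.
  by apply: sumr_ge0 => j _; exact: sqr_ge0.
move: (2 ^+ 8) (2 ^- 8) c0 c0' B1 B2 D20' h12 h8 E1 E2 E3 => c8 c8' *; lra.
Qed.

Let mre s : measurable_fun setT (re_form s).
Proof.
apply: measurable_sum => -[i b]; apply: measurable_funM => //.
by case: b; rewrite /re_coef /=; [exact: (measurableT_comp mx)|exact: (measurableT_comp my)].
Qed.

Let mim s : measurable_fun setT (im_form s).
Proof.
apply: measurable_sum => -[i b]; apply: measurable_funM => //.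
case: b; rewrite /im_coef /=; last exact: (measurableT_comp mx).
by apply: measurable_funN; exact: (measurableT_comp my).
Qed.

Let msq s : measurable_fun setT (sq_form s).
Proof. by apply: measurable_funD; apply: measurable_funX. Qed.

Let mprod s t : measurable_fun setT (prod_form s t).
Proof. by apply: measurable_funD; apply: measurable_funM. Qed.

Let menergy : measurable_fun setT energy.
Proof.
apply: measurable_sum => i; apply: measurable_funD; apply: measurable_funX.
  exact: (measurableT_comp mx).
exact: (measurableT_comp my).
Qed.

Variables (P0 : probability T0 R) (a : T0 -> V) (zeta Q : R).
Hypothesis ma : measurable_fun setT a.
Hypothesis Q0 : 0 < Q.
Hypothesis Qz : Q <= zeta.
Hypothesis z1 : zeta <= 1.
Hypothesis small_ball : forall s t, balanced s t ->
  Q <= fine (P0 [set w | zeta / 256 <= prod_form s t (a w) ^+ 2]).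
Hypothesis form_tail : forall s (c : R), 0 < c ->
  fine (P0 [set w | c < sq_form s (a w)]) <= sq_norm s / c.
Hypothesis energy_tail : forall c : R, 0 < c ->
  fine (P0 [set w | c * n%:R < energy (a w)]) <= c^-1.

(* Each linear form exceeds [kap] in square with probability at most [Q / 4]. *)
Let kap := 8 / Q.

Definition typical s t : set V :=
  [set v | [/\ zeta / 256 <= prod_form s t v ^+ 2, sq_form s v <= kap & sq_form t v <= kap]].

Lemma measurable_typical s t : measurable (typical s t).
Proof.
rewrite (_ : typical s t = [set v | zeta / 256 <= prod_form s t v ^+ 2] `&`
   ([set v | sq_form s v <= kap] `&` [set v | sq_form t v <= kap])).
  by apply: measurableI; [|apply: measurableI]; apply: measurable_le_set => //; exact: measurable_funX.
by apply/seteqP; split => v /=; rewrite /typical /=; [case|move=> [? [? ?]]].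
Qed.

Lemma typical_prob s t : balanced s t -> Q / 2 <= fine (P0 (a @^-1` typical s t)).
Proof.
move=> st; have [/andP[_ s2] /andP[_ t2] _] := st.
have kap0 : 0 < kap by rewrite divr_gt0.
have mpre (B : set V) : measurable B -> measurable (a @^-1` B).
  by move=> mB; rewrite -[X in measurable X]setTI; exact: ma.
set A := [set w | zeta / 256 <= prod_form s t (a w) ^+ 2].
have mA : measurable A.
  by apply: (mpre [set v | zeta / 256 <= prod_form s t v ^+ 2]); apply: measurable_le_set => //; exact: measurable_funX.
have mB u : measurable [set w | kap < sq_form u (a w)].
  by apply: (mpre [set v | kap < sq_form u v]); exact: measurable_lt_set.
have mC := mpre _ (measurable_typical s t).
have tl u : sq_norm u <= 2 -> fine (P0 [set w | kap < sq_form u (a w)]) <= Q / 4.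
  move=> u2; apply: (le_trans (form_tail u kap0)).
  rewrite /kap invf_div mulrA ler_pdivrMr//.
  have := ler_wpM2r (ltW Q0) u2; lra.
have H : fine (P0 A) <= fine (P0 (a @^-1` typical s t)) +
    (fine (P0 [set w | kap < sq_form s (a w)]) + fine (P0 [set w | kap < sq_form t (a w)])).
  rewrite -!Ex_indic// -!ExD; try by repeat apply: L1D; exact: L1_indic.
  apply: Ex_le; [exact: L1_indic|by repeat apply: L1D; exact: L1_indic|] => w.
  rewrite !indicE; case: (boolP (w \in A)) => [/set_mem Aw|_]; last by rewrite !addr_ge0.
  have [H1|H1] := lerP (sq_form s (a w)) kap; last first.
    have /mem_set -> : [set w | kap < sq_form s (a w)] w by [].
    by rewrite addrCA lerDl addr_ge0.
  have [H2|H2] := lerP (sq_form t (a w)) kap; last first.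
    have /mem_set -> : [set w | kap < sq_form t (a w)] w by [].
    by rewrite addrA lerDr addr_ge0.
  have /mem_set -> : (a @^-1` typical s t) w by [].
  by rewrite lerDl addr_ge0.
have := small_ball st; rewrite -/A; have := tl _ s2; have := tl _ t2; lra.
Qed.

Variables (P : probability T R) (b : 'I_m -> T -> V).
Hypothesis mb : forall k, measurable_fun setT (b k).
Hypothesis indb : mutually_independent P b.
Hypothesis law : forall k B, measurable B -> P (b k @^-1` B) = P0 (a @^-1` B).
Hypothesis mlarge : 2 ^+ 17 * n%:R / Q ^+ 2 <= m%:R.

Let nR : 0 < n%:R :> R. Proof. by rewrite ltr0n. Qed.
(* Samples of energy above [M * n] and samples with a large rounding error should
   both be fewer than a fraction [th] of all. The first has probability
   [M^-1 = th / 4]. The second dictates [step]: by [round_to_grid] at most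
   [2 step^2 M n m / tau2] samples have a squared error above [tau2], the error
   that [perturbed_product] tolerates. *)
Let th := Q / 32.
Let M := 128 / Q.
Let step := Q ^+ 2 / 2 ^+ 15 / Num.sqrt n%:R.
Let L := `|Num.ceil (2 / step ^+ 2)|%N.
Let tau2 := zeta / (2 ^+ 14 * kap).

Let step0 : 0 < step.
Proof. by rewrite !divr_gt0 ?exprn_gt0 ?sqrtr_gt0. Qed.

Let Q1 : Q <= 1. Proof. exact: le_trans Qz z1. Qed.

Let stepE : step ^+ 2 = Q ^+ 4 / 2 ^+ 30 / n%:R.
Proof.
rewrite /step !exprMn !exprVn sqr_sqrtr; last exact: ltW.
by rewrite -!exprM -exprD.
Qed.

Let Q4 : Q ^+ 4 <= 1. Proof. by rewrite exprn_ile1// ltW. Qed.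

Let kap1 : 1 <= kap.
Proof. by rewrite /kap ler_pdivlMr// mul1r; have := Q1; lra. Qed.

Definition grid (c : net_code I L) (j : I) : R := step * (net_coord c j)%:~R.

Let two29 : 2 * (Q ^+ 4 / 2 ^+ 30) <= 2 ^- 20.
Proof.
apply: (@le_trans _ _ (2 / 2 ^+ 30)).
  by rewrite ler_pM2l// ler_pdivrMr ?exprn_gt0// mulVf ?expf_neq0// pnatr_eq0.
rewrite ler_pdivrMr ?exprn_gt0// -[2 ^+ 30]/(2 ^+ (20 + 10)) exprD mulKf ?expf_neq0 ?pnatr_eq0//.
by rewrite -natrX ler_nat.
Qed.

(** The grid point also stays close to [s] in norm, since every coordinate moves
    by at most [step]; so its norm is bounded and it belongs to the net. *)
Lemma nearby_grid_point s (v : 'I_m -> V) : sq_norm s = 1 ->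
  exists c, sq_norm (fun j => s j - grid c j) <= 2 * (Q ^+ 4 / 2 ^+ 30) /\
    \sum_(k | energy (v k) <= M * n%:R) sq_form (fun j => s j - grid c j) (v k) <=
    th * m%:R * tau2.
Proof.
move=> s1; have M0 : 0 <= M by rewrite divr_ge0// ltW.
have [z [zs Hz]] := round_to_grid s v step0 M0.
have D : sq_norm (fun j => s j - step * (z j)%:~R) <= 2 * (Q ^+ 4 / 2 ^+ 30).
  apply: (@le_trans _ _ (\sum_(j : I) step ^+ 2)); first by apply: ler_sum => j _; exact: zs.
  rewrite sumr_const card_prod card_ord card_bool stepE -[leLHS]mulr_natr natrM.
  by rewrite mulrA divfK ?gt_eqF// mulrC.
have /andP[_ g2] := sq_norm_near D two29 s1.
have [c cz] : exists c : net_code I L, net_coord c =1 z.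
  apply: net_coord_onto; rewrite -(ler_int R) /L gez0_abs; last first.
    by rewrite ceil_ge0 (lt_le_trans (ltrN10 R))// divr_ge0// sqr_ge0.
  have /andP[_ cl] := ceil_itv (2 / step ^+ 2); apply: le_trans cl.
  rewrite ler_pdivlMr ?exprn_gt0//.
  apply: le_trans g2; rewrite /sq_norm rmorph_sum mulr_suml /=; apply: ler_sum => j _.
  by rewrite rmorphXn /= [leRHS]exprMn mulrC.
have gE : grid c = fun j => step * (z j)%:~R by apply/funext => j; rewrite /grid cz.
exists c; rewrite gE; split => //; apply: (le_trans Hz).
rewrite stepE /th /M /tau2 /kap.
have -> : Q ^+ 4 / 2 ^+ 30 / n%:R * (2 * (128 / Q * n%:R) * m%:R) =
   (Q ^+ 2 * m%:R) * (2 ^+ 8 / 2 ^+ 30) * Q.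
  by field; rewrite !lt0r_neq0.
have -> : Q / 32 * m%:R * (zeta / (2 ^+ 14 * (8 / Q))) =
   (Q ^+ 2 * m%:R) * (2 ^+ 8 / 2 ^+ 30) * zeta.
  by field; rewrite lt0r_neq0.
apply: ler_wpM2l => //; apply: mulr_ge0; first by rewrite mulr_ge0 ?sqr_ge0.
by rewrite divr_ge0 ?exprn_ge0.
Qed.

(* [bad1]: too many samples of large energy. [bad2 c]: too few typical samples at
   a pair of grid points where the small-ball hypothesis applies. *)
Let high := [set v | M * n%:R < energy v].
Let bad1 := [set w | th * m%:R <= (hits b high w)%:R].
Let bad2 (c : net_code I L * net_code I L) :=
  if `[< balanced (grid c.1) (grid c.2) >] then
    [set w | (hits b (typical (grid c.1) (grid c.2)) w)%:R < Q / 2 * m%:R / 4]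
  else set0.
Let bad := bad1 `|` \bigcup_(c in [set: (net_code I L * net_code I L)%type]) bad2 c.

Definition separated s t : set V := [set v | zeta / 1024 <= prod_form s t v ^+ 2].

(** At the pair of grid points near [s] and [t], at least [Q m / 8] samples are
    typical; all of them are separated at [s, t] too, except for at most
    [3 th m = 3 Q m / 32] samples of large energy or with a large rounding error. *)
Lemma grid_to_sphere w s t : ~ bad w -> sq_norm s = 1 -> sq_norm t = 1 ->
  im_inner s t = 0 -> th * m%:R <= (hits b (separated s t) w)%:R.
Proof.
move=> /not_orP[nb1 nb2] s1 t1 st.
have [c [cD cS]] := nearby_grid_point (fun k => b k w) s1.
have [c' [cD' cS']] := nearby_grid_point (fun k => b k w) t1.
have bal : balanced (grid c) (grid c').
  split; [exact: sq_norm_near cD two29 s1|exact: sq_norm_near cD' two29 t1|].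
  exact: im_inner_near cD cD' two29 s1 t1 st.
have many : Q / 2 * m%:R / 4 <= (hits b (typical (grid c) (grid c')) w)%:R.
  rewrite leNgt; apply/negP => H; apply: nb2; exists (c, c') => //.
  by rewrite /bad2 /= asboolT.
have few : (hits b high w)%:R < th * m%:R.
  by rewrite ltNge; apply/negP => H; apply: nb1.
pose far u := [set k | (energy (b k w) <= M * n%:R) && (tau2 < sq_form u (b k w))]%SET.
have kap0 : 0 < kap by apply: lt_le_trans kap1.
have z0 : 0 < zeta by apply: lt_le_trans Qz.
have tau0 : 0 < tau2 by rewrite divr_gt0// mulr_gt0// exprn_gt0.
have farb u : \sum_(k | energy (b k w) <= M * n%:R) sq_form u (b k w) <= th * m%:R * tau2 ->
    (#|far u|)%:R <= th * m%:R.
  move=> H; rewrite -(ler_pM2r tau0); apply: le_trans H.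
  rewrite mulr_natl -sumr_const.
  rewrite [leRHS](bigID (fun k => tau2 < sq_form u (b k w))) /= -[leLHS]addr0; apply: lerD.
    rewrite [leRHS](eq_bigl (fun k => k \in far u)); last by move=> k; rewrite inE.
    by apply: ler_sum => k; rewrite inE => /andP[_ /ltW].
  by apply: sumr_ge0 => k _; rewrite addr_ge0 ?sqr_ge0.
set s' := grid c in cD cS bal many; set t' := grid c' in cD' cS' bal many.
pose e j := s j - s' j; pose f j := t j - t' j.
have sub : [set k | b k w \in typical s' t']%SET \subset
   [set k | b k w \in (separated s t)]%SET :|:
   ([set k | b k w \in high]%SET :|: (far e :|: far f)).
  apply/fintype.subsetP => k; rewrite /far finset.in_set !finset.in_setU !finset.in_set => /set_mem [H1 H2 H3].
  have [hi|lo] := ltP (M * n%:R) (energy (b k w)).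
    by apply/orP; right; apply/orP; left; exact/mem_set.
  have [fe|ne] := ltP tau2 (sq_form e (b k w)); first by rewrite /= !orbT.
  have [ff|nf] := ltP tau2 (sq_form f (b k w)); first by rewrite /= !orbT.
  apply/orP; left; apply/mem_set => /=.
  rewrite /separated /prod_form /=.
  have sE : re_form s (b k w) = re_form s' (b k w) + re_form e (b k w).
    by rewrite /e -re_formB addrC subrK.
  have tE : re_form t (b k w) = re_form t' (b k w) + re_form f (b k w).
    by rewrite /f -re_formB addrC subrK.
  have sE' : im_form s (b k w) = im_form s' (b k w) + im_form e (b k w).
    by rewrite /e -im_formB addrC subrK.
  have tE' : im_form t (b k w) = im_form t' (b k w) + im_form f (b k w).
    by rewrite /f -im_formB addrC subrK.
  by rewrite sE tE sE' tE'; apply: (perturbed_product z0 z1 kap1 H2 H3 ne nf).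
have := subset_leq_card sub; rewrite -(ler_nat R) => card1.
have card2 : (#|[set k | b k w \in typical s' t']%SET|)%:R <=
   (hits b (separated s t) w)%:R +
   ((hits b high w)%:R + ((#|far e|)%:R + (#|far f|)%:R)) :> R.
  apply: (le_trans card1); rewrite -!natrD ler_nat.
  apply: (leq_trans (leq_card_setU _ _)); rewrite leq_add2l.
  apply: (leq_trans (leq_card_setU _ _)); rewrite leq_add2l.
  exact: leq_card_setU.
move: card2; rewrite -/(hits b (typical s' t') w) => card2.
have := farb _ cS; have := farb _ cS'; rewrite -/e -/f /th in few * => ff fe.
lra.
Qed.

Let mhigh : measurable high.
Proof. by apply: measurable_lt_set. Qed.

Let mbad1 : measurable bad1.
Proof. exact: many_hits_measurable. Qed.

Let mbad2 c : measurable (bad2 c).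
Proof.
rewrite /bad2; case: ifP => _; last exact: measurable0.
by apply: few_hits_measurable => //; exact: measurable_typical.
Qed.

Let mbad : measurable bad.
Proof.
apply: measurableU => //; apply: fin_bigcup_measurable => [|c _]; last exact: mbad2.
exact: finite_finset.
Qed.

Let fine_law k B : measurable B -> P (b k @^-1` B) = (fine (P0 (a @^-1` B)))%:E.
Proof.
move=> mB; rewrite law// fineK// fin_num_measure//.
by rewrite -[X in measurable X]setTI; exact: ma.
Qed.

Let Pbad1 : fine (P bad1) <= expR (- (th * m%:R / 4)).
Proof.
apply: (chernoff_many_hits mb indb mhigh (fun k => fine_law k mhigh)).
have M0 : 0 < M by rewrite divr_gt0.
have := energy_tail M0; rewrite /M /th invf_div; lra.
Qed.

Let Pbad2 c : fine (P (bad2 c)) <= expR (- (Q / 2 * m%:R / 4)).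
Proof.
rewrite /bad2; case: asboolP => [bal|_]; last by rewrite measure0 expR_ge0.
have mt := measurable_typical (grid c.1) (grid c.2).
apply: (chernoff_few_hits mb indb mt (fun k => fine_law k mt)).
by apply/andP; split; [rewrite divr_ge0// ltW|exact: typical_prob].
Qed.

(* [expR 2 * 2^31 / Q^4 <= expR (2 + 31 + 4 / Q)]; the logarithm of [1 / Q] is
   bounded by [1 / Q], which costs nothing as [m] has to exceed [n / Q^2] anyway. *)
Let card_net : #|{: net_code I L * net_code I L}|%:R <= expR (296 * n%:R / Q) :> R.
Proof.
have Qinv : 1 <= Q^-1 by rewrite invf_ge1.
have r0 : 1 <= 2 ^+ 31 / Q ^+ 4 :> R.
  by rewrite ler_pdivlMr ?exprn_gt0// mul1r (le_trans Q4)// exprn_ege1//; lra.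
have LI : L%:R <= 2 ^+ 31 / Q ^+ 4 * #|{: I}|%:R :> R.
  have X : 2 / step ^+ 2 = 2 ^+ 31 / Q ^+ 4 * n%:R.
    rewrite stepE; have -> : 2 ^+ 31 = 2 * 2 ^+ 30 :> R by rewrite -exprS.
    by field; rewrite !lt0r_neq0 ?exprn_gt0.
  have X1 : 1 <= 2 / step ^+ 2.
    by rewrite X mulr_ege1// ler1n.
  have /andP[ub _] := ceil_itv (2 / step ^+ 2).
  have L' : L%:R = (Num.ceil (2 / step ^+ 2))%:~R :> R.
    rewrite /L natr_absz gtr0_norm//; by rewrite ceil_gt0; lra.
  rewrite L' card_prod card_ord card_bool natrM mulrA -X.
  by move: ub; rewrite intrB mulr1z; lra.
have r00 : 0 < 2 ^+ 31 / Q ^+ 4 :> R by exact: lt_le_trans r0.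
have H := card_net_code r00 r0 LI.
rewrite card_prod natrM; apply: le_trans (ler_pM _ _ H H) _; rewrite ?ler0n//.
rewrite -exprD card_prod card_ord card_bool.
have big : expR 2 * (2 ^+ 31 / Q ^+ 4) <= expR (37 / Q).
  have e1 : 2 <= expR 1 :> R by have := expR_ge1Dx (1 : R); lra.
  have eQ : Q^-1 <= expR Q^-1 by have := expR_ge1Dx Q^-1; lra.
  apply: (@le_trans _ _ (expR 2 * (expR 1 ^+ 31 * expR Q^-1 ^+ 4))).
    have A1 : 2 ^+ 31 <= expR 1 ^+ 31 :> R by rewrite lerXn2r ?nnegrE ?expR_ge0.
    have Qi0 : 0 <= Q^-1 by rewrite invr_ge0 ltW.
    have A2 : (Q ^+ 4)^-1 <= expR Q^-1 ^+ 4.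
      by rewrite -exprVn lerXn2r ?nnegrE ?expR_ge0.
    rewrite ler_pM2l ?expR_gt0//; apply: (ler_pM _ _ A1 A2); first exact: exprn_ge0.
    by rewrite invr_ge0 exprn_ge0// ltW.
  by rewrite -!expRM_natr -!expRD ler_expR; lra.
apply: (@le_trans _ _ (expR (37 / Q) ^+ (2 * (n * 2) + 2 * (n * 2)))).
  by rewrite lerXn2r ?nnegrE ?expR_ge0// mulr_ge0 ?expR_ge0// ltW.
by rewrite -expRM_natr ler_expR natrD !natrM; lra.
Qed.

(** Union bound over the net: its cardinality [exp (296 n / Q)] is absorbed by the
    Chernoff bound [exp (- Q m / 8)] as soon as [m >= 2^17 n / Q^2]. *)
Lemma uniform_separation : exists E : set T, [/\ measurable E,
  ((1 - expR (- (Q * m%:R / 256)))%:E <= P E)%E &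
  forall w, E w -> forall s t, sq_norm s = 1 -> sq_norm t = 1 -> im_inner s t = 0 ->
    Q / 32 * m%:R <= (hits b (separated s t) w)%:R].
Proof.
exists (~` bad); split; first exact: measurableC.
- rewrite probability_setC// -[P bad]fineK ?fin_num_measure// -EFinB lee_fin lerD2l lerN2.
  pose C : finType := (net_code I L * net_code I L)%type.
  have H : fine (P bad) <= fine (P bad1) + \sum_(c : C) fine (P (bad2 c)).
    rewrite (eq_bigr (fun c => Ex P \1_(bad2 c))); last by move=> c _; rewrite Ex_indic.
    have LS : L1 P (fun w => \sum_(c : C) \1_(bad2 c) w) by apply: L1_sum => c _; exact: L1_indic.
    have L1' : L1 P (\1_bad1) by exact: L1_indic.
    rewrite -Ex_sum; last by move=> c _; exact: L1_indic.
    rewrite -!Ex_indic// -ExD//; apply: Ex_le; [exact: L1_indic|exact: L1D|] => w.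
    have S0 : 0 <= \sum_(c : C) \1_(bad2 c) w :> R by apply: sumr_ge0 => c _; rewrite indicE.
    rewrite [leLHS]indicE; case: (boolP (w \in bad)) => [/set_mem [b1|[c _ b2]]|_].
    + by rewrite indicE mem_set// lerDl.
    + rewrite (bigD1 c)//= [\1_(bad2 c) w]indicE mem_set//= addrCA lerDl addr_ge0//.
      by apply: sumr_ge0 => c' _; rewrite indicE.
    + by rewrite addr_ge0// indicE.
  apply: (le_trans H); set E := Q * m%:R / 256.
  have E1 : 296 * n%:R / Q <= E.
    have Q2 : 0 < Q ^+ 2 by exact: exprn_gt0.
    move: mlarge; rewrite ler_pdivrMr// => H1.
    rewrite ler_pdivrMr// /E.
    rewrite (_ : Q * m%:R / 256 * Q = (m%:R * Q ^+ 2) / 256); last by ring.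
    rewrite ler_pdivlMr//; apply: le_trans H1.
    have : 296 * 256 <= 2 ^+ 17 :> R by rewrite -natrM -natrX ler_nat.
    move=> H2; have := ler_wpM2r (ltW nR) H2; rewrite mulrAC; lra.
  have E2 : 1 <= E.
    apply: le_trans E1; rewrite ler_pdivlMr// mul1r.
    have : 1 <= n%:R :> R by rewrite ler1n.
    have := Q1; lra.
  apply: (@le_trans _ _ (expR (- (2 * E)) + expR E * expR (- (32 * E)))).
    apply: lerD.
      by apply: (le_trans Pbad1); rewrite ler_expR /th /E; lra.
    apply: (@le_trans _ _ (\sum_(c : C) expR (- (32 * E)))).
      apply: ler_sum => c _; apply: (le_trans (Pbad2 c)); rewrite ler_expR /E; lra.
    rewrite sumr_const -[leLHS]mulr_natl ler_wpM2r ?expR_ge0//.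
    by apply: (le_trans card_net); rewrite ler_expR.
  have e2 : 2 <= expR E by have := expR_ge1Dx E; lra.
  rewrite -expRD; apply: (@le_trans _ _ (2 * expR (- (2 * E)))).
    have : expR (E - 32 * E) <= expR (- (2 * E)) by rewrite ler_expR; lra.
    lra.
  rewrite (_ : - E = E + - (2 * E)); last by ring.
  by rewrite expRD ler_wpM2r ?expR_ge0.
- by move=> w nb s t s1 t1 st; exact: grid_to_sphere.
Qed.

End Uniform.

(** * Choice of the truncation level *)

Section RealPowers.
Variable R : realType.
Implicit Types s t p : R.

(** Tangent-line inequality, from [1 + x <= exp x] used twice. *)
Lemma bernoulli_powR s p : 0 <= s -> 1 <= p -> 1 + p * (s - 1) <= s `^ p.
Proof.
move=> s0 p1; have [->|sn0] := eqVneq s 0.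
  rewrite powR0; last by rewrite gt_eqF// (lt_le_trans ltr01).
  by lra.
have sp : 0 < s by rewrite lt_neqAle eq_sym sn0.
rewrite -{1}(lnK sp) /powR (negbTE sn0); set u := ln s.
have H1 : 1 + (p - 1) * u <= expR ((p - 1) * u) by exact: expR_ge1Dx.
have H2 : expR u - 1 <= u * expR u.
  have := expR_ge1Dx (- u); rewrite expRN => H.
  have e0 := expR_gt0 u; have := ler_wpM2r (ltW e0) H.
  by rewrite mulVf ?gt_eqF//; lra.
have -> : p * u = u + (p - 1) * u by ring.
rewrite expRD; have e0 := expR_ge0 u.
have H3 := ler_wpM2l e0 H1; have H4 : (p - 1) * (expR u - 1) <= (p - 1) * (u * expR u).
  by rewrite ler_wpM2l//; lra.
lra.
Qed.

Lemma natpow_le_powR t (k : nat) p tau : 0 <= t -> 0 < tau -> t <= tau -> p <= k%:R -> 0 < p ->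
  t ^+ k <= t `^ p * (tau ^+ k / tau `^ p).
Proof.
move=> t0 tau0 tt pk p0.
have [->|tn0] := eqVneq t 0.
  have k0 : (0 < k)%N by rewrite -(ltr_nat R) (lt_le_trans p0).
  by rewrite expr0n gtn_eqF// powR0 ?mul0r// gt_eqF.
have tp : 0 < t by rewrite lt_neqAle eq_sym tn0.
have -> : tau ^+ k / tau `^ p = tau `^ (k%:R - p).
  rewrite -powR_mulrn ?(ltW tau0)// -{1}[k%:R](subrK p) powRD; last by rewrite (gt_eqF tau0) implybT.
  by rewrite mulfK// gt_eqF// powR_gt0.
rewrite -powR_mulrn//.
have -> : t `^ k%:R = t `^ p * t `^ (k%:R - p).
  by rewrite -powRD; [congr powR; ring|rewrite tn0 implybT].
by rewrite ler_wpM2l ?powR_ge0// ge0_ler_powR ?nnegrE ?subr_ge0 ?(ltW tau0)//.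
Qed.

Lemma natpow_ge_powR t (k : nat) p tau : 0 < tau -> tau <= t -> k%:R <= p ->
  t ^+ k <= t `^ p * (tau ^+ k / tau `^ p).
Proof.
move=> tau0 tt pk; have tp : 0 < t by exact: lt_le_trans tt.
have t0 : 0 < tau `^ p by exact: powR_gt0.
rewrite mulrA ler_pdivlMr// -(powR_mulrn k (ltW tau0)) -(powR_mulrn k (ltW tp)).
have -> : t `^ p = t `^ k%:R * t `^ (p - k%:R).
  by rewrite -powRD; [congr powR; ring|rewrite (gt_eqF tp) implybT].
have -> : tau `^ p = tau `^ k%:R * tau `^ (p - k%:R).
  by rewrite -powRD; [congr powR; ring|rewrite (gt_eqF tau0) implybT].
rewrite mulrA [leRHS]mulrAC ler_wpM2l ?mulr_ge0 ?powR_ge0//.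
by rewrite ge0_ler_powR ?nnegrE ?subr_ge0 ?(ltW tau0) ?(ltW tp).
Qed.

End RealPowers.

Lemma double_double_succ (K : nat) : (2 * K.+1.*2 = 4 + 4 * K)%N.
Proof. lia. Qed.

Section SmallBallMoment.
Context {d d' : measure_display} {T : measurableType d} {U : measurableType d'}.
Context {R : realType}.
Variables (P : probability T R) (n : nat) (a : 'I_n -> T -> U).
Hypothesis ma : forall i, measurable_fun setT (a i).
Hypothesis ind : mutually_independent P a.
Variables (xf yf : U -> R).
Hypothesis mx : measurable_fun setT xf.
Hypothesis my : measurable_fun setT yf.
Local Notation norm u := (Num.sqrt (sqnorm xf yf u)).
Local Notation herm_xy := (fun sr si tr ti => herm a sr si tr ti (fun=> xf) (fun=> yf)).

Hypothesis x0 : forall i, Ex P (xf \o a i) = 0.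
Hypothesis y0 : forall i, Ex P (yf \o a i) = 0.
Hypothesis n1 : forall i, Ex P (sqnorm xf yf \o a i) = 1.
Variables (zeta gam : R).
Hypothesis n2 : forall i, 1 + zeta <= Ex P (fun w => sqnorm xf yf (a i w) ^+ 2).
Hypothesis cov : forall i,
  (Ex P (fun w => xf (a i w) ^+ 2) - Ex P (fun w => yf (a i w) ^+ 2)) ^+ 2 +
  4 * Ex P (fun w => xf (a i w) * yf (a i w)) ^+ 2 <= gam ^+ 2.
Hypothesis zeta0 : 0 < zeta.
Hypothesis gam0 : 0 <= gam.
Hypothesis zeta_gam : zeta <= 1 - gam ^+ 2.

Let zeta1 : zeta <= 1.
Proof. by move: zeta_gam; have := sqr_ge0 gam; lra. Qed.

Let N0 u : 0 <= sqnorm xf yf u.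
Proof. by rewrite addr_ge0 ?sqr_ge0. Qed.

Let mN : measurable_fun setT (sqnorm xf yf).
Proof. by apply: measurable_funD; exact: measurable_funX. Qed.

Let msmall tau : measurable_fun setT (small xf yf tau).
Proof.
apply: measurable_fun_ifT; [|exact: measurable_cst|exact: measurable_cst].
by apply: measurable_fun_ler => //; exact: measurable_cst.
Qed.

Let mcomp (f : U -> R) i : measurable_fun setT f -> measurable_fun setT (fun w => f (a i w)).
Proof. by move=> mf; exact: measurableT_comp. Qed.

Let sqnorm_pow u (k : nat) : sqnorm xf yf u ^+ k = norm u ^+ (2 * k).
Proof. by rewrite exprM sqr_sqrtr. Qed.

Lemma L1_fourth_moment p i : 4 <= p -> L1 P (fun w => norm (a i w) `^ p) ->
  L1 P (fun w => sqnorm xf yf (a i w) ^+ 2).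
Proof.
move=> p4 Lp; apply: L1_le (L1D (L1_cst P 1) Lp).
  by apply: measurable_funX; exact: mcomp.
move=> w; rewrite ger0_norm ?exprn_ge0// sqnorm_pow.
set t := norm _; have t0 : 0 <= t by exact: sqrtr_ge0.
have [t1|/ltW t1] := lerP t 1.
  by rewrite (le_trans (exprn_ile1 _ _ _))// lerDl powR_ge0.
rewrite -powR_mulrn// (le_trans (ler_powR t1 p4))// lerDr//.
Qed.

(** By Markov's inequality the fourth moment beyond [tau] is at most
    [A / tau^delta], which is below [zeta / 2] for [tau = 4 (2 A / zeta) ^ (1 / delta)]. The
    truncated moment of order [4 + 4K] is at most [A tau^(4K - delta)] as soon as
    [delta <= 4K]. The power [tau^-4] of the small-ball probability produces
    the exponent [4 / delta]. *)
Lemma small_ball_moment (K : nat) (delta A : R) (sr si tr ti : 'I_n -> R) :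
  (0 < K)%N -> 0 < delta -> delta <= (4 * K)%:R -> 1 <= A ->
  (forall i, L1 P (fun w => norm (a i w) `^ (4 + delta))) ->
  (forall i, Ex P (fun w => norm (a i w) `^ (4 + delta)) <= A) ->
  2^-1 <= \sum_i (sr i ^+ 2 + si i ^+ 2) <= 2 ->
  2^-1 <= \sum_i (tr i ^+ 2 + ti i ^+ 2) <= 2 ->
  `|\sum_i (si i * tr i - sr i * ti i)| <= 4^-1 ->
  small_ball_const R K / 256 * (zeta * (zeta / (2 * A)) `^ (4 / delta)) <=
  fine (P [set w | zeta / 256 <= herm_xy sr si tr ti w ^+ 2]).
Proof.
move=> K0 d0 dK A1 LA EA s1 t1 im1.
have A0 : 0 < A by exact: lt_le_trans A1.
pose B := 2 * A / zeta.
have B1 : 1 <= B by rewrite /B ler_pdivlMr// mul1r; have := zeta1; lra.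
have B0 : 0 < B by exact: lt_le_trans B1.
pose tau := 4 * B `^ delta^-1.
have Bd1 : 1 <= B `^ delta^-1.
  by rewrite -[leLHS](powRr0 B) ler_powR// invr_ge0 ltW.
have tau4 : 4 <= tau by rewrite /tau; lra.
have tau0 : 0 < tau by lra.
have taud : B <= tau `^ delta.
  rewrite /tau powRM ?powR_ge0// -powRrM mulVf ?gt_eqF// powRr1 ?(ltW B0)//.
  by rewrite ler_peMl ?(ltW B0)// -[leLHS](powRr0 4) ler_powR ?ltW//; lra.
have Atau : A / tau `^ delta <= zeta / 2.
  rewrite ler_pdivrMr ?powR_gt0//; apply: (@le_trans _ _ (zeta / 2 * B)).
    by apply: eq_ler; rewrite /B; field; rewrite gt_eqF.
  by rewrite ler_wpM2l// divr_ge0// ltW.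
have tauK : 1 <= zeta * tau ^+ (4 * K).
  apply: (@le_trans _ _ (zeta * B)).
    by rewrite /B mulrC divfK ?gt_eqF//; lra.
  rewrite ler_wpM2l ?(ltW zeta0)//; apply: (le_trans taud).
  rewrite -powR_mulrn ?(ltW tau0)// ler_powR//; lra.
have p0 : 0 < 4 + delta by lra.
have split4 k : (4 <= k)%N -> tau ^+ k / tau `^ (4 + delta) = tau ^+ (k - 4) / tau `^ delta.
  move=> k4; rewrite powRD; last by rewrite (gt_eqF tau0) implybT.
  rewrite -(subnK k4) exprD addnK (powR_mulrn 4 (ltW tau0)).
  by field; rewrite !gt_eqF// ?exprn_gt0 ?powR_gt0.
have pK : 4 + delta <= (2 * K.+1.*2)%:R.
  rewrite double_double_succ.
  by rewrite natrD lerD2l.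
have bigp i : Ex P (fun w => sqnorm xf yf (a i w) ^+ 2 * (1 - small xf yf tau (a i w))) <= zeta / 2.
  apply: (@le_trans _ _ (Ex P (fun w => (tau `^ delta)^-1 * norm (a i w) `^ (4 + delta)))).
    apply: Ex_le.
    - apply: L1_le (L1_fourth_moment _ (LA i)); [|move=> w|by lra].
        apply: measurable_funM; first by apply: measurable_funX; exact: mcomp.
        by apply: measurable_funB => //; exact: (mcomp i (msmall tau)).
      rewrite /small; case: ifP => _; rewrite ?subrr ?subr0 ?mulr0 ?mulr1 ?normr0 ?sqr_ge0//.
      by rewrite ger0_norm ?sqr_ge0.
    - by apply: L1Z.
    - move=> w; rewrite /small; case: (lerP (sqnorm xf yf (a i w)) (tau ^+ 2)) => H.
        by rewrite subrr mulr0 mulr_ge0 ?invr_ge0 ?powR_ge0.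
      rewrite subr0 mulr1 sqnorm_pow.
      have tn : tau <= norm (a i w).
        by rewrite -[tau]ger0_norm ?(ltW tau0)// -sqrtr_sqr ler_wsqrtr// ltW.
      apply: le_trans (natpow_ge_powR tau0 tn (_ : (2 * 2)%:R <= 4 + delta)) _; first by lra.
      by rewrite split4// subnn expr0 mul1r mulrC.
  rewrite ExZ//; apply: le_trans Atau; rewrite mulrC ler_wpM2r ?invr_ge0 ?powR_ge0//; exact: EA.
have smallp i : Ex P (fun w => sqnorm xf yf (a i w) ^+ K.+1.*2 * small xf yf tau (a i w)) <=
    zeta / 2 * tau ^+ (4 * K).
  have pt w : sqnorm xf yf (a i w) ^+ K.+1.*2 * small xf yf tau (a i w) <=
      (tau ^+ (4 * K) / tau `^ delta) * norm (a i w) `^ (4 + delta).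
    rewrite /small; case: (lerP (sqnorm xf yf (a i w)) (tau ^+ 2)) => H; last first.
      by rewrite mulr0 !mulr_ge0 ?invr_ge0 ?powR_ge0// exprn_ge0// ltW.
    rewrite mulr1 sqnorm_pow.
    have tn : norm (a i w) <= tau.
      by rewrite -[leRHS]ger0_norm ?(ltW tau0)// -sqrtr_sqr ler_wsqrtr.
    apply: le_trans (natpow_le_powR (sqrtr_ge0 _) tau0 tn pK p0) _.
    by rewrite double_double_succ split4 ?leq_addr// addKn mulrC.
  have LR : L1 P (fun w => (tau ^+ (4 * K) / tau `^ delta) * norm (a i w) `^ (4 + delta)) by exact: L1Z.
  apply: (@le_trans _ _ (Ex P (fun w => (tau ^+ (4 * K) / tau `^ delta) * norm (a i w) `^ (4 + delta)))).
    apply: Ex_le => //; apply: L1_le LR.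
      by apply: measurable_funM; [apply: measurable_funX; exact: mcomp|exact: (mcomp i (msmall tau))].
    move=> w; rewrite ger0_norm//; rewrite /small; case: ifP => _; rewrite ?mulr1 ?mulr0//.
    by rewrite exprn_ge0.
  rewrite ExZ// -mulrA [leRHS]mulrC ler_wpM2l ?exprn_ge0 ?(ltW tau0)//.
  by apply: le_trans Atau; rewrite mulrC ler_wpM2r ?invr_ge0 ?powR_ge0//; exact: EA.
have L4 i : L1 P (fun w => sqnorm xf yf (a i w) ^+ 2) by apply: L1_fourth_moment (LA i); lra.
have := small_ball_truncated ma ind mx my L4 x0 y0 n1 n2 cov zeta0 gam0 zeta_gam
  bigp smallp (lexx _) tau4 K0 tauK s1 t1 im1.
apply: le_trans.
have -> : tau ^+ 4 = 256 * B `^ (4 / delta).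
  rewrite /tau exprMn -[X in _ * X]powR_mulrn ?powR_ge0// -powRrM.
  by congr (_ * _); [ring|congr powR; rewrite mulrC].
have -> : (zeta / (2 * A)) `^ (4 / delta) = (B `^ (4 / delta))^-1.
  have -> : zeta / (2 * A) = B^-1 by rewrite /B invf_div.
  by rewrite -powR_inv1 ?(ltW B0)// -powRrM mulN1r powRN.
apply: eq_ler; field.
by rewrite gt_eqF// powR_gt0.
Qed.

End SmallBallMoment.

(** * Small-ball probability in terms of the moment parameters *)

(** The number [K] of [small_ball_moment] has to satisfy [delta <= 4K]. *)
Definition moment_index (R : realType) (delta : R) : nat := `|Num.ceil delta|%N.

Definition local_const (R : realType) (delta : R) : R :=
  small_ball_const R (moment_index delta) / 256 * 2^-1 `^ (4 / delta).

Definition global_const (R : realType) : R := small_ball_const R 1 / 1024.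

(** The form in which [gconst] arises from [small_ball_moment]. *)
Lemma gconstE (R : realType) (delta al ze : R) : 0 < delta -> 0 < al -> 0 < ze ->
  gconst delta al ze = ze * (ze / al) `^ (4 / delta).
Proof.
move=> d0 a0 z0; rewrite /gconst powRD; last by rewrite (gt_eqF z0) implybT.
rewrite (powRr1 (ltW z0)) powRM ?invr_ge0 ?(ltW z0) ?(ltW a0)//.
by rewrite -(powR_inv1 (ltW a0)) -powRrM mulN1r powRN [_ * ze]mulrC mulrA.
Qed.

Lemma exponent_le (R : realType) (delta : R) : 0 < delta ->
  (4 + delta)^-1 * 8%:R <= 4 / delta * 2%:R.
Proof.
move=> d0; rewrite -[leRHS]mulrA [_^-1 * 2]mulrC mulrA (_ : 4 * 2 = 8%:R :> R); last by rewrite -natrM.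
by rewrite mulrC ler_wpM2l// lef_pV2 ?posrE ?lerDr// addr_gt0.
Qed.

Lemma global_const_arith (R : realType) (c z L : R) : 0 < L ->
  c / 256 * (z * (z / (2 * (2 * L)))) = c / 1024 * (z ^+ 2 / L).
Proof. by move=> L0; field; rewrite gt_eqF. Qed.

Section SmallBallMax.
Context {d d' : measure_display} {T : measurableType d} {U : measurableType d'}.
Context {R : realType}.
Variables (P : probability T R) (n : nat) (a : 'I_n -> T -> U).
Hypothesis ma : forall i, measurable_fun setT (a i).
Hypothesis ind : mutually_independent P a.
Variables (xf yf : U -> R).
Hypothesis mx : measurable_fun setT xf.
Hypothesis my : measurable_fun setT yf.
Local Notation norm u := (Num.sqrt (sqnorm xf yf u)).
Hypothesis x0 : forall i, Ex P (xf \o a i) = 0.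
Hypothesis y0 : forall i, Ex P (yf \o a i) = 0.
Hypothesis n1 : forall i, Ex P (sqnorm xf yf \o a i) = 1.
Hypothesis npos : (0 < n)%N.
Variables (zeta gam delta al : R).
Hypothesis n2 : forall i, 1 + zeta <= Ex P (fun w => sqnorm xf yf (a i w) ^+ 2).
Hypothesis cov : forall i,
  (Ex P (fun w => xf (a i w) ^+ 2) - Ex P (fun w => yf (a i w) ^+ 2)) ^+ 2 +
  4 * Ex P (fun w => xf (a i w) * yf (a i w)) ^+ 2 <= gam ^+ 2.
Hypothesis zeta0 : 0 < zeta.
Hypothesis gam0 : 0 <= gam.
Hypothesis zeta_gam : zeta <= 1 - gam ^+ 2.
Hypothesis d0 : 0 < delta.
Hypothesis LA : forall i, L1 P (fun w => norm (a i w) `^ (4 + delta)).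
Hypothesis EA : forall i, Ex P (fun w => norm (a i w) `^ (4 + delta)) <= al.

Let g := gconst delta al zeta.

Let N0 u : 0 <= sqnorm xf yf u.
Proof. by rewrite addr_ge0 ?sqr_ge0. Qed.

Let mnorm i : measurable_fun setT (fun w => norm (a i w)).
Proof.
rewrite (_ : (fun w => _) = fun w => sqnorm xf yf (a i w) `^ 2^-1); last first.
  by apply/funext => w; rewrite powR12_sqrt.
apply: (measurableT_comp (measurable_powR _)).
by apply: measurableT_comp (ma i); apply: measurable_funD; exact: measurable_funX.
Qed.

Lemma zeta_le1 : zeta <= 1.
Proof. by move: zeta_gam; have := sqr_ge0 gam; lra. Qed.

(** The moment of order [4 + delta] exceeds 1 by at least as much as the fourth
    one: Bernoulli's inequality for [|a|^2] with exponent [1 + delta / 2]. It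
    follows that [zeta / al <= 1/2], which lets [g] itself absorb the loss
    [2 ^ (- 4 / delta)] in [small_ball_global]. *)
Lemma one_plus_zeta_le_moment : 1 + zeta <= al.
Proof.
pose i := Ordinal npos; apply: le_trans (EA i).
have L4 : L1 P (fun w => sqnorm xf yf (a i w) ^+ 2).
  by apply: (L1_fourth_moment ma mx my _ (LA i)); move: d0; lra.
have L2N : L2 P (fun w => sqnorm xf yf (a i w)).
  by split=> //; apply: measurableT_comp (ma i); apply: measurable_funD; exact: measurable_funX.
have LN := L2_L1 L2N.
pose k := delta / 2; have k0 : 0 < k by rewrite divr_gt0.
apply: (@le_trans _ _ (Ex P (fun w => (1 + k) * sqnorm xf yf (a i w) ^+ 2 - k * sqnorm xf yf (a i w)))).
  rewrite ExB; [|exact: L1Z|exact: L1Z].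
  rewrite !ExZ// [Ex P (fun w => sqnorm _ _ _)]n1 mulr1.
  have := n2 i; move: (Ex _ _) => e He; move: zeta0; nra.
apply: Ex_le => //; first by apply: L1B; exact: L1Z.
move=> w; set s := sqnorm xf yf (a i w); have s0 : 0 <= s by exact: N0.
have -> : Num.sqrt s `^ (4 + delta) = s * s `^ (1 + k).
  rewrite -powR12_sqrt// -powRrM -{2}[s]powRr1// -powRD; first by congr powR; rewrite /k; field.
  by rewrite (_ : (1 + (1 + k) == 0) = false)//; apply/eqP; lra.
have k1 : 1 <= 1 + k by lra.
have B := ler_wpM2l s0 (bernoulli_powR s0 k1); apply: le_trans B.
by apply: eq_ler; ring.
Qed.

Let al0 : 0 < al. Proof. by have := one_plus_zeta_le_moment; move: zeta0; lra. Qed.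

Let ratio_half : zeta / al <= 2^-1.
Proof. by rewrite ler_pdivrMr//; have := one_plus_zeta_le_moment; have := zeta_le1; lra. Qed.

Let ratio0 : 0 < zeta / al. Proof. exact: divr_gt0. Qed.

Let gE : g = zeta * (zeta / al) `^ (4 / delta). Proof. exact: gconstE. Qed.

Let e0 : 0 < 4 / delta. Proof. by rewrite divr_gt0. Qed.

Lemma gconst_gt0 : 0 < g.
Proof. by rewrite gE mulr_gt0// powR_gt0. Qed.

Let ratio_pow_half : (zeta / al) `^ (4 / delta) <= 2^-1 `^ (4 / delta).
Proof. by rewrite ge0_ler_powR// ?nnegrE ?ltW// invr_gt0. Qed.

Let half_pow1 : 2^-1 `^ (4 / delta) <= 1 :> R.
Proof.
apply: (@le_trans _ _ (1 `^ (4 / delta))); last by rewrite powR1.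
by rewrite ge0_ler_powR// ?nnegrE ?(ltW e0) ?invr_ge0 ?invf_le1//; lra.
Qed.

Lemma gconst_le_zeta : g <= zeta.
Proof.
by rewrite gE ler_piMr ?(ltW zeta0)// (le_trans ratio_pow_half).
Qed.

Lemma local_const01 : 0 < local_const delta <= 1.
Proof.
have /andP[c0 c1] := small_ball_const01 R (moment_index delta).
have h0 : 0 < 2^-1 `^ (4 / delta) :> R by rewrite powR_gt0// invr_gt0.
apply/andP; split; first by rewrite /local_const; apply: (mulr_gt0 _ h0); rewrite (pmulr_rgt0 _ c0) invr_gt0 ltr0n.
have c01 : small_ball_const R (moment_index delta) / 256 <= 1 by lra.
have c00 : 0 <= small_ball_const R (moment_index delta) / 256.
  by apply: mulr_ge0; [exact: ltW|rewrite invr_ge0 ler0n].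
by rewrite /local_const; apply: mulr_ile1 => //; exact: powR_ge0.
Qed.

Variables sr si tr ti : 'I_n -> R.
Hypothesis s_norm : 2^-1 <= \sum_i (sr i ^+ 2 + si i ^+ 2) <= 2.
Hypothesis t_norm : 2^-1 <= \sum_i (tr i ^+ 2 + ti i ^+ 2) <= 2.
Hypothesis im_small : `|\sum_i (si i * tr i - sr i * ti i)| <= 4^-1.

Let prob := fine (P [set w | zeta / 256 <= herm a sr si tr ti (fun=> xf) (fun=> yf) w ^+ 2]).

Let half_ratio_pow : (zeta / (2 * al)) `^ (4 / delta) =
  (zeta / al) `^ (4 / delta) * 2^-1 `^ (4 / delta).
Proof.
rewrite (_ : zeta / (2 * al) = zeta / al * 2^-1); last by rewrite invfM mulrA mulrAC.
by rewrite powRM ?(ltW ratio0) ?invr_ge0 ?ler0n.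
Qed.

(** Linear in [g], with a constant that depends on [delta] through the number of
    moments of the truncated form; this rate governs the lower bound. *)
Lemma small_ball_local : local_const delta * g <= prob.
Proof.
have K0 : (0 < moment_index delta)%N by rewrite absz_gt0 gt_eqF// ceil_gt0.
have dK : delta <= (4 * moment_index delta)%:R.
  have /andP[_ c] := ceil_itv delta.
  have E : (moment_index delta)%:R = (Num.ceil delta)%:~R :> R.
    by rewrite /moment_index natr_absz gtr0_norm// ceil_gt0.
  rewrite natrM E; have := d0; lra.
have A1 : 1 <= al by have := one_plus_zeta_le_moment; move: zeta0; lra.
have := small_ball_moment ma ind mx my x0 y0 n1 n2 cov zeta0 gam0 zeta_gam K0 d0 dK A1 LA EA
  s_norm t_norm im_small.
apply: le_trans; rewrite gE /local_const.
rewrite half_ratio_pow.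
apply: eq_ler; ring.
Qed.

(** Quadratic in [g], with a universal constant; this rate governs the
    probability. For [delta <= 4] take [K = 1] and bound [2 ^ (- 4 / delta)] below by
    [g]. For [delta > 4] use eighth moments instead: splitting at
    [lam = al ^ (1 / (4 + delta))], they are at most [2 lam^8], and
    [al ^ (8 / (4 + delta)) <= al ^ (8 / delta)]. *)
Lemma small_ball_global : global_const R * g ^+ 2 <= prob.
Proof.
have /andP[c0 c1] := small_ball_const01 R 1.
have A1 : 1 <= al by have := one_plus_zeta_le_moment; move: zeta0; lra.
have [d4|d4] := lerP delta 4.
  have dK : delta <= (4 * 1)%:R by rewrite muln1.
  have := small_ball_moment ma ind mx my x0 y0 n1 n2 cov zeta0 gam0 zeta_gam (ltn0Sn 0) d0 dK A1 LA EA
    s_norm t_norm im_small.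
  apply: le_trans.
  rewrite half_ratio_pow.
  rewrite (mulrA zeta) -gE /global_const.
  have H : g * g <= g * 2^-1 `^ (4 / delta).
    rewrite ler_pM2l ?gconst_gt0//; apply: le_trans ratio_pow_half.
    by rewrite gE ler_piMl ?powR_ge0// zeta_le1.
  have H0 : 0 <= g * 2^-1 `^ (4 / delta) by rewrite mulr_ge0 ?powR_ge0 ?(ltW gconst_gt0).
  rewrite -mulrA; have H1 := ler_wpM2l (ltW c0) H; have H2 := mulr_ge0 (ltW c0) H0.
  rewrite expr2; lra.
pose lam := al `^ (4 + delta)^-1.
have p0 : 0 < 4 + delta by move: d0; lra.
have lam1 : 1 <= lam by rewrite -[leLHS](powRr0 al) ler_powR// invr_ge0 ltW.
have lam0 : 0 < lam by lra.
have lamp : lam `^ (4 + delta) = al by rewrite /lam -powRrM mulVf ?gt_eqF// powRr1// ltW.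
have pt i w : norm (a i w) `^ (4 + 4) <= lam ^+ 8 + norm (a i w) `^ (4 + delta) * (lam ^+ 8 / al).
  have -> : norm (a i w) `^ (4 + 4) = norm (a i w) ^+ 8.
    by rewrite -natrD powR_mulrn// sqrtr_ge0.
  have [le|ge] := lerP (norm (a i w)) lam.
    apply: (@le_trans _ _ (lam ^+ 8)); first by rewrite lerXn2r ?nnegrE ?sqrtr_ge0// ltW.
    by rewrite lerDl mulr_ge0 ?powR_ge0// divr_ge0 ?exprn_ge0 ?ltW.
  rewrite -lamp; apply: le_trans (natpow_ge_powR lam0 (ltW ge) (_ : 8%:R <= 4 + delta)) _.
    by move: d4; lra.
  by rewrite lerDr exprn_ge0// ltW.
have LR i : L1 P (fun w => (lam ^+ 8 / al) * norm (a i w) `^ (4 + delta)) by exact: L1Z.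
have LR' i : L1 P (fun w => lam ^+ 8 + (lam ^+ 8 / al) * norm (a i w) `^ (4 + delta)).
  by apply: L1D => //; exact: L1_cst.
have LB i : L1 P (fun w => norm (a i w) `^ (4 + 4)).
  apply: L1_le (LR' i); first by apply: (measurableT_comp (measurable_powR _)); exact: mnorm.
  by move=> w; rewrite ger0_norm ?powR_ge0// mulrC; exact: pt.
have l8 : 1 <= lam ^+ 8 by exact: exprn_ege1.
have EB i : Ex P (fun w => norm (a i w) `^ (4 + 4)) <= 2 * lam ^+ 8.
  apply: (@le_trans _ _ (Ex P (fun w => lam ^+ 8 + (lam ^+ 8 / al) * norm (a i w) `^ (4 + delta)))).
    by apply: Ex_le => // w; rewrite mulrC; exact: pt.
  rewrite ExD//; last exact: L1_cst.
  rewrite Ex_cst ExZ// mulr_natl mulr2n lerD2l -mulrA ler_piMr ?(le_trans ler01 l8)//.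
  by rewrite mulrC ler_pdivrMr// mul1r.
have dK : (4 : R) <= (4 * 1)%:R by rewrite muln1.
have B1 : 1 <= 2 * lam ^+ 8 by lra.
have := small_ball_moment ma ind mx my x0 y0 n1 n2 cov zeta0 gam0 zeta_gam (ltn0Sn 0) (ltr0n R 4) dK B1 LB EB
    s_norm t_norm im_small.
apply: le_trans.
have l0 : 0 < lam ^+ 8 by lra.
rewrite mulfV// powRr1; last by rewrite divr_ge0 ?(ltW zeta0)// mulr_ge0 ?mulr_ge0// ltW.
have H : g ^+ 2 <= zeta ^+ 2 / lam ^+ 8.
  rewrite gE exprMn ler_wpM2l ?sqr_ge0//.
  apply: (@le_trans _ _ ((al^-1 `^ (4 / delta)) ^+ 2)).
    rewrite lerXn2r ?nnegrE ?powR_ge0// ge0_ler_powR// ?nnegrE ?(ltW e0) ?(ltW ratio0) ?invr_ge0 ?(ltW al0)//.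
    by rewrite ler_piMl ?invr_ge0 ?(ltW al0)// zeta_le1.
  rewrite -powR_inv1 ?(ltW al0)// -powRrM mulN1r powRN exprVn lef_pV2 ?posrE ?exprn_gt0 ?powR_gt0//.
  rewrite /lam -(powR_mulrn 8 (powR_ge0 _ _)) -(powR_mulrn 2 (powR_ge0 _ _)) -!powRrM.
  apply: ler_powR; first exact: A1.
  exact: exponent_le.
rewrite global_const_arith//; apply: ler_wpM2l H.
by rewrite /global_const; apply: mulr_ge0; [exact: ltW|rewrite invr_ge0 ler0n].
Qed.

End SmallBallMax.

(** * Counting and the phaseless map *)

(** If a fraction [th] of the entries is at least [c], the norm is at least
    [c * (th * m) ^ (1 / q)], and [th ^ (1 / q) >= th] for [q >= 1]. *)
Lemma lnorm_ge_of_count (R : realType) m (q th c : R) (v : 'I_m -> R) : 1 <= q -> 0 <= th <= 1 -> 0 <= c ->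
  th * m%:R <= (#|[set k | c <= `|v k|]%SET|)%:R ->
  th * c * m%:R `^ (1 / q) <= lnorm q v.
Proof.
move=> q1 /andP[th0 th1] c0 H; have q0 : 0 < q by exact: lt_le_trans q1.
have qi0 : 0 <= q^-1 by rewrite invr_ge0 ltW.
apply: (@le_trans _ _ ((th * m%:R * c `^ q) `^ q^-1)).
  rewrite !powRM ?mulr_ge0 ?powR_ge0// -powRrM mulfV ?gt_eqF// powRr1// div1r.
  rewrite -[leLHS]mulrA [c * _]mulrC [leLHS]mulrA ler_wpM2r// ler_wpM2r ?powR_ge0//.
  have [->|tn0] := eqVneq th 0; first exact: powR_ge0.
  have tp : 0 < th by rewrite lt_neqAle eq_sym tn0.
  have th01 : 0 < th <= 1 by rewrite tp.
  by rewrite -{1}[th]powRr1// ger_powR// invf_le1.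
rewrite /lnorm ge0_ler_powR ?nnegrE ?mulr_ge0 ?powR_ge0//; first by apply: sumr_ge0 => i _; exact: powR_ge0.
apply: (@le_trans _ _ ((#|[set k | c <= `|v k|]%SET|)%:R * c `^ q)).
  by rewrite ler_wpM2r ?powR_ge0.
rewrite mulr_natl -sumr_const big_mkcond /=; apply: ler_sum => k _.
rewrite finset.in_set; case: ifP => [h|_]; last exact: powR_ge0.
by rewrite ge0_ler_powR ?nnegrE ?(ltW q0).
Qed.

Section ComplexGeometry.
Variable R : realType.
Local Notation Re := (@complex.Re R).
Local Notation Im := (@complex.Im R).
Local Notation reC := (@complex.Re R : borelC R -> R).
Local Notation imC := (@complex.Im R : borelC R -> R).

Lemma modulus_sqr (z : R[i]) : modulus z ^+ 2 = Re z ^+ 2 + Im z ^+ 2.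
Proof. by case: z => x y /=; rewrite sqr_sqrtr// addr_ge0 ?sqr_ge0. Qed.

Lemma modulus_ge0 (z : R[i]) : 0 <= modulus z.
Proof. by case: z => x y; exact: sqrtr_ge0. Qed.

Lemma modulusE (z : R[i]) : modulus z = Num.sqrt (sqnorm reC imC (z : borelC R)).
Proof. by case: z. Qed.

Lemma ReD (z w : R[i]) : Re (z + w) = Re z + Re w.
Proof. by case: z; case: w. Qed.
Lemma ImD (z w : R[i]) : Im (z + w) = Im z + Im w.
Proof. by case: z; case: w. Qed.
Lemma ReB (z w : R[i]) : Re (z - w) = Re z - Re w.
Proof. by case: z; case: w. Qed.
Lemma ImB (z w : R[i]) : Im (z - w) = Im z - Im w.
Proof. by case: z; case: w. Qed.
Lemma ReM (z w : R[i]) : Re (z * w) = Re z * Re w - Im z * Im w.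
Proof. by case: z; case: w. Qed.
Lemma ImM (z w : R[i]) : Im (z * w) = Re z * Im w + Im z * Re w.
Proof. by case: z => a b; case: w => c e. Qed.
Lemma Re_sum (I : Type) (r : seq I) (F : I -> R[i]) : Re (\sum_(i <- r) F i) = \sum_(i <- r) Re (F i).
Proof. by elim: r => [|i r IH]; rewrite ?big_nil// !big_cons ReD IH. Qed.
Lemma Im_sum (I : Type) (r : seq I) (F : I -> R[i]) : Im (\sum_(i <- r) F i) = \sum_(i <- r) Im (F i).
Proof. by elim: r => [|i r IH]; rewrite ?big_nil// !big_cons ImD IH. Qed.

Lemma exists_aligning_phase (u v : R) : exists t : R,
  [/\ 0 <= t < 2 * pi, 0 <= cos t * u - sin t * v & cos t * v + sin t * u = 0].
Proof.
have pi0 := pi_gt0 R.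
have [r0|r0] := eqVneq (u ^+ 2 + v ^+ 2) 0.
  have /andP[/eqP u0 /eqP v0] : (u == 0) && (v == 0).
    by move/eqP: r0; rewrite paddr_eq0 ?sqr_ge0// !sqrf_eq0.
  by exists 0; rewrite u0 v0 !mulr0 subrr addr0 !lexx; split=> //; rewrite mulr_gt0.
have rp : 0 < u ^+ 2 + v ^+ 2 by rewrite lt_neqAle eq_sym r0 addr_ge0 ?sqr_ge0.
pose r := Num.sqrt (u ^+ 2 + v ^+ 2).
have rr : 0 < r by rewrite sqrtr_gt0.
have r2 : r ^+ 2 = u ^+ 2 + v ^+ 2 by rewrite sqr_sqrtr// ltW.
pose c := u / r; pose s := - v / r.
have cs : c ^+ 2 + s ^+ 2 = 1.
  by rewrite /c /s !exprMn sqrrN exprVn -mulrDl -r2 mulfV// gt_eqF ?exprn_gt0.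
have c1 : -1 <= c <= 1.
  by rewrite -ler_norml -ler_sqr ?nnegrE// real_normK ?num_real// expr1n; have := sqr_ge0 s; lra.
have [t [t02 ct st]] : exists t, [/\ 0 <= t < 2 * pi, cos t = c & sin t = s].
  have [A0 Ac] := acos_def c1; have As := sin_acos c1; move/andP: A0 => [A0 Api].
  have ss : Num.sqrt (1 - c ^+ 2) = `|s| by rewrite -cs addrC addKr sqrtr_sqr.
  have [s0|s0] := lerP 0 s.
    exists (acos c); split=> //; last by rewrite As ss ger0_norm.
    by rewrite A0 /=; lra.
  have Ap : 0 < acos c.
    rewrite lt_neqAle A0 andbT; apply/eqP => A00.
    by move: As; rewrite -A00 sin0 ss ltr0_norm//; lra.
  exists (2 * pi - acos c); split.
  - by apply/andP; split; lra.
  - by rewrite cosB mulr_natl cos2pi sin2pi mul1r mul0r addr0.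
  - by rewrite sinB mulr_natl cos2pi sin2pi mul0r mul1r sub0r As ss ltr0_norm// opprK.
exists t; rewrite ct st /c /s; split=> //.
  rewrite (_ : _ - _ = (u ^+ 2 + v ^+ 2) / r); last by field; rewrite gt_eqF.
  by rewrite divr_ge0 ?ltW.
by field; rewrite gt_eqF.
Qed.

Variable n : nat.
Implicit Types x y : 'cV[R[i]]_n.

Definition coord (i : 'I_n) (v : borelCn R n) : borelC R := v i ord0.

Definition coords x (j : 'I_n * bool) : R := if j.2 then Re (x j.1 ord0) else Im (x j.1 ord0).

Lemma Re_cdot (v : borelCn R n) x : Re (cdot v x) = re_form coord reC imC (coords x) v.
Proof.
rewrite /cdot Re_sum /re_form sum_pair_bool; apply: eq_bigr => i _.
by rewrite ReM /coords /re_coef /coord /=; case: (v i ord0) => p q; case: (x i ord0) => c e /=; ring.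
Qed.

Lemma Im_cdot (v : borelCn R n) x : Im (cdot v x) = im_form coord reC imC (coords x) v.
Proof.
rewrite /cdot Im_sum /im_form sum_pair_bool; apply: eq_bigr => i _.
by rewrite ImM /coords /im_coef /coord /=; case: (v i ord0) => p q; case: (x i ord0) => c e /=; ring.
Qed.

Lemma phaselessE m (b : 'I_m -> borelCn R n) x k :
  phaseless b x k = sq_form coord reC imC (coords x) (b k).
Proof. by rewrite /phaseless modulus_sqr Re_cdot Im_cdot. Qed.

Lemma phaseless_phase m (b : 'I_m -> borelCn R n) x k t :
  phaseless b (expi t *: x) k = phaseless b x k.
Proof.
rewrite /phaseless !modulus_sqr.
have -> : cdot (b k) (expi t *: x) = expi t * cdot (b k) x.
  by rewrite /cdot mulr_sumr; apply: eq_bigr => i _; rewrite mxE mulrCA.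
rewrite ReM ImM /expi /=; set p := Re _; set q := Im _.
rewrite (_ : _ + _ = (cos t ^+ 2 + sin t ^+ 2) * (p ^+ 2 + q ^+ 2)); last by ring.
by rewrite cos2Dsin2 mul1r.
Qed.

Lemma l2normE x : l2norm x = Num.sqrt (sq_norm (coords x)).
Proof.
rewrite /l2norm /lnorm /sq_norm sum_pair_bool powR12_sqrt; last first.
  by apply: sumr_ge0 => i _; exact: powR_ge0.
congr Num.sqrt; apply: eq_bigr => i _.
by rewrite -[2]/(2%:R) powR_mulrn// real_normK ?num_real// modulus_sqr.
Qed.

Lemma dist_sqr_le x y t : 0 <= t < 2 * pi ->
  dist x y ^+ 2 <= sq_norm (coords (expi t *: x - y)).
Proof.
move=> t02; set S := [set l2norm (expi u *: x - y) | u in [set u : R | 0 <= u < 2 * pi]].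
have lb0 : lbound S 0 by move=> _ [u _ <-]; rewrite l2normE sqrtr_ge0.
have St : S (l2norm (expi t *: x - y)) by exists t.
have d0 : 0 <= dist x y by apply: lb_le_inf => //; exists (l2norm (expi t *: x - y)).
have dle : dist x y <= l2norm (expi t *: x - y) by apply: ge_inf => //; exists 0.
have n0 : 0 <= sq_norm (coords (expi t *: x - y)) by apply: sumr_ge0 => j _; exact: sqr_ge0.
rewrite -[leRHS](sqr_sqrtr n0) -l2normE lerXn2r ?nnegrE//; exact: le_trans dle.
Qed.

(** Rotate [x] to [w] so that [<w, y>] is a nonnegative real number, and set
    [s = w + y], [t = w - y]: polarization gives the product form, [Im <s, t>] is
    twice the imaginary part of [<w, y>] up to sign, and [|s|^2 - |t|^2] is four
    times its real part. *)
Lemma phaseless_factorization x y : exists s t : 'I_n * bool -> R,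
  [/\ im_inner s t = 0, dist x y ^+ 2 <= sq_norm t, sq_norm t <= sq_norm s &
   forall m (b : 'I_m -> borelCn R n) k,
     phaseless b x k - phaseless b y k = prod_form coord reC imC s t (b k)].
Proof.
pose u := \sum_i (Re (x i ord0) * Re (y i ord0) + Im (x i ord0) * Im (y i ord0)).
pose v := \sum_i (Im (x i ord0) * Re (y i ord0) - Re (x i ord0) * Im (y i ord0)).
have [t [t02 re0 im0]] := exists_aligning_phase u v.
pose w := expi t *: x.
have wre i : Re (w i ord0) = cos t * Re (x i ord0) - sin t * Im (x i ord0).
  by rewrite mxE ReM.
have wim i : Im (w i ord0) = cos t * Im (x i ord0) + sin t * Re (x i ord0).
  by rewrite mxE ImM.
exists (fun j => coords w j + coords y j), (fun j => coords w j - coords y j); split.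
- have H : - 2 * (cos t * v + sin t * u) = 0 by rewrite im0 mulr0.
  rewrite -[RHS]H /im_inner /u /v !mulr_sumr -big_split mulr_sumr /=.
  by apply: eq_bigr => i _; rewrite /coords /= wre wim; ring.
- apply: le_trans (dist_sqr_le x y t02) _; apply: eq_ler.
  apply: eq_bigr => -[i b] _; rewrite /coords /=.
  have -> : (expi t *: x - y) i ord0 = w i ord0 - y i ord0 by rewrite !mxE.
  by case: b; rewrite ?ReB ?ImB.
- rewrite -subr_ge0 /sq_norm -sumrB.
  have -> : \sum_j ((coords w j + coords y j) ^+ 2 - (coords w j - coords y j) ^+ 2) =
      4 * (cos t * u - sin t * v); last by rewrite mulr_ge0.
  rewrite sum_pair_bool /u /v !mulr_sumr -sumrB mulr_sumr; apply: eq_bigr => i _.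
  by rewrite /coords /= wre wim; ring.
- move=> m b k; rewrite -(phaseless_phase b x k t) -/w !phaselessE.
  have lin (F : ('I_n * bool -> R) -> borelCn R n -> R) (c : borelCn R n -> 'I_n * bool -> R) :
     (forall s v, F s v = \sum_j s j * c v j) -> forall s s' v,
     F (fun j => s j + s' j) v = F s v + F s' v /\ F (fun j => s j - s' j) v = F s v - F s' v.
    move=> FE s s' v'; rewrite !FE -big_split -sumrB /=; split; apply: eq_bigr => j _; ring.
  have [r1 r2] := lin (re_form coord reC imC) (re_coef coord reC imC) (fun _ _ => erefl) (coords w) (coords y) (b k).
  have [i1 i2] := lin (im_form coord reC imC) (im_coef coord reC imC) (fun _ _ => erefl) (coords w) (coords y) (b k).
  by rewrite /prod_form r1 r2 i1 i2 /sq_form; ring.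
Qed.

End ComplexGeometry.

(** * Moments of the complex entries *)

Section ComplexEntries.
Context {d0 : measure_display} {T0 : measurableType d0} {R : realType}.
Variables (P0 : probability T0 R) (n : nat) (a : {mfun T0 >-> borelCn R n}).
Local Notation reC := (@complex.Re R : borelC R -> R).
Local Notation imC := (@complex.Im R : borelC R -> R).
Local Notation ent := (fun i w => coord i (a w)).
Local Notation norm u := (Num.sqrt (sqnorm reC imC u)).

Lemma measurable_entries i : measurable_fun setT (ent i).
Proof.
have mc : measurable_fun setT (coord i : borelCn R n -> borelC R) by exact: measurable_entry.
exact: (measurableT_comp mc (measurable_funPT a)).
Qed.

Lemma Ex_expectation (f : T0 -> R) : Ex P0 f = fine 'E_P0[f]%E.
Proof. by rewrite unlock. Qed.

Lemma L1_of_finite_expectation (f : T0 -> R) : measurable_fun setT f -> (forall w, 0 <= f w) ->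
  ('E_P0[f] < +oo)%E -> L1 P0 f.
Proof.
move=> mf f0; rewrite unlock => fin; apply/integrableP; split; first exact/measurable_EFinP.
apply: le_lt_trans fin; rewrite le_eqVlt; apply/orP; left; apply/eqP.
by apply: eq_integral => w _ /=; rewrite ger0_norm.
Qed.

Lemma expectationE (f : T0 -> R) : L1 P0 f -> 'E_P0[f]%E = (Ex P0 f)%:E.
Proof. by move=> Lf; rewrite unlock -Ex_EFin. Qed.

Let mre i : measurable_fun setT (fun w => reC (ent i w)).
Proof. exact: (measurableT_comp (@measurable_Re R) (measurable_entries i)). Qed.

Let mim i : measurable_fun setT (fun w => imC (ent i w)).
Proof. exact: (measurableT_comp (@measurable_Im R) (measurable_entries i)). Qed.

Let msq i : measurable_fun setT (fun w => sqnorm reC imC (ent i w)).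
Proof. by apply: measurable_funD; exact: measurable_funX. Qed.

Lemma modulus_entry i w : modulus (entry a i w) = norm (ent i w).
Proof. exact: modulusE. Qed.

Let sq0 (u : borelC R) : 0 <= sqnorm reC imC u.
Proof. by rewrite addr_ge0 ?sqr_ge0. Qed.

Let sqE i : (fun w => modulus (entry a i w) ^+ 2) = fun w => sqnorm reC imC (ent i w).
Proof. by apply/funext => w; rewrite modulus_entry sqr_sqrtr. Qed.

Let powE i p : (fun w => modulus (entry a i w) `^ p) = fun w => norm (ent i w) `^ p.
Proof. by apply/funext => w; rewrite modulus_entry. Qed.

Hypothesis mean0 : forall i, Cexpectation P0 (entry a i) = 0.
Hypothesis var1 : forall i, ('E_P0[fun w => (modulus (entry a i w) ^+ 2)%R] = 1)%E.

Lemma mean_re i : Ex P0 (reC \o ent i) = 0.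
Proof. by rewrite Ex_expectation; case: (mean0 i). Qed.

Lemma mean_im i : Ex P0 (imC \o ent i) = 0.
Proof. by rewrite Ex_expectation; case: (mean0 i). Qed.

Lemma L1_sqnorm i : L1 P0 (fun w => sqnorm reC imC (ent i w)).
Proof.
by apply: L1_of_finite_expectation; [exact: msq|move=> w; exact: sq0|rewrite -sqE var1 ltry].
Qed.

Lemma mean_sqnorm i : Ex P0 (sqnorm reC imC \o ent i) = 1.
Proof. by rewrite Ex_expectation /comp -sqE var1. Qed.

Section Moments.
Variable p : R.
Hypothesis p4 : 4 <= p.
Hypothesis alpha_fin : (alpha P0 a p < +oo)%E.

Lemma expectation_le_alpha i : ('E_P0[fun w => (norm (ent i w) `^ p)%R] <= alpha P0 a p)%E.
Proof. rewrite -powE; exact: (le_bigmax _ (fun i => 'E_P0[fun w => (modulus (entry a i w) `^ p)%R])%E). Qed.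

Lemma L1_moment i : L1 P0 (fun w => norm (ent i w) `^ p).
Proof.
apply: L1_of_finite_expectation; last exact: le_lt_trans (expectation_le_alpha i) alpha_fin.
  rewrite -powE (_ : (fun w => _) = fun w => sqnorm reC imC (ent i w) `^ (2^-1 * p)).
    exact: (measurableT_comp (measurable_powR _)).
  by apply/funext => w; rewrite powRrM powR12_sqrt// modulus_entry.
by move=> w; exact: powR_ge0.
Qed.

Lemma moment_le_alpha i : Ex P0 (fun w => norm (ent i w) `^ p) <= fine (alpha P0 a p).
Proof.
have := expectation_le_alpha i; rewrite (expectationE (L1_moment i)) => H.
have fin : alpha P0 a p \is a fin_num by rewrite fin_numElt alpha_fin andbT (lt_le_trans _ H)// ltNyr.
by rewrite -lee_fin (fineK fin).
Qed.

Lemma beta_le_moment i : (1 < beta P0 a)%E ->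
  1 < fine (beta P0 a) <= Ex P0 (fun w => sqnorm reC imC (ent i w) ^+ 2).
Proof.
move=> b1.
have L4 : L1 P0 (fun w => sqnorm reC imC (ent i w) ^+ 2).
  exact: (L1_fourth_moment measurable_entries (@measurable_Re R) (@measurable_Im R) p4 (L1_moment i)).
have H : (beta P0 a <= (Ex P0 (fun w => sqnorm reC imC (ent i w) ^+ 2))%:E)%E.
  rewrite -expectationE//.
  rewrite (_ : (fun w => sqnorm _ _ _ ^+ 2) = fun w => modulus (entry a i w) ^+ 4); last first.
    by apply/funext => w; rewrite modulus_entry (exprM _ 2 2) sqr_sqrtr.
  exact: bigmin_le.
have bf : beta P0 a \is a fin_num.
  by rewrite fin_numElt (lt_trans _ b1) ?ltNyr//= (le_lt_trans H) ?ltry.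
by rewrite -lte_fin -lee_fin (fineK bf) b1 H.
Qed.
End Moments.

Lemma gamma_ge0 : 0 <= gamma P0 a.
Proof. exact: bigmax_ge_id. Qed.

(** [E a^2] has real part [E x^2 - E y^2] and imaginary part [2 E (x y)]. *)
Lemma covariance_le_gamma i :
  (Ex P0 (fun w => reC (ent i w) ^+ 2) - Ex P0 (fun w => imC (ent i w) ^+ 2)) ^+ 2 +
  4 * Ex P0 (fun w => reC (ent i w) * imC (ent i w)) ^+ 2 <= gamma P0 a ^+ 2.
Proof.
have Lx : L1 P0 (fun w => reC (ent i w) ^+ 2).
  apply: L1_le (L1_sqnorm i); first exact: measurable_funX.
  by move=> w; rewrite ger0_norm ?sqr_ge0// lerDl sqr_ge0.
have Ly : L1 P0 (fun w => imC (ent i w) ^+ 2).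
  apply: L1_le (L1_sqnorm i); first exact: measurable_funX.
  by move=> w; rewrite ger0_norm ?sqr_ge0// lerDr sqr_ge0.
have Lxy : L1 P0 (fun w => reC (ent i w) * imC (ent i w)).
  by apply: L2_mul; split.
have H : modulus (Cexpectation P0 (fun w => entry a i w ^+ 2)) <= gamma P0 a.
  exact: (le_bigmax _ (fun i => modulus (Cexpectation P0 (fun w => entry a i w ^+ 2)))).
have := lerXn2r 2 (modulus_ge0 _) gamma_ge0 H; rewrite modulus_sqr /=.
rewrite -!Ex_expectation.
rewrite (@Ex_ext _ _ _ P0 _ (fun w => reC (ent i w) ^+ 2 - imC (ent i w) ^+ 2)); last first.
  by move=> w; rewrite expr2 ReM -!expr2.
rewrite ExB//.
rewrite (@Ex_ext _ _ _ P0 (fun w => complex.Im _) (fun w => 2 * (reC (ent i w) * imC (ent i w)))); last first.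
  by move=> w; rewrite expr2 ImM /coord /entry; ring.
by rewrite ExZ// exprMn -natrX.
Qed.

End ComplexEntries.

(** * From separated directions to the phaseless map *)

Section Deterministic.
Variables (R : realType) (n m : nat) (b : 'I_m -> borelCn R n).
Local Notation reC := (@complex.Re R : borelC R -> R).
Local Notation imC := (@complex.Im R : borelC R -> R).

Lemma sq_normZ (c : R) (s : 'I_n * bool -> R) : sq_norm (fun j => c * s j) = c ^+ 2 * sq_norm s.
Proof. by rewrite /sq_norm mulr_sumr; apply: eq_bigr => j _; rewrite exprMn. Qed.

Lemma im_innerZ (c e : R) (s t : 'I_n * bool -> R) :
  im_inner (fun j => c * s j) (fun j => e * t j) = c * e * im_inner s t.
Proof. by rewrite /im_inner mulr_sumr; apply: eq_bigr => i _; ring. Qed.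

Lemma prod_formZ (c e : R) (s t : 'I_n * bool -> R) v :
  prod_form (@coord R n) reC imC (fun j => c * s j) (fun j => e * t j) v =
  c * e * prod_form (@coord R n) reC imC s t v.
Proof.
have lin (F : 'I_n * bool -> R) k u : \sum_j k * u j * F j = k * \sum_j u j * F j.
  by rewrite mulr_sumr; apply: eq_bigr => j _; rewrite mulrA.
by rewrite /prod_form /re_form /im_form !lin; ring.
Qed.

(** The product form is bilinear in the pair [s, t] of the factorization, which
    can be normalized unless [t = 0]; its modulus is then at least
    [sqrt zeta / 32 * |s| |t| >= sqrt zeta / 32 * |t|^2] on a fraction [Q / 32] of samples. *)
Lemma phaseless_lower_bound (q zeta Q : R) x y : 1 <= q -> 0 <= zeta -> 0 <= Q <= 1 ->
  (forall s t, sq_norm s = 1 -> sq_norm t = 1 -> im_inner s t = 0 ->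
    Q / 32 * m%:R <= (#|[set k | b k \in separated (@coord R n) reC imC zeta s t]%SET|)%:R) ->
  Q / 32 * (Num.sqrt zeta / 32) * m%:R `^ (1 / q) * dist x y ^+ 2 <=
  lnorm q (fun k => phaseless b x k - phaseless b y k).
Proof.
move=> q1 z0 /andP[Q0 Q1] sep.
have [s [t [im0 dt ts fact]]] := phaseless_factorization x y.
have A0 : 0 <= Q / 32 * (Num.sqrt zeta / 32) * m%:R `^ (1 / q).
  by rewrite mulr_ge0 ?powR_ge0// mulr_ge0// divr_ge0// sqrtr_ge0.
have t0 : 0 <= sq_norm t by apply: sumr_ge0 => j _; exact: sqr_ge0.
have [tz|tn] := eqVneq (sq_norm t) 0.
  apply: (@le_trans _ _ 0); last exact: powR_ge0.
  by apply: mulr_ge0_le0 => //; rewrite -tz.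
have tp : 0 < sq_norm t by rewrite lt_neqAle eq_sym tn.
have sp : 0 < sq_norm s by exact: lt_le_trans ts.
pose cs := (Num.sqrt (sq_norm s))^-1; pose ct := (Num.sqrt (sq_norm t))^-1.
have cs2 : cs ^+ 2 = (sq_norm s)^-1 by rewrite exprVn sqr_sqrtr// ltW.
have ct2 : ct ^+ 2 = (sq_norm t)^-1 by rewrite exprVn sqr_sqrtr// ltW.
pose c := Num.sqrt zeta / 32 * sq_norm t.
have c0 : 0 <= c by rewrite mulr_ge0// divr_ge0// sqrtr_ge0.
have H := sep (fun j => cs * s j) (fun j => ct * t j).
rewrite !sq_normZ im_innerZ cs2 ct2 !mulVf ?gt_eqF// im0 mulr0 in H.
have {}H := H erefl erefl erefl.
apply: (@le_trans _ _ (Q / 32 * c * m%:R `^ (1 / q))).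
  rewrite /c (_ : Q / 32 * (_ * sq_norm t) * _ = Q / 32 * (Num.sqrt zeta / 32) * m%:R `^ (1 / q) * sq_norm t).
    exact: ler_wpM2l.
  by rewrite !mulrA mulrAC.
apply: lnorm_ge_of_count => //.
  by apply/andP; split; [rewrite divr_ge0|lra].
apply: (le_trans H); rewrite ler_nat; apply/subset_leq_card/fintype.subsetP => k.
rewrite !finset.in_set => /set_mem; rewrite /separated /= prod_formZ => sk.
rewrite fact -ler_sqr ?nnegrE// real_normK ?num_real//.
move: sk; set p := prod_form _ _ _ _ _ _; rewrite exprMn exprMn cs2 ct2 => sk.
rewrite /c exprMn exprMn sqr_sqrtr// exprVn.
have st0 : 0 < sq_norm s * sq_norm t by exact: mulr_gt0.
move: sk; rewrite -invfM [X in _ <= X -> _]mulrC ler_pdivlMr// => sk; apply: le_trans sk.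
rewrite (_ : 32 ^+ 2 = 1024 :> R); last by rewrite -natrX.
apply: ler_wpM2l; first by apply: mulr_ge0; [exact: z0|rewrite invr_ge0 ler0n].
by rewrite expr2 ler_wpM2r.
Qed.

End Deterministic.

(** [f >= g^-2]: the product [f * g^2] equals [al ^ (4 / (4 + delta)) / ze]. So the
    assumed number of samples is of the order [n / Q^2] required by
    [uniform_separation] for [Q] proportional to [g]. *)
Lemma fconst_ge (R : realType) (delta al ze : R) : 0 < delta -> 1 <= al -> 0 < ze <= 1 ->
  1 <= fconst delta al ze * gconst delta al ze ^+ 2.
Proof.
move=> d0 a1 /andP[z0 z1]; rewrite /fconst /gconst.
have a0 : 0 < al by exact: lt_le_trans a1.
have sq (u r : R) : (u `^ r) ^+ 2 = u `^ (r * 2) by rewrite powRrM powR_mulrn ?powR_ge0.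
rewrite exprMn exprVn !sq.
set e1 := (32 + _) / _; set e2 := 3 + _; set e3 := (_ + 1) * 2; set e4 := _ * 2.
have e41 : e4 <= e1.
  have -> : e1 = e4 + 4 / (4 + delta).
    by rewrite /e1 /e4; field; rewrite !gt_eqF//; lra.
  by rewrite lerDl divr_ge0//; lra.
have e32 : e3 <= e2 by rewrite /e3 /e2; lra.
have z2 := powR_gt0 e2 z0; have a4 := powR_gt0 e4 a0.
have Ha : 1 <= al `^ e1 / al `^ e4 by rewrite ler_pdivlMr// mul1r ler_powR.
have Hz : 1 <= ze `^ e3 / ze `^ e2 by rewrite ler_pdivlMr// mul1r ger_powR// z0.
have := mulr_ege1 Ha Hz.
by rewrite mulrACA [X in _ -> _ <= X]mulrACA [_^-1 * _^-1]mulrC.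
Qed.

(** * Sample size and the stability estimate *)

Lemma global_const01 (R : realType) : 0 < global_const R <= 1.
Proof.
have /andP[c0 c1] := small_ball_const01 R 1; rewrite /global_const.
have k0 : 0 < 1024 :> R by rewrite ltr0n.
by rewrite divr_gt0// ler_pdivrMr// mul1r (le_trans c1)// ler1n.
Qed.

Lemma sample_size_suffices (R : realType) (M lc g f Q N k : R) :
  0 <= M -> 0 < lc -> 0 < g -> 0 <= N -> 1 <= f * g ^+ 2 -> lc * g <= Q ->
  M / lc ^+ 2 * f * N <= k -> M * N / Q ^+ 2 <= k.
Proof.
move=> M0 l0 g0 N0 fg lQ; apply: le_trans.
have lg : 0 < lc * g by exact: mulr_gt0.
have Q0 : 0 < Q by exact: lt_le_trans lQ.
apply: (@le_trans _ _ (M * N / (lc * g) ^+ 2)).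
  rewrite ler_wpM2l ?mulr_ge0// lef_pV2 ?posrE ?exprn_gt0// lerXn2r// nnegrE; exact: ltW.
rewrite exprMn invfM (_ : _ * (_ / _) = M / lc ^+ 2 * (g ^+ 2)^-1 * N); last first.
  by rewrite !mulrA [_ * N * _]mulrAC [_ * N * _]mulrAC.
rewrite ler_wpM2r// ler_wpM2l ?divr_ge0 ?sqr_ge0//.
by rewrite -[leLHS]div1r ler_pdivrMr ?exprn_gt0.
Qed.

Section FormsOfEntries.
Context {d' dv d0 : measure_display} {U : measurableType d'} {V : measurableType dv}.
Context {T0 : measurableType d0} {R : realType}.
Variables (n : nat) (co : 'I_n -> V -> U) (xf yf : U -> R) (a : T0 -> V).
Local Notation ent := (fun i w => co i (a w)).
Local Notation re s := (fun i => s (i, true)).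
Local Notation im s := (fun i => s (i, false)).

Lemma re_form_lin (s : 'I_n * bool -> R) w :
  re_form co xf yf s (a w) = lin_re ent (fun=> xf) (fun=> yf) (re s) (im s) w.
Proof.
by rewrite /re_form sum_pair_bool; apply: eq_bigr => i _; rewrite /re_coef /= ![s _ * _]mulrC.
Qed.

Lemma im_form_lin (s : 'I_n * bool -> R) w :
  im_form co xf yf s (a w) = lin_im ent (fun=> xf) (fun=> yf) (re s) (im s) w.
Proof.
by rewrite /im_form sum_pair_bool; apply: eq_bigr => i _; rewrite /im_coef /=; ring.
Qed.

Lemma prod_form_herm (s t : 'I_n * bool -> R) w :
  prod_form co xf yf s t (a w) = herm ent (re s) (im s) (re t) (im t) (fun=> xf) (fun=> yf) w.
Proof. by rewrite /prod_form !re_form_lin !im_form_lin. Qed.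

Lemma sq_norm_pairs (s : 'I_n * bool -> R) :
  sq_norm s = \sum_i (s (i, true) ^+ 2 + s (i, false) ^+ 2).
Proof. by rewrite /sq_norm sum_pair_bool. Qed.

End FormsOfEntries.

Theorem theorem5 (R : realType) :
  exists C2 : R, 0 < C2 /\
  forall delta : R, 0 < delta ->
  exists C1 C3 : R, 0 < C1 /\ 0 < C3 /\
  forall (q : R) (n m : nat), 1 <= q -> (0 < n)%N ->
  forall (d0 : measure_display) (T0 : measurableType d0)
    (P0 : probability T0 R) (a : {mfun T0 >-> borelCn R n}),
  mutually_independent P0
    (fun (i : 'I_n) (w : T0) => entry a i w : borelC R) ->
  (forall i : 'I_n, Cexpectation P0 (entry a i) = 0) ->
  (forall i : 'I_n, ('E_P0[fun w => (modulus (entry a i w) ^+ 2)%R] = 1)%E) ->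
  (alpha P0 a (4 + delta) < +oo)%E ->
  (1 < beta P0 a)%E ->
  gamma P0 a < 1 ->
  let al := fine (alpha P0 a (4 + delta)) in
  let ze := zeta P0 a in
  let f := fconst delta al ze in
  let g := gconst delta al ze in
  let h := hconst delta al ze in
  forall (d : measure_display) (T : measurableType d)
    (P : probability T R) (b : 'I_m -> {mfun T >-> borelCn R n}),
  mutually_independent P (fun k w => b k w) ->
  (forall k : 'I_m, is_copy P P0 (b k) a) ->
  C1 * f * n%:R <= m%:R ->
  exists E : set T,
    [/\ measurable E,
        ((1 - expR (- (C2 * m%:R * g ^+ 2)))%:E <= P E)%E &
        forall w, E w -> forall x y : 'cV[R[i]]_n,
          C3 * h * m%:R `^ (1 / q) * dist x y ^+ 2 <=
          lnorm q (fun k => phaseless (fun k => b k w) x k -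
                            phaseless (fun k => b k w) y k)].
Proof.
have /andP[gc0 gc1] := global_const01 R.
have n256 : 0 < 256 :> R by rewrite ltr0n.
have n1024 : 0 < 1024 :> R by rewrite ltr0n.
have M0 : 0 < 2 ^+ 17 :> R by exact: exprn_gt0.
exists (global_const R / 256); split; first exact: divr_gt0.
move=> delta d0; have /andP[lc0 lc1] := local_const01 d0.
exists (2 ^+ 17 / local_const delta ^+ 2), (local_const delta / 1024).
split; first by apply: divr_gt0 => //; exact: exprn_gt0.
split; first exact: divr_gt0.
move=> q n m q1 n0 dd T0 P0 a ind mean0 var1 alpha_fin b1 g1 al ze f g h d T P b indb copy mlarge.
pose reC := @complex.Re R : borelC R -> R; pose imC := @complex.Im R : borelC R -> R.
have mre : measurable_fun setT reC by exact: measurable_Re.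
have mim : measurable_fun setT imC by exact: measurable_Im.
have ma := measurable_entries a.
have p4 : 4 <= 4 + delta by rewrite lerDl ltW.
have x0 := mean_re mean0; have y0 := mean_im mean0; have n1 := mean_sqnorm var1.
have L1N := L1_sqnorm var1.
have LA := L1_moment alpha_fin; have EA := moment_le_alpha alpha_fin.
have gam0 := gamma_ge0 P0 a; have cov := covariance_le_gamma var1.
have B i := beta_le_moment p4 alpha_fin i b1.
have ze0 : 0 < ze.
  have /andP[fb _] := B (Ordinal n0).
  by rewrite /ze /zeta lt_min !subr_gt0 fb/= expr_lt1.
have n2 i : 1 + ze <= Ex P0 (fun w => sqnorm reC imC (coord i (a w)) ^+ 2).
  have /andP[_ fb] := B i; apply: le_trans fb.
  by rewrite addrC -lerBrDr /ze /zeta ge_min lexx.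
have zg : ze <= 1 - gamma P0 a ^+ 2 by rewrite /ze /zeta ge_min lexx orbT.
have z1 : ze <= 1 := zeta_le1 zg.
have al1 : 1 <= al.
  have := one_plus_zeta_le_moment ma mre mim n1 n0 n2 ze0 d0 LA EA; apply: le_trans; rewrite lerDl; exact: ltW.
have g0 : 0 < g := gconst_gt0 ma mre mim n1 n0 n2 ze0 d0 LA EA.
have gz : g <= ze := gconst_le_zeta ma mre mim n1 n0 n2 ze0 zg d0 LA EA.
(* The larger of the two small-ball rates: the first makes the number of samples
   and the lower bound linear in [g], the second gives the deviation a universal
   constant. *)
pose Q := Num.max (local_const delta * g) (global_const R * g ^+ 2).
have lQ : local_const delta * g <= Q by rewrite /Q le_max lexx.
have gQ : global_const R * g ^+ 2 <= Q by rewrite /Q le_max lexx orbT.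
have Q0 : 0 < Q by exact: lt_le_trans (mulr_gt0 lc0 g0) lQ.
have Qz : Q <= ze.
  have g01 : g <= 1 by exact: le_trans gz z1.
  rewrite /Q ge_max; apply/andP; split; apply: le_trans gz; first by rewrite ler_piMl// ltW.
  rewrite expr2 mulrA ler_piMl ?(ltW g0)//; apply: mulr_ile1 => //; exact: ltW.
have sb s t : balanced s t ->
    Q <= fine (P0 [set w | ze / 256 <= prod_form (@coord R n) reC imC s t (a w) ^+ 2]).
  case; rewrite !sq_norm_pairs => s1 t1 i1.
  under eq_set do rewrite prod_form_herm.
  rewrite /Q ge_max; apply/andP; split.
    exact: (small_ball_local ma ind mre mim x0 y0 n1 n0 n2 cov ze0 gam0 zg d0 LA EA s1 t1 i1).
  exact: (small_ball_global ma ind mre mim x0 y0 n1 n0 n2 cov ze0 gam0 zg d0 LA EA s1 t1 i1).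
have ft s (c : R) : 0 < c ->
    fine (P0 [set w | c < sq_form (@coord R n) reC imC s (a w)]) <= sq_norm s / c.
  move=> c0; rewrite sq_norm_pairs /sq_form.
  under eq_set do rewrite re_form_lin im_form_lin.
  exact: (linear_form_tail ma ind mre mim L1N x0 y0 n1).
have et (c : R) : 0 < c -> fine (P0 [set w | c * n%:R < energy (@coord R n) reC imC (a w)]) <= c^-1.
  by move=> c0; exact: (norm_tail L1N n1 c0 n0).
have mb k : measurable_fun setT (b k) by exact: measurable_funPT.
have law k (B' : set (borelCn R n)) : measurable B' -> P (b k @^-1` B') = P0 (a @^-1` B').
  exact: copy.
have ml : 2 ^+ 17 * n%:R / Q ^+ 2 <= m%:R.
  apply: (sample_size_suffices (ltW M0) lc0 g0 (ler0n _ n) _ lQ mlarge).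
  by apply: fconst_ge => //; rewrite ze0.
have mco i : measurable_fun setT (coord i : borelCn R n -> borelC R) by exact: measurable_entry.
have [E [mE PE sepE]] := uniform_separation mco mre mim n0 (measurable_funPT a) Q0 Qz z1 sb ft et mb indb law ml.
exists E; split=> //.
  apply: le_trans PE; rewrite lee_fin lerD2l lerN2 ler_expR lerN2.
  rewrite [leLHS]mulrAC [_ / 256 * _]mulrAC [leLHS]mulrAC -[leLHS]mulrA -[leRHS]mulrA.
  by rewrite ler_wpM2r// mulr_ge0 ?ler0n// invr_ge0 ltW.
move=> w Ew x y; have Q01 : 0 <= Q <= 1 by rewrite (ltW Q0) (le_trans Qz).
apply: le_trans (phaseless_lower_bound x y q1 (ltW ze0) Q01 (sepE w Ew)).
rewrite ler_wpM2r ?sqr_ge0// ler_wpM2r ?powR_ge0//.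
rewrite /h /hconst -/g div1r powR12_sqrt ?(ltW ze0)//.
rewrite (_ : _ * (g * _) = local_const delta * g * (Num.sqrt ze / 1024)); last first.
  by move: 1024^-1 => k; ring.
rewrite (_ : Q / 32 * _ = Q * (Num.sqrt ze / 1024)); last first.
  by rewrite -!mulrA; congr (_ * _); rewrite mulrCA -invfM -natrM.
apply: ler_wpM2r lQ; apply: mulr_ge0; first exact: sqrtr_ge0.
by rewrite invr_ge0 ltW.
Qed.
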